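(* Let $\nu>\eta>0$, $\nu\ge1$, $0<\theta\le2\nu$, and $\delta>0$. Then $$E_{22}(\Lambda_\theta^{\eta/2},(D^{\nu e_1},\ldots,D^{\nu e_d}))=d^{\eta/\theta}\left(\frac{\delta}{(2\pi)^{d/2}}\right)^{1-\eta/\nu},$$ and all methods $$\widehat m(y)=F^{-1}\left(a(\cdot)\psi_\theta^{\eta/2}(\cdot)y(\cdot)\right),$$ where $a$ is a measurable function satisfying (for almost all $\xi\in\mathbb R^d$) the condition $$\psi_\theta^\eta(\xi)\left(\frac{|1-a(\xi)|^2}{\lambda_2\sum_{j=1}^d|\xi_j|^{2\nu}}+\frac{|a(\xi)|^2}{(2\pi)^d\lambda_1}\right)\le1,$$ in which $$\lambda_1=\frac{d^{2\eta/\theta}}{(2\pi)^d}\left(1-\frac\eta\nu\right)\left(\frac{(2\pi)^d}{\delta^2}\right)^{\eta/\nu},\qquad \lambda_2=\frac\eta\nu d^{2\eta/\theta-1}\left(\frac{(2\pi)^d}{\delta^2}\right)^{\eta/\nu-1},$$ are optimal. Moreover, the inequality $$\|\Lambda_\theta^{\eta/2}x\|_{L_2(\mathbb R^d)}\le\frac{d^{\eta/\theta}}{(2\pi)^{d(1-\eta/\nu)/2}}\|Fx\|_{L_2(\mathbb R^d)}^{1-\eta/\nu}\left(\max_{1\le j\le d}\|D^{\nu e_j}x\|_{L_2(\mathbb R^d)}\right)^{\eta/\nu},\quad x\in X_2,$$ holds and is sharp (the constant cannot be replaced by a smaller one).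
   Context: $S'$ is the space of tempered distributions on $\mathbb R^d$ and $F\colon S'\to S'$ the Fourier transform, normalized by $Fx(\xi)=\int_{\mathbb R^d}x(t)e^{-i\langle t,\xi\rangle}dt$ (so $\|x\|_{L_2}=(2\pi)^{-d/2}\|Fx\|_{L_2}$). Functions are complex-valued. For $\alpha\in\mathbb R_+^d$, $\mathbb R_+=[0,\infty)$, $D^\alpha x=F^{-1}((i\xi)^\alpha Fx(\xi))$ with $(i\xi)^\alpha=(i\xi_1)^{\alpha_1}\cdots(i\xi_d)^{\alpha_d}$; $e_1,\ldots,e_d$ is the standard basis of $\mathbb R^d$. For $\theta>0$, $\psi_\theta(\xi)=(|\xi_1|^\theta+\ldots+|\xi_d|^\theta)^{2/\theta}$, and $\Lambda_\theta^{\eta/2}x=F^{-1}(\psi_\theta^{\eta/2}Fx)$ (so $\Lambda_2=-\Delta$). Put $$X_2=\{x\in S':\ (i\xi_j)^\nu Fx\in L_2(\mathbb R^d),\ j=1,\ldots,d,\ Fx\in L_2(\mathbb R^d)\},\quad W_2=\{x\in X_2:\ \|D^{\nu e_j}x\|_{L_2(\mathbb R^d)}\le1,\ j=1,\ldots,d\}.$$ For an arbitrary map (method) $m\colon L_2(\mathbb R^d)\to L_2(\mathbb R^d)$ its error is $$e_{22}(m)=\sup\{\|\Lambda_\theta^{\eta/2}x-m(y)\|_{L_2(\mathbb R^d)}:\ x\in W_2,\ y\in L_2(\mathbb R^d),\ \|Fx-y\|_{L_2(\mathbb R^d)}\le\delta\},$$ $E_{22}(\Lambda_\theta^{\eta/2},(D^{\nu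 e_1},\ldots,D^{\nu e_d}))=\inf_me_{22}(m)$, and a method attaining this infimum is called optimal. *)

(* Defs.v *)
From HB Require Import structures.
From mathcomp Require Import all_boot all_order all_algebra.
From mathcomp Require Import complex.
From mathcomp Require Import all_classical all_reals all_analysis.

Set Implicit Arguments.
Unset Strict Implicit.
Unset Printing Implicit Defensive.

Import Order.TTheory GRing.Theory Num.Theory.
Import numFieldNormedType.Exports.
Import ComplexField.Normc.

Local Open Scope classical_set_scope.
Local Open Scope ring_scope.
Local Open Scope complex_scope.

(* 'rV[T]_n carries the product sigma-algebra (for T = R, the Borel one). *)
Definition measure_rV_display : measure_display -> measure_display.
Proof. exact. Qed.

Section measurable_rV.
Context {disp : measure_display} {T : measurableType disp}.
Variable n : nat.

Let coors : 'I_n -> 'rV[T]_n -> T := fun i x => x ord0 i.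

Let rV_set0 : g_sigma_preimage coors set0.
Proof. exact: sigma_algebra0. Qed.

Let rV_setC A : g_sigma_preimage coors A -> g_sigma_preimage coors (~` A).
Proof. exact: sigma_algebraC. Qed.

Let rV_bigcup (F : _^nat) : (forall i, g_sigma_preimage coors (F i)) ->
  g_sigma_preimage coors (\bigcup_i (F i)).
Proof. exact: sigma_algebra_bigcup. Qed.

HB.instance Definition _ := @isMeasurable.Build (measure_rV_display disp)
  'rV[T]_n (g_sigma_preimage coors) rV_set0 rV_setC rV_bigcup.

End measurable_rV.

Lemma measurable_coord disp (T : measurableType disp) n (i : 'I_n) :
  measurable_fun [set: 'rV[T]_n] (fun x => x ord0 i).
Proof.
move=> _ Y mY; rewrite setTI; apply: sub_sigma_algebra => /=.
rewrite -bigcup_seq/=; exists i => /=; first by rewrite mem_index_enum.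
by exists Y => //; rewrite setTI.
Qed.

Lemma measurable_fun_coordP d1 d2 (T1 : measurableType d1)
    (T2 : measurableType d2) n (f : T1 -> 'rV[T2]_n) :
  measurable_fun [set: T1] f <->
  forall i, measurable_fun [set: T1] (fun x => f x ord0 i).
Proof.
split=> [mf i|mf]; first exact: measurableT_comp (measurable_coord i) mf.
move=> _ Y mY; rewrite setTI.
suff : (<<s \big[setU/set0]_(i < n) preimage_set_system setT
    (fun x : 'rV[T2]_n => x ord0 i) measurable >> `<=`
    [set Y | measurable (f @^-1` Y)]) by exact.
apply: smallest_sub.
  split => /=.
  - by rewrite preimage_set0.
  - by move=> A mA; rewrite setTD preimage_setC; exact: measurableC.
  - by move=> F mF; rewrite preimage_bigcup; exact: bigcupT_measurable.
rewrite -bigcup_seq/=; apply: bigcup_sub => i _ _ [B mB <-] /=.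
by rewrite setTI; have := mf i measurableT B mB; rewrite setTI.
Qed.

Section lebesgue_rV.
Variable R : realType.

Definition cons_rV n (p : measurableTypeR R * 'rV[R]_n) : 'rV[R]_n.+1 :=
  \row_i oapp (p.2 ord0) (p.1 : R) (unlift ord0 i).

Lemma measurable_cons_rV n : measurable_fun setT (@cons_rV n).
Proof.
apply/measurable_fun_coordP => i.
case: (unliftP ord0 i) => [j|] ->.
  rewrite (_ : (fun _ => _) = (fun v : 'rV[R]_n => v ord0 j) \o snd).
    exact: measurableT_comp (measurable_coord j) measurable_snd.
  by apply/funext => p /=; rewrite mxE liftK.
rewrite (_ : (fun _ => _) = (id : measurableTypeR R -> R) \o fst).
  by apply: measurableT_comp => //.
by apply/funext => p /=; rewrite mxE unlift_none.
Qed.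

Definition uncons_rV n (v : 'rV[R]_n.+1) : measurableTypeR R * 'rV[R]_n :=
  (v ord0 ord0, \row_j v ord0 (lift ord0 j)).

Lemma measurable_uncons_rV n : measurable_fun setT (@uncons_rV n).
Proof.
apply/measurable_fun_pairP; split; first exact: measurable_coord.
apply/measurable_fun_coordP => j.
rewrite (_ : (fun _ => _) = (fun v : 'rV[R]_n.+1 => v ord0 (lift ord0 j))).
  exact: measurable_coord.
by apply/funext => v /=; rewrite mxE.
Qed.

Lemma cons_rVK n : cancel (@cons_rV n) (@uncons_rV n).
Proof.
case=> x v; rewrite /uncons_rV /cons_rV mxE unlift_none /=; congr pair.
by apply/rowP => j; rewrite !mxE liftK.
Qed.

Section cons_measure.
Variables (n : nat) (mu : {sigma_finite_measure set 'rV[R]_n -> \bar R}).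

Definition cons_measure : set 'rV[R]_n.+1 -> \bar R :=
  pushforward ((@lebesgue_measure R) \x mu)%E (@cons_rV n).

Let push : {measure set 'rV[R]_n.+1 -> \bar R} :=
  @measure_function_pushforward__canonical__measure_function_Measure _ _ _ _ _
   ((@lebesgue_measure R) \x mu)%E (@cons_rV n) (@measurable_cons_rV n).

Let cons_measure0 : cons_measure set0 = 0%E.
Proof. exact: (measure0 push). Qed.

Let cons_measure_ge0 A : (0 <= cons_measure A)%E.
Proof. exact: (measure_ge0 push). Qed.

Let cons_measure_sigma_additive : semi_sigma_additive cons_measure.
Proof. exact: (@measure_semi_sigma_additive _ _ _ push). Qed.

HB.instance Definition _ := isMeasure.Build _ _ _ cons_measure
  cons_measure0 cons_measure_ge0 cons_measure_sigma_additive.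

Let cons_measure_sigma_finite : sigma_finite setT cons_measure.
Proof.
have /sigma_finiteP[F [FT ndF Foo]] := sigma_finiteT (@lebesgue_measure R).
have /sigma_finiteP[G [GT ndG Goo]] := sigma_finiteT mu.
exists (fun k => @uncons_rV n @^-1` (F k `*` G k)).
  rewrite -preimage_bigcup; apply/esym; rewrite -subTset => v _ /=.
  have [i _ Fi] : (\bigcup_k F k) (uncons_rV v).1 by rewrite -FT.
  have [j _ Gj] : (\bigcup_k G k) (uncons_rV v).2 by rewrite -GT.
  exists (maxn i j) => //; split.
  - by move: (_.1) Fi; exact/subsetPset/ndF/leq_maxl.
  - by move: (_.2) Gj; exact/subsetPset/ndG/leq_maxr.
move=> k; have [mF Fk] := Foo k; have [mG Gk] := Goo k; split.
  rewrite -[X in measurable X]setTI; apply: measurable_uncons_rV => //.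
  exact: measurableX.
rewrite /cons_measure /pushforward -comp_preimage.
rewrite (_ : _ \o _ = id); last by apply/funext => p; exact: cons_rVK.
by rewrite preimage_id product_measure1E// lte_mul_pinfty// ge0_fin_numE.
Qed.

HB.instance Definition _ := Measure_isSigmaFinite.Build _ _ _ cons_measure
  cons_measure_sigma_finite.

End cons_measure.

Fixpoint lebesgue_rV n : {sigma_finite_measure set 'rV[R]_n -> \bar R} :=
  match n with
  | 0 => dirac (0 : 'rV[R]_0)
  | m.+1 => cons_measure (lebesgue_rV m)
  end.

Lemma lebesgue_rV_box n (A : 'I_n -> set (measurableTypeR R)) :
  (forall i, measurable (A i)) ->
  lebesgue_rV n [set v | forall i, A i (v ord0 i)] =
  (\prod_(i < n) lebesgue_measure (A i))%E.
Proof.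
elim: n A => [A _|n IH A mA].
  rewrite big_ord0 /= diracE mem_set//=; by case.
pose B : set 'rV[R]_n := [set v | forall i, A (lift ord0 i) (v ord0 i)].
have mB : measurable B.
  rewrite (_ : B = \big[setI/setT]_(i < n)
      ((fun v : 'rV[R]_n => v ord0 i) @^-1` A (lift ord0 i))).
    apply: bigsetI_measurable => i _; rewrite -[X in measurable X]setTI.
    exact: (@measurable_coord _ _ _ i measurableT _ (mA _)).
  rewrite -bigcap_seq; apply/seteqP; split => v /= vA i; first by move=> _.
  by apply: (vA i) => /=; rewrite mem_index_enum.
rewrite big_ord_recl -(IH (fun j => A (lift ord0 j)))// -/B.
rewrite -[RHS](product_measure1E (@lebesgue_measure R) (lebesgue_rV n))//.
congr ((lebesgue_measure \x lebesgue_rV n)%E _).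
apply/seteqP; split => -[x v] /=.
  move=> h; split; first by have := h ord0; rewrite mxE unlift_none.
  by move=> i; have := h (lift ord0 i); rewrite mxE liftK.
move=> [Ax h] i; rewrite mxE; case: (unliftP ord0 i) => [j ->|->] //=.
Qed.

End lebesgue_rV.

Section functions.
Context {R : realType} {d : nat}.
Local Notation E := 'rV[R]_d.
Local Notation C := R[i].
Local Notation leb := (lebesgue_rV R d).
Implicit Types (f g h : E -> C) (T U : (E -> C) -> C).

Definition cmeasurable f : Prop :=
  measurable_fun setT (fun x => complex.Re (f x)) /\
  measurable_fun setT (fun x => complex.Im (f x)).

(* Measurability with respect to the completed (Lebesgue) sigma-algebra. *)
Definition lebesgue_cmeasurable f : Prop :=
  exists2 g, cmeasurable g & {ae leb, forall x, f x = g x}.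

Definition cintegral f : C :=
  (\int[leb]_x complex.Re (f x)) +i* (\int[leb]_x complex.Im (f x)).

Definition l2norm f : \bar R := Lnorm leb 2%:E (fun x => (normc (f x))%:E).

(* Elements of L_2(R^d) are represented by Borel functions, identified when
   they agree almost everywhere. *)
Definition L2 : set (E -> C) :=
  [set f | cmeasurable f /\ (l2norm f < +oo)%E].

Definition pderiv (j : 'I_d) f : E -> C := fun x =>
  ('D_(delta_mx ord0 j) (fun y => complex.Re (f y)) x)
  +i* ('D_(delta_mx ord0 j) (fun y => complex.Im (f y)) x).

Definition pderivable (j : 'I_d) f : Prop := forall x : E,
  derivable (fun y => complex.Re (f y)) x (delta_mx ord0 j) /\
  derivable (fun y => complex.Im (f y)) x (delta_mx ord0 j).

Definition pderivs (s : seq 'I_d) f : E -> C := foldr pderiv f s.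

(* M bounds the k-th Schwartz seminorm of f. *)
Definition schwartz_bound (k : nat) f (M : R) : Prop :=
  forall (s : seq 'I_d) (x : E), (size s <= k)%N ->
    (1 + `|x|) ^+ k * normc (pderivs s f x) <= M.

(* The space S. Continuity of the iterated partial derivatives is not required
   separately: partial derivatives that exist everywhere and are bounded make a
   function Lipschitz. *)
Definition schwartz : set (E -> C) :=
  [set f | (forall s j, pderivable j (pderivs s f)) /\
           (forall k, exists M, schwartz_bound k f M)].

(* The space S' of continuous linear functionals on S. A distribution is
   encoded as a function on all of E -> C of which only the values on S matter;
   equality in S' is [dist_eq]. *)
Definition tempered : set ((E -> C) -> C) :=
  [set T | (forall (c : C) f g, schwartz f -> schwartz g ->
              T (fun x => c * f x + g x) = c * T f + T g) /\
           (exists (k : nat) (K : R), forall f M, schwartz f ->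
              schwartz_bound k f M -> normc (T f) <= K * M)].

Definition dist_eq T U : Prop := forall f, schwartz f -> T f = U f.

Definition regular g : (E -> C) -> C := fun f => cintegral (fun x => g x * f x).

Definition dist_sub T U : (E -> C) -> C := fun f => T f - U f.

Definition cis (t : R) : C := cos t +i* sin t.

Definition dotp (t xi : E) : R := \sum_j t ord0 j * xi ord0 j.

Definition fourier_fun f : E -> C := fun xi =>
  cintegral (fun t => f t * cis (- dotp t xi)).

Definition inv_fourier_fun f : E -> C := fun t =>
  ((2 * pi) ^- d)%:C * cintegral (fun xi => f xi * cis (dotp t xi)).

Definition fourier T : (E -> C) -> C := fun f => T (fourier_fun f).

Definition inv_fourier T : (E -> C) -> C := fun f => T (inv_fourier_fun f).

Definition represents T : set (E -> C) :=
  [set g | L2 g /\ dist_eq T (regular g)].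

Definition in_L2 T : Prop := exists g, represents T g.

(* The L_2 norm of a distribution; it is +oo when T is not in L_2(R^d), and
   otherwise it is the norm of the (a.e. unique) function representing T. *)
Definition dist_l2norm T : \bar R :=
  ereal_inf [set l2norm g | g in represents T].

(* The product w T for T in L_2(R^d), formed as the product of w with the
   function representing T. *)
Definition mul_L2 (w : E -> C) T : (E -> C) -> C :=
  regular (fun x => w x * xget (fun=> 0) (represents T) x).

(* (i t)^nu = |t|^nu e^(i pi nu sgn(t) / 2), the principal branch; note that
   0 `^ 0 = 1 and 0 `^ nu = 0 for nu <> 0. *)
Definition ipow (nu t : R) : C :=
  (`|t| `^ nu)%:C * cis (Num.sg t * nu * pi / 2).

Definition frac_deriv (alpha : E) T : (E -> C) -> C :=
  inv_fourier (mul_L2 (fun xi => \prod_j ipow (alpha ord0 j) (xi ord0 j))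
                      (fourier T)).

Definition psi (theta : R) (xi : E) : R :=
  (\sum_j `|xi ord0 j| `^ theta) `^ (2 / theta).

(* Lambda theta eta is the operator Lambda_theta^(eta/2). *)
Definition Lambda (theta eta : R) T : (E -> C) -> C :=
  inv_fourier (mul_L2 (fun xi => (psi theta xi `^ (eta / 2))%:C) (fourier T)).

Definition X2 (nu : R) : set ((E -> C) -> C) :=
  [set T | [/\ tempered T,
     forall j, in_L2 (mul_L2 (fun xi => ipow nu (xi ord0 j)) (fourier T)) &
     in_L2 (fourier T)]].

Definition D_nu (nu : R) (j : 'I_d) T : (E -> C) -> C :=
  frac_deriv (nu *: delta_mx ord0 j) T.

Definition W2 (nu : R) : set ((E -> C) -> C) :=
  [set T | X2 nu T /\ forall j, (dist_l2norm (D_nu nu j T) <= 1)%E].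

Definition is_method (m : (E -> C) -> (E -> C)) : Prop :=
  (forall y, L2 y -> L2 (m y)) /\
  (forall y z, L2 y -> L2 z -> {ae leb, forall x, y x = z x} ->
     {ae leb, forall x, m y x = m z x}).

Definition method_error (theta eta nu delta : R) (m : (E -> C) -> (E -> C)) :
    \bar R :=
  ereal_sup [set e | exists T y, [/\ W2 nu T, L2 y,
    (dist_l2norm (dist_sub (fourier T) (regular y)) <= delta%:E)%E &
    e = dist_l2norm (dist_sub (Lambda theta eta T) (regular (m y)))]].

Definition optimal_error (theta eta nu delta : R) : \bar R :=
  ereal_inf [set method_error theta eta nu delta m | m in is_method].

Definition optimal_method (theta eta nu delta : R)
    (m : (E -> C) -> (E -> C)) : Prop :=
  is_method m /\
  method_error theta eta nu delta m = optimal_error theta eta nu delta.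

(* m(y) = F^-1(a psi_theta^(eta/2) y) as an element of L_2(R^d), the product
   being again in L_2(R^d); g is a Borel representative of it. *)
Definition multiplier_method (theta eta : R) (a : E -> C)
    (m : (E -> C) -> (E -> C)) : Prop :=
  is_method m /\
  forall y, L2 y -> exists g, [/\ L2 g,
    {ae leb, forall xi, g xi = a xi * (psi theta xi `^ (eta / 2))%:C * y xi} &
    dist_eq (regular (m y)) (inv_fourier (regular g))].

End functions.

Definition lambda1 {R : realType} (d : nat) (theta eta nu delta : R) : R :=
  d%:R `^ (2 * eta / theta) / (2 * pi) ^+ d * (1 - eta / nu)
  * ((2 * pi) ^+ d / delta ^+ 2) `^ (eta / nu).

Definition lambda2 {R : realType} (d : nat) (theta eta nu delta : R) : R :=
  eta / nu * d%:R `^ (2 * eta / theta - 1)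
  * ((2 * pi) ^+ d / delta ^+ 2) `^ (eta / nu - 1).

(* At xi = 0 the first denominator vanishes; this is a null set. *)
Definition multiplier_condition {R : realType} {d : nat}
    (theta eta nu delta : R) (a : 'rV[R]_d -> R[i]) : Prop :=
  {ae lebesgue_rV R d, forall xi : 'rV[R]_d,
    psi theta xi `^ eta *
    (normc (1 - a xi) ^+ 2 /
       (lambda2 d theta eta nu delta * \sum_j `|xi ord0 j| `^ (2 * nu))
     + normc (a xi) ^+ 2 / ((2 * pi) ^+ d * lambda1 d theta eta nu delta))
    <= 1}.

Definition multiplicative_inequality {R : realType} (d : nat)
    (theta eta nu c : R) : Prop :=
  forall T : ('rV[R]_d -> R[i]) -> R[i], X2 nu T ->
  (dist_l2norm (Lambda theta eta T) <=
   c%:E * dist_l2norm (fourier T) `^ (1 - eta / nu)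
        * (\big[maxe/0]_(j < d) dist_l2norm (D_nu nu j T)) `^ (eta / nu))%E.

(* Main.v *)
(* Write g = Fx, S = sum_j |xi_j|^(2 nu) and rho = (2 pi)^d / delta^2.  The
   power mean inequality (as theta <= 2 nu) followed by the weighted
   arithmetic-geometric mean inequality gives, pointwise,
     psi_theta^eta <= d^(2 eta / theta) (S / d)^(eta / nu)
                   <= lambda_2 S + (2 pi)^d lambda_1.
   By Plancherel and the Cauchy-Schwarz inequality, the condition on a yields
     psi_theta^eta |g - a y|^2 <= lambda_2 S |g|^2 + (2 pi)^d lambda_1 |g - y|^2,
   and integrating gives the upper bound; a = L / (L + lambda_2 S) with
   L = (2 pi)^d lambda_1 satisfies the condition.  Letting rho vary in the
   first inequality gives the multiplicative inequality.  Functions g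
   concentrated near the point where all |xi_j|^(2 nu) equal rho make every
   inequality tight; since the datum y = 0 is compatible with both g and - g,
   they also bound the error of an arbitrary method from below.
     The Plancherel theorem is obtained from real-variable tools: damping by
   exp(- e (|xi_1| + ... + |xi_d|)), whose Fourier transform is a product of
   Poisson kernels, bounds the Fourier transform on L_1 and L_2, and the
   extension to L_2 is inverted by testing against tensor products of
   one-variable Schwartz functions, where inversion is again a Poisson kernel
   computation. *)
Require Import Defs.
From mathcomp Require Import all_boot all_order all_algebra.
From mathcomp Require Import complex.
From mathcomp Require Import all_classical all_reals all_analysis.
From mathcomp Require Import measurable_realfun.
From mathcomp Require Import ring lra.
Import Order.TTheory GRing.Theory Num.Theory.
Import numFieldNormedType.Exports.
Import ComplexField.Normc.
Local Open Scope classical_set_scope.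
Local Open Scope ring_scope.

Set Implicit Arguments.
Unset Strict Implicit.
Unset Printing Implicit Defensive.
Local Open Scope complex_scope.

(** * Complex-valued integrals *)

Section complex_facts.
Context {R : realType}.
Implicit Types z w : R[i].

(** Distributions are handled through one function: [Fx] is represented by some g in L_2, and the
    norms in the statement become integrals of |g|^2 against weights ([X2_represents], [X2_surj]). A
    distribution that has to be exhibited is taken regular with square-integrable density, so that
    it can be paired with the Fourier transform of a test function, which is square integrable as
    well. The obstacle lies in X_2. That (i xi_j)^nu Fx is in L_2 only says that g times a growing
    weight acts on test functions like some k in L_2; the product itself is not yet known to be in
    L_2. Equality almost everywhere has to be read off from test functions so small that weight
    times test function stays in L_2: hence tests dominated by a Gaussian, which approximate the
    Gaussian cut off to quadrants. The numbers lambda_1, lambda_2 are the Lagrange multipliers of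
    maximising the integral of psi_theta^eta |g|^2 under bounds on the integrals of |g|^2 and
    |xi_j|^(2 nu) |g|^2; lambda_2 S + (2 pi)^d lambda_1 is the tangent at S = d rho of the concave
    function d^(2 eta / theta) (S / d)^(eta / nu). *)

Lemma normc_ge0 z : 0 <= normc z.
Proof. by case: z => a b; rewrite /normc sqrtr_ge0. Qed.

Lemma sqr_normc z : normc z ^+ 2 = complex.Re z ^+ 2 + complex.Im z ^+ 2.
Proof. by case: z => a b; rewrite /normc sqr_sqrtr// addr_ge0 ?sqr_ge0. Qed.

Lemma normc_def z : (normc z)%:C = `|z|.
Proof. by case: z. Qed.

Lemma normcD z w : normc (z + w) <= normc z + normc w.
Proof. by rewrite -lecR rmorphD/= !normc_def ler_normD. Qed.

Lemma normcN z : normc (- z) = normc z.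
Proof. by apply: (@complexI R); rewrite !normc_def normrN. Qed.

Lemma normcB z w : normc (z - w) <= normc z + normc w.
Proof. by rewrite (le_trans (normcD _ _))// normcN. Qed.

Lemma normc_real (r : R) : normc r%:C = `|r|.
Proof. by rewrite /normc/= expr0n addr0 sqrtr_sqr. Qed.

Lemma normc_Re z : `|complex.Re z| <= normc z.
Proof.
rewrite -(@ler_pXn2r _ 2) ?nnegrE ?normc_ge0//.
by rewrite sqr_normc real_normK ?num_real// lerDl sqr_ge0.
Qed.

Lemma normc_Im z : `|complex.Im z| <= normc z.
Proof.
rewrite -(@ler_pXn2r _ 2) ?nnegrE ?normc_ge0//.
by rewrite sqr_normc real_normK ?num_real// lerDr sqr_ge0.
Qed.

Lemma Re_add z w : complex.Re (z + w) = complex.Re z + complex.Re w.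
Proof. by case: z; case: w. Qed.

Lemma Im_add z w : complex.Im (z + w) = complex.Im z + complex.Im w.
Proof. by case: z; case: w. Qed.

Lemma Re_opp z : complex.Re (- z) = - complex.Re z.
Proof. by case: z. Qed.

Lemma Im_opp z : complex.Im (- z) = - complex.Im z.
Proof. by case: z. Qed.

Lemma Re_mul z w : complex.Re (z * w) =
  complex.Re z * complex.Re w - complex.Im z * complex.Im w.
Proof. by case: z; case: w. Qed.

Lemma Im_mul z w : complex.Im (z * w) =
  complex.Re z * complex.Im w + complex.Im z * complex.Re w.
Proof. by case: z => a b; case: w => c d /=; rewrite mulrC. Qed.

Lemma mulc_conj z : z * z^*%C = (normc z ^+ 2)%:C.
Proof.
rewrite sqr_normc; case: z => a b; apply/eqP; rewrite eq_complex/=.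
by apply/andP; split; apply/eqP; ring.
Qed.

Lemma normc_conj z : normc z^*%C = normc z.
Proof. by case: z => a b; rewrite /normc/= sqrrN. Qed.

(** Supplies the unimodular constant that turns a complex integral into a nonnegative real one in
    [normc_cint]. *)
Lemma unit_rotation z : exists2 c : R[i], normc c = 1 & c * z = (normc z)%:C.
Proof.
have [->|z0] := eqVneq z 0; first by exists 1; rewrite ?normc1// mulr0 normc0.
have nz : normc z != 0 by apply: contra z0 => /eqP/eq0_normc ->.
exists (z^*%C / (normc z)%:C).
  by rewrite normcM normcV normc_conj normc_real ger0_norm ?normc_ge0// divff.
rewrite mulrAC (mulrC _ z) mulc_conj -fmorphV -rmorphM/=.
by rewrite expr2 mulfK.
Qed.

Lemma cisD (s t : R) : cis (s + t) = cis s * cis t.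
Proof.
by apply/eqP; rewrite eq_complex/= cosD sinD addrC eqxx/= addrC mulrC eqxx.
Qed.

Lemma cis0 : cis 0 = 1 :> R[i].
Proof. by rewrite /cis cos0 sin0. Qed.

Lemma normc_cis (t : R) : normc (cis t) = 1.
Proof. by rewrite /normc/= cos2Dsin2 sqrtr1. Qed.

Lemma cis_sum (I : Type) (s : seq I) (P : pred I) (F : I -> R) :
  cis (\sum_(i <- s | P i) F i) = \prod_(i <- s | P i) cis (F i).
Proof. by apply: (big_morph _ cisD); exact: cis0. Qed.

Lemma conj_cis (t : R) : (cis t)^*%C = cis (- t).
Proof. by rewrite /cis cosN sinN. Qed.

End complex_facts.

Section complex_measurable.
Context d (T : measurableType d) {R : realType}.
Implicit Types f g : T -> R[i].

(** [cmeasurable] over an arbitrary measurable type: the Fubini arguments need it on the line and on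
    products. *)
Definition cmeas f := measurable_fun setT (fun x => complex.Re (f x)) /\
  measurable_fun setT (fun x => complex.Im (f x)).

Lemma cmeas_cst (c : R[i]) : cmeas (fun=> c).
Proof. by split; exact: measurable_cst. Qed.

Lemma cmeasD f g : cmeas f -> cmeas g -> cmeas (fun x => f x + g x).
Proof.
move=> [f1 f2] [g1 g2]; split.
  by under eq_fun do rewrite Re_add; exact: measurable_funD.
by under eq_fun do rewrite Im_add; exact: measurable_funD.
Qed.

Lemma cmeasN f : cmeas f -> cmeas (fun x => - f x).
Proof.
move=> [f1 f2]; split.
  by under eq_fun do rewrite Re_opp; exact: measurableT_comp.
by under eq_fun do rewrite Im_opp; exact: measurableT_comp.
Qed.

Lemma cmeasB f g : cmeas f -> cmeas g -> cmeas (fun x => f x - g x).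
Proof. by move=> mf mg; apply: cmeasD => //; exact: cmeasN. Qed.

Lemma cmeasM f g : cmeas f -> cmeas g -> cmeas (fun x => f x * g x).
Proof.
move=> [f1 f2] [g1 g2]; split.
  under eq_fun do rewrite Re_mul.
  by apply: measurable_funB; exact: measurable_funM.
under eq_fun do rewrite Im_mul.
by apply: measurable_funD; exact: measurable_funM.
Qed.

Lemma cmeas_conj f : cmeas f -> cmeas (fun x => (f x)^*%C).
Proof.
move=> [f1 f2]; split.
  by rewrite (_ : (fun _ => _) = (fun x => complex.Re (f x)))//;
    apply/funext => x; case: (f x).
rewrite (_ : (fun _ => _) = (fun x => - complex.Im (f x))).
  exact: measurableT_comp.
by apply/funext => x; case: (f x).
Qed.

Lemma cmeas_real (u : T -> R) : measurable_fun setT u -> cmeas (fun x => (u x)%:C).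
Proof. by move=> mu; split => //=; exact: measurable_cst. Qed.

Lemma cmeas_normc f : cmeas f -> measurable_fun setT (fun x => normc (f x)).
Proof.
move=> [f1 f2].
rewrite (_ : (fun _ => _) =
  (fun x => Num.sqrt (complex.Re (f x) ^+ 2 + complex.Im (f x) ^+ 2))); last first.
  by apply/funext => x; case: (f x).
apply: (@measurableT_comp _ _ _ _ _ _ (@Num.sqrt R)) => //.
  apply: continuous_measurable_fun; exact: sqrt_continuous.
by apply: measurable_funD; exact: measurable_funX.
Qed.

Lemma cmeas_normcE f : cmeas f -> measurable_fun setT (fun x => (normc (f x))%:E).
Proof. by move=> mf; apply/measurable_EFinP; exact: cmeas_normc. Qed.

Lemma cmeas_normc2 f : cmeas f ->
  measurable_fun setT (fun x => (normc (f x) ^+ 2)%:E).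
Proof.
by move=> mf; apply/measurable_EFinP/measurable_funX; exact: cmeas_normc.
Qed.

Lemma cmeas_prod (I : Type) (s : seq I) (P : pred I) (F : I -> T -> R[i]) :
  (forall i, P i -> cmeas (F i)) -> cmeas (fun x => \prod_(i <- s | P i) F i x).
Proof.
move=> mF; elim: s => [|i s IH].
  by under eq_fun do rewrite big_nil; exact: cmeas_cst.
under eq_fun do rewrite big_cons.
by have [Pi|//] := boolP (P i); apply: cmeasM => //; exact: mF.
Qed.

Lemma cmeas_cis (u : T -> R) : measurable_fun setT u -> cmeas (fun x => cis (u x)).
Proof.
move=> mu; split => /=; apply: measurableT_comp => //;
  apply: continuous_measurable_fun.
- exact: continuous_cos.
- exact: continuous_sin.
Qed.

End complex_measurable.

Lemma cmeas_comp d1 d2 (T1 : measurableType d1) (T2 : measurableType d2)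
    (R : realType) (f : T2 -> R[i]) (h : T1 -> T2) :
  measurable_fun setT h -> cmeas f -> cmeas (f \o h).
Proof.
by move=> mh [f1 f2]; split; [exact: (measurableT_comp f1)|
  exact: (measurableT_comp f2)].
Qed.

Section complex_integral.
Context d (T : measurableType d) {R : realType} (mu : {measure set T -> \bar R}).
Implicit Types f g : T -> R[i].

Definition cintegrable f :=
  cmeas f /\ (\int[mu]_x (normc (f x))%:E < +oo)%E.

(** Unfolds to [cintegral] when the measure is [lebesgue_rV R d]; the measure is a parameter because
    the line and product measures occur as well. *)
Definition cint f : R[i] :=
  (\int[mu]_x complex.Re (f x)) +i* (\int[mu]_x complex.Im (f x)).

Lemma cintegrable_le f (g : T -> R) : cmeas f -> measurable_fun setT g ->
  (\int[mu]_x (g x)%:E < +oo)%E -> (forall x, normc (f x) <= g x) ->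
  cintegrable f.
Proof.
move=> mf mg ig fg; split => //; apply: le_lt_trans ig.
apply: ge0_le_integral => //.
- by move=> x _; rewrite lee_fin normc_ge0.
- exact: cmeas_normcE.
- exact/measurable_EFinP.
- by move=> x _; rewrite lee_fin.
Qed.

Lemma cintegrable_real_le (h : T -> R) f : cintegrable f ->
  measurable_fun setT h -> (forall x, `|h x| <= normc (f x)) ->
  mu.-integrable setT (EFin \o h).
Proof.
move=> [mf If] mh hf; apply/integrableP; split; first exact/measurable_EFinP.
apply: le_lt_trans If; apply: ge0_le_integral => //.
- by apply/measurable_EFinP; exact: measurableT_comp.
- exact: cmeas_normcE.
- by move=> x _; rewrite /= lee_fin hf.
Qed.

Lemma cintegrable_Re f : cintegrable f ->
  mu.-integrable setT (EFin \o (fun x => complex.Re (f x))).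
Proof.
move=> If; apply: (cintegrable_real_le If); first exact: If.1.1.
by move=> x; exact: normc_Re.
Qed.

Lemma cintegrable_Im f : cintegrable f ->
  mu.-integrable setT (EFin \o (fun x => complex.Im (f x))).
Proof.
move=> If; apply: (cintegrable_real_le If); first exact: If.1.2.
by move=> x; exact: normc_Im.
Qed.

Lemma cintegrable_normc f : cintegrable f ->
  mu.-integrable setT (EFin \o (fun x => normc (f x))).
Proof.
move=> If; apply: (cintegrable_real_le If); first exact: cmeas_normc If.1.
by move=> x; rewrite ger0_norm ?normc_ge0.
Qed.

Lemma cintegrableD f g : cintegrable f -> cintegrable g ->
  cintegrable (fun x => f x + g x).
Proof.
move=> [mf If] [mg Ig].
apply: (@cintegrable_le _ (fun x => normc (f x) + normc (g x))).
- exact: cmeasD.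
- by apply: measurable_funD; exact: cmeas_normc.
- under eq_integral do rewrite EFinD.
  rewrite ge0_integralD//; first exact: lte_add_pinfty.
  + by move=> x _; rewrite lee_fin normc_ge0.
  + exact: cmeas_normcE.
  + by move=> x _; rewrite lee_fin normc_ge0.
  + exact: cmeas_normcE.
- by move=> x; exact: normcD.
Qed.

Lemma cintegrableZ (c : R[i]) f : cintegrable f ->
  cintegrable (fun x => c * f x).
Proof.
move=> [mf If]; split; first by apply: cmeasM => //; exact: cmeas_cst.
under eq_integral do rewrite normcM EFinM.
rewrite ge0_integralZl//.
- by rewrite lte_mul_pinfty// lee_fin normc_ge0.
- exact: cmeas_normcE.
- by move=> x _; rewrite lee_fin normc_ge0.
- by rewrite lee_fin normc_ge0.
Qed.

Lemma cintegrableN f : cintegrable f -> cintegrable (fun x => - f x).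
Proof.
move=> If; have := cintegrableZ (-1) If.
by under eq_fun do rewrite mulN1r.
Qed.

Lemma cintegrableB f g : cintegrable f -> cintegrable g ->
  cintegrable (fun x => f x - g x).
Proof. by move=> If Ig; apply: cintegrableD => //; exact: cintegrableN. Qed.

Lemma cintegrable_bounded (M : R) f g : cintegrable f -> cmeas g ->
  (forall x, normc (g x) <= M) -> cintegrable (fun x => f x * g x).
Proof.
move=> If mg gM.
have [IMf1 IMf2] := cintegrableZ M%:C If.
apply: (@cintegrable_le _ (fun x => normc (M%:C * f x))) => //.
- exact: cmeasM If.1 mg.
- exact: cmeas_normc.
- move=> x; rewrite !normcM normc_real mulrC ler_wpM2r ?normc_ge0//.
  exact: le_trans (gM x) (ler_norm _).
Qed.

Lemma cintD f g : cintegrable f -> cintegrable g ->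
  cint (fun x => f x + g x) = cint f + cint g.
Proof.
move=> If Ig; rewrite /cint; apply/eqP; rewrite eq_complex/=; apply/andP; split.
  under eq_Rintegral do rewrite Re_add.
  by rewrite RintegralD//; exact: cintegrable_Re.
under eq_Rintegral do rewrite Im_add.
by rewrite RintegralD//; exact: cintegrable_Im.
Qed.

Lemma cintZ (c : R[i]) f : cintegrable f -> cint (fun x => c * f x) = c * cint f.
Proof.
move=> If; have fR := cintegrable_Re If; have fI := cintegrable_Im If.
have ZR (r : R) : mu.-integrable setT (EFin \o (fun x => r * complex.Re (f x))).
  by apply: (eq_integrable _ _ _ _ (integrableZl _ r fR)).
have ZI (r : R) : mu.-integrable setT (EFin \o (fun x => r * complex.Im (f x))).
  by apply: (eq_integrable _ _ _ _ (integrableZl _ r fI)).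
rewrite /cint; apply/eqP; rewrite eq_complex; apply/andP; split; apply/eqP.
  rewrite Re_mul /=; under eq_Rintegral do rewrite Re_mul.
  by rewrite RintegralB// !RintegralZl.
rewrite Im_mul /=; under eq_Rintegral do rewrite Im_mul.
by rewrite RintegralD// !RintegralZl.
Qed.

Lemma cintB f g : cintegrable f -> cintegrable g ->
  cint (fun x => f x - g x) = cint f - cint g.
Proof.
move=> If Ig; rewrite cintD//; last exact: cintegrableN.
congr +%R; rewrite -[RHS]mulN1r -cintZ//.
by congr cint; apply/funext => x; rewrite mulN1r.
Qed.

(** Rotate the integral onto the nonnegative real axis: its modulus is then the integral of a real
    part, which is at most the modulus pointwise. *)
Lemma normc_cint f : cintegrable f -> normc (cint f) <= \int[mu]_x normc (f x).
Proof.
move=> If; have [c c1 cf] := unit_rotation (cint f).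
have -> : normc (cint f) = \int[mu]_x complex.Re (c * f x).
  by have := congr1 (@complex.Re R) cf; rewrite -cintZ//= => ->.
have Icf := cintegrableZ c If.
apply: le_Rintegral => //; first exact: cintegrable_Re Icf.
  exact: cintegrable_normc.
move=> x _; rewrite (le_trans (ler_norm _))// (le_trans (normc_Re _))//.
by rewrite normcM c1 mul1r.
Qed.

Lemma normc_cintE f : cintegrable f ->
  ((normc (cint f))%:E <= \int[mu]_x (normc (f x))%:E)%E.
Proof.
move=> If; apply: le_trans (_ : ((\int[mu]_x normc (f x))%:E <= _)%E).
  by rewrite lee_fin normc_cint.
rewrite /Rintegral fineK// ge0_fin_numE//; first exact: If.2.
by apply: integral_ge0 => x _; rewrite lee_fin normc_ge0.
Qed.

Lemma eq_cint f g : (forall x, f x = g x) -> cint f = cint g.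
Proof. by move=> fg; congr cint; apply/funext. Qed.

Lemma ae_eq_cint f g : cmeas f -> cmeas g -> {ae mu, forall x, f x = g x} ->
  cint f = cint g.
Proof.
move=> [f1 f2] [g1 g2] fg; rewrite /cint /Rintegral; congr (fine _ +i* fine _);
  apply: ae_eq_integral => //; try exact/measurable_EFinP;
  by apply: filterS fg => x /= ->.
Qed.

Lemma ae_eq_integral_normc f g : cmeas f -> cmeas g ->
  {ae mu, forall x, f x = g x} ->
  (\int[mu]_x (normc (f x) ^+ 2)%:E = \int[mu]_x (normc (g x) ^+ 2)%:E)%E.
Proof.
move=> mf mg fg; apply: ae_eq_integral => //; try exact: cmeas_normc2.
by apply: filterS fg => x /= ->.
Qed.

Lemma cint_real (u : T -> R) : cint (fun x => (u x)%:C) = (\int[mu]_x u x)%:C.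
Proof.
rewrite /cint/=; congr (_ +i* _); rewrite Rintegral_cst//.
by rewrite mul0r.
Qed.

End complex_integral.

(** * Fubini's theorem for complex integrands *)

Section complex_fubini.
Context d1 d2 (T1 : measurableType d1) (T2 : measurableType d2) {R : realType}.
Variables (m1 : {sigma_finite_measure set T1 -> \bar R})
  (m2 : {sigma_finite_measure set T2 -> \bar R}).

Let real_fubini (f : T1 * T2 -> R) :
  (m1 \x m2)%E.-integrable setT (EFin \o f) ->
  (forall x, m2.-integrable setT (EFin \o (fun y => f (x, y)))) ->
  (forall y, m1.-integrable setT (EFin \o (fun x => f (x, y)))) ->
  \int[m1]_x \int[m2]_y f (x, y) = \int[(m1 \x m2)%E]_z f z /\
  \int[m2]_y \int[m1]_x f (x, y) = \int[(m1 \x m2)%E]_z f z.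
Proof.
move=> If I1 I2; split; rewrite /Rintegral; congr fine.
  rewrite -[RHS](integral12_prod_meas1 If); apply: eq_integral => x _.
  by rewrite fineK//; exact: (integrable_fin_num _ (I1 x)).
rewrite -[RHS](integral21_prod_meas1 If); apply: eq_integral => x _.
by rewrite fineK//; exact: (integrable_fin_num _ (I2 x)).
Qed.

(** Every section, not just almost every one, is asked to be integrable: the inner [Rintegral] is
    the [fine] of an extended integral, and this lets it be unwrapped at each point. The bounded
    kernels used below comply. *)
Lemma cint_prod (f : T1 * T2 -> R[i]) :
  cintegrable (m1 \x m2)%E f ->
  (forall x, cintegrable m2 (fun y => f (x, y))) ->
  (forall y, cintegrable m1 (fun x => f (x, y))) ->
  cint m1 (fun x => cint m2 (fun y => f (x, y))) = cint (m1 \x m2)%E f /\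
  cint m2 (fun y => cint m1 (fun x => f (x, y))) = cint (m1 \x m2)%E f.
Proof.
move=> If I1 I2.
have [R1 R2] := real_fubini (cintegrable_Re If)
  (fun x => cintegrable_Re (I1 x)) (fun y => cintegrable_Re (I2 y)).
have [J1 J2] := real_fubini (cintegrable_Im If)
  (fun x => cintegrable_Im (I1 x)) (fun y => cintegrable_Im (I2 y)).
by split; rewrite /cint/=; congr (_ +i* _).
Qed.

Lemma cintegrable_tensor (f : T1 -> R[i]) (g : T2 -> R[i]) (h : T1 * T2 -> R[i]) :
  cintegrable m1 f -> cintegrable m2 g -> cmeas h ->
  (forall z, normc (h z) <= normc (f z.1) * normc (g z.2)) ->
  cintegrable (m1 \x m2)%E h.
Proof.
move=> [mf If] [mg Ig] mh hfg.
have mfg : measurable_fun setT (fun z : T1 * T2 => normc (f z.1) * normc (g z.2)).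
  apply: measurable_funM.
    exact: measurableT_comp (cmeas_normc mf) measurable_fst.
  exact: measurableT_comp (cmeas_normc mg) measurable_snd.
apply: (cintegrable_le mh mfg) => //.
rewrite fubini_tonelli1//=; last 2 first.
- exact/measurable_EFinP.
- by move=> z; rewrite lee_fin mulr_ge0 ?normc_ge0.
rewrite /fubini_F/=.
under eq_integral => x _.
  under eq_integral do rewrite EFinM.
  rewrite ge0_integralZl//; last 3 first.
  - exact: cmeas_normcE.
  - by move=> y _; rewrite lee_fin normc_ge0.
  - by rewrite lee_fin normc_ge0.
  over.
rewrite ge0_integralZr//; last 3 first.
- exact: cmeas_normcE.
- by move=> y _; rewrite lee_fin normc_ge0.
- by apply: integral_ge0 => y _; rewrite lee_fin normc_ge0.
rewrite -ge0_fin_numE; last first.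
  by rewrite mule_ge0//; apply: integral_ge0 => y _; rewrite lee_fin normc_ge0.
by rewrite fin_numM// ge0_fin_numE//;
  apply: integral_ge0 => y _; rewrite lee_fin normc_ge0.
Qed.

End complex_fubini.

(** * Integrals of product functions *)

Section lebesgue_rV_integral.
Variable R : realType.
Local Notation leb := (lebesgue_rV R).
Local Notation leb1 := (@lebesgue_measure R).

(** [lebesgue_rV R n.+1] is by construction the pushforward of a product measure under [cons_rV].
    This change of variables drives all inductions on the dimension. *)
Lemma ge0_integral_rVS n (f : 'rV[R]_n.+1 -> \bar R) :
  measurable_fun setT f -> (forall x, (0 <= f x)%E) ->
  (\int[leb n.+1]_x f x =
   \int[(leb1 \x leb n)%E]_p f (cons_rV p))%E.
Proof.
move=> mf f0.
rewrite (_ : (\int[leb n.+1]_x f x)%E =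
  (\int[pushforward (leb1 \x leb n)%E (@cons_rV R n)]_x f x)%E)//.
by rewrite (ge0_integral_pushforward (@measurable_cons_rV R n)).
Qed.

Lemma cintegrable_rVS n (f : 'rV[R]_n.+1 -> R[i]) : cmeas f ->
  cintegrable (leb n.+1) f <->
  cintegrable (leb1 \x leb n)%E (f \o @cons_rV R n).
Proof.
move=> mf; have mfc := cmeas_comp (@measurable_cons_rV R n) mf.
rewrite /cintegrable ge0_integral_rVS; [|exact: cmeas_normcE|].
  by split=> -[_ If]; split.
by move=> x; rewrite lee_fin normc_ge0.
Qed.

Lemma cint_rVS n (f : 'rV[R]_n.+1 -> R[i]) : cintegrable (leb n.+1) f ->
  cint (leb n.+1) f = cint (leb1 \x leb n)%E (f \o @cons_rV R n).
Proof.
move=> If; have Ic := (cintegrable_rVS If.1).1 If.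
rewrite /cint /Rintegral; congr (fine _ +i* fine _).
  rewrite (_ : (\int[leb n.+1]_x (complex.Re (f x))%:E)%E =
    (\int[pushforward (leb1 \x leb n)%E (@cons_rV R n)]_x (complex.Re (f x))%:E)%E)//.
  rewrite (integral_pushforward (@measurable_cons_rV R n))//.
  - by apply/measurable_EFinP; exact: If.1.1.
  - exact: (cintegrable_Re Ic).
rewrite (_ : (\int[leb n.+1]_x (complex.Im (f x))%:E)%E =
  (\int[pushforward (leb1 \x leb n)%E (@cons_rV R n)]_x (complex.Im (f x))%:E)%E)//.
rewrite (integral_pushforward (@measurable_cons_rV R n))//.
- by apply/measurable_EFinP; exact: If.1.2.
- exact: (cintegrable_Im Ic).
Qed.

Definition prodf n (F : 'I_n -> R -> R[i]) (x : 'rV[R]_n) : R[i] :=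
  \prod_(i < n) F i (x ord0 i).

Lemma cmeas_prodf n (F : 'I_n -> R -> R[i]) :
  (forall i, cmeas (F i)) -> cmeas (prodf F).
Proof.
move=> mF; apply: cmeas_prod => i _.
exact: cmeas_comp (measurable_coord i) (mF i).
Qed.

Lemma prodf_cons n (F : 'I_n.+1 -> R -> R[i]) p :
  prodf F (cons_rV p) = F ord0 p.1 * prodf (F \o lift ord0) p.2.
Proof.
rewrite /prodf big_ord_recl /cons_rV mxE unlift_none/=; congr (_ * _).
by apply: eq_bigr => i _; rewrite mxE liftK.
Qed.

(** Integrability and value go through one induction on the dimension, because Fubini at step n + 1
    calls for the integrability of the product of the remaining n factors. *)
Lemma cint_prodf_aux n (F : 'I_n -> R -> R[i]) :
  (forall i, cintegrable leb1 (F i)) ->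
  cintegrable (leb n) (prodf F) /\
  cint (leb n) (prodf F) = \prod_(i < n) cint leb1 (F i).
Proof.
elim: n F => [|n IH] F IF.
  (* In dimension 0 the measure is the Dirac mass at the only point and the empty product is 1. *)
  rewrite big_ord0; have -> : prodf F = fun=> 1.
    by apply/funext => x; rewrite /prodf big_ord0.
  split; first split.
  - exact: cmeas_cst.
  - under eq_integral do rewrite normc1.
    by rewrite /= integral_dirac// diracE in_setT mul1e ltry.
  - rewrite /cint /Rintegral /= !integral_dirac// diracE in_setT !mul1e.
    by apply/eqP; rewrite eq_complex/= !eqxx.
have [IL EL] := IH (F \o lift ord0) (fun i => IF _).
have mF : cmeas (prodf F) by apply: cmeas_prodf => i; exact: (IF i).1.
have If1 : cintegrable (leb1 \x leb n)%E (prodf F \o @cons_rV R n).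
  apply: (cintegrable_tensor (IF ord0) IL).
    exact: cmeas_comp (@measurable_cons_rV R n) mF.
  by move=> z; rewrite /= prodf_cons normcM.
have If : cintegrable (leb n.+1) (prodf F) by apply/cintegrable_rVS.
split => //; rewrite cint_rVS//.
have E : prodf F \o @cons_rV R n =
    fun p => F ord0 p.1 * prodf (F \o lift ord0) p.2.
  by apply/funext => p; rewrite /= prodf_cons.
rewrite E in If1 *.
have I2 y : cintegrable leb1 (fun x => F ord0 x * prodf (F \o lift ord0) y).
  have := cintegrableZ (prodf (F \o lift ord0) y) (IF ord0).
  by under eq_fun do rewrite mulrC.
have [<- _] := cint_prod If1 (fun x => cintegrableZ (F ord0 x) IL) I2.
rewrite big_ord_recl -EL/=.
under eq_fun do rewrite cintZ//.
under eq_fun do rewrite mulrC.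
by rewrite cintZ// mulrC.
Qed.

Lemma cintegrable_prodf n (F : 'I_n -> R -> R[i]) :
  (forall i, cintegrable leb1 (F i)) -> cintegrable (leb n) (prodf F).
Proof. by move=> /cint_prodf_aux[]. Qed.

Lemma cint_prodf n (F : 'I_n -> R -> R[i]) :
  (forall i, cintegrable leb1 (F i)) ->
  cint (leb n) (prodf F) = \prod_(i < n) cint leb1 (F i).
Proof. by move=> /cint_prodf_aux[]. Qed.

End lebesgue_rV_integral.

(** * The Poisson kernel on the line *)

Lemma Rintegral_dominated_cvg d (T : measurableType d) (R : realType)
    (mu : {measure set T -> \bar R}) (f_ : nat -> T -> R) (f g : T -> R) :
  (forall n, measurable_fun setT (f_ n)) -> measurable_fun setT f ->
  {ae mu, forall x, f_ n x @[n --> \oo] --> f x} ->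
  mu.-integrable setT (EFin \o g) ->
  (forall n x, `|f_ n x| <= g x) ->
  \int[mu]_x f_ n x @[n --> \oo] --> \int[mu]_x f x.
Proof.
move=> mf_ mf cf Ig fg.
have [||||| If _ h] := @dominated_convergence _ T R mu setT measurableT
  (fun n => EFin \o f_ n) (EFin \o f) (EFin \o g).
- by move=> n; exact/measurable_EFinP.
- exact/measurable_EFinP.
- apply: filterS cf => x fx _; apply: cvg_EFin => //; exact: nearW.
- by [].
- by apply: nearW => x n _; rewrite lee_fin.
by rewrite /Rintegral; apply: fine_cvg; rewrite fineK//; exact: integrable_fin_num If.
Qed.

Section calculus.
Variable R : realType.
Local Notation leb1 := (@lebesgue_measure R).
Implicit Types (f F : R -> R) (e x y a : R).

(** Exhaust D by compact intervals, use the fundamental theorem of calculus on each, and pass to the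
    limit by dominated convergence with majorant |f|. One statement then serves the line and both
    half-lines. *)
Lemma integral_FTC_cvg (D : set R) (a b : nat -> R) f F (l : R) :
  measurable D -> (forall n, a n < b n) -> (forall n, `[a n, b n] `<=` D) ->
  (forall x, D x -> \forall n \near \oo, x \in `[a n, b n]) ->
  (forall x : R, is_derive x (1 : R) F (f x)) -> continuous f ->
  leb1.-integrable D (EFin \o f) ->
  F (b n) - F (a n) @[n --> \oo] --> l ->
  \int[leb1]_(x in D) f x = l.
Proof.
move=> mD ab abD Dab dF cf If Fl.
have cF : continuous F.
  by move=> x; apply/differentiable_continuous/derivable1_diffP; case: (dF x).
have mf : measurable_fun setT f by exact: continuous_measurable_fun.
have h : \int[leb1]_x (f \_ `[a n, b n]) x @[n --> \oo] --> \int[leb1]_x (f \_ D) x.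
  have := @Rintegral_dominated_cvg _ _ R leb1 (fun n => f \_ `[a n, b n]) (f \_ D)
    (fun x => `|(f \_ D) x|).
  apply.
  - move=> n; apply/(measurable_restrictT f (measurable_itv _)).
    exact: measurable_funTS.
  - by apply/(measurable_restrictT f mD); exact: measurable_funTS.
  - apply: nearW => x; apply: (@cvg_near_cst); rewrite !patchE.
    have [/set_mem xD|xD] := boolP (x \in D).
      by near=> n; rewrite patchE mem_set//; near: n; exact: Dab.
    apply: nearW => n; rewrite patchE ifF//; apply/negbTE.
    by apply: contra xD; rewrite !inE; exact: abD.
  - have /integrable_abse : leb1.-integrable setT ((EFin \o f) \_ D).
      by apply/integrable_restrict => //; rewrite setTI.
    apply: eq_integrable => // x _; rewrite /= !patchE.
    by case: ifPn => //= _; rewrite normr0.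
  - move=> n x; rewrite !patchE; case: ifPn => xab; last by rewrite normr0.
    by rewrite ifT// inE; apply: (abD n); move: xab; rewrite inE.
rewrite Rintegral_mkcond; apply/esym/(cvg_unique _ _ h) => //.
apply: cvg_trans Fl; apply: near_eq_cvg; apply: nearW => n.
rewrite -Rintegral_mkcond /Rintegral (@continuous_FTC2 _ f F)//.
- exact: continuous_subspaceT.
- split => //.
    + by apply: cvg_at_right_filter; exact: cF.
    + by apply: cvg_at_left_filter; exact: cF.
- by move=> x _; rewrite derive1E; exact: derive_val.
Unshelve. all: by end_near. Qed.

Lemma measurable_oneDsqrV : measurable_fun setT (fun y : R => (1 + y ^+ 2)^-1).
Proof. by apply: continuous_measurable_fun; exact: continuous_oneDsqrV. Qed.

(** The common majorant of the one-variable integrands below: the damping factor, the Poisson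
    kernel, Schwartz functions and their transforms. *)
Lemma integrable_oneDsqrV :
  leb1.-integrable setT (EFin \o (fun y : R => (1 + y ^+ 2)^-1)).
Proof.
have p y : 0 <= (1 + y ^+ 2)^-1 :> R by rewrite invr_ge0 addr_ge0 ?sqr_ge0.
apply/integrableP; split; first by apply/measurable_EFinP; exact: measurable_oneDsqrV.
under eq_integral do rewrite /= ger0_norm//.
rewrite ge0_symfun_integralT//.
- rewrite (_ : [set x : R | 0 <= x] = `[0, +oo[%classic); last by rewrite set_itvcy.
  by rewrite integral0y_oneDsqr -EFinM ltry.
- exact: continuous_oneDsqrV.
- by move=> x; rewrite /= sqrrN.
Qed.

Lemma integral_FTC_line f F (A B : R) :
  (forall x : R, is_derive x (1 : R) F (f x)) -> continuous f ->
  leb1.-integrable setT (EFin \o f) ->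
  F x @[x --> +oo] --> A -> F x @[x --> -oo] --> B ->
  \int[leb1]_x f x = A - B.
Proof.
move=> dF cf If FA FB.
apply: (@integral_FTC_cvg _ (fun n => - n.+1%:R) (fun n => n.+1%:R) _ F) => //.
- by move=> n; rewrite -subr_gt0 opprK addr_gt0.
- move=> x _; near=> n; rewrite in_itv/= -ler_norml.
  by rewrite (@le_trans _ _ n%:R) ?ler_nat//; near: n; exact: nbhs_infty_ger.
- apply: cvgB.
    apply: cvg_comp FA; apply/cvgryPge => M; near=> n.
    by rewrite (@le_trans _ _ n%:R) ?ler_nat//; near: n; exact: nbhs_infty_ger.
  apply: cvg_comp FB; apply/cvgrNyPle => M; near=> n.
  rewrite lerNl (@le_trans _ _ n%:R) ?ler_nat//; near: n; exact: nbhs_infty_ger.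
Unshelve. all: by end_near. Qed.

Lemma integral_FTC_right f F (A : R) :
  (forall x : R, is_derive x (1 : R) F (f x)) -> continuous f ->
  leb1.-integrable `[0, +oo[ (EFin \o f) ->
  F x @[x --> +oo] --> A ->
  \int[leb1]_(x in `[0, +oo[) f x = A - F 0.
Proof.
move=> dF cf If FA.
apply: (@integral_FTC_cvg _ (fun=> 0) (fun n => n.+1%:R) _ F) => //.
- by move=> n x /=; rewrite !in_itv/= andbT => /andP[].
- move=> x /=; rewrite in_itv/= andbT => x0; near=> n; rewrite in_itv/= x0/=.
  by rewrite (@le_trans _ _ n%:R) ?ler_nat//; near: n; exact: nbhs_infty_ger.
- apply: cvgB; last exact: cvg_cst.
  apply: cvg_comp FA; apply/cvgryPge => M; near=> n.
  by rewrite (@le_trans _ _ n%:R) ?ler_nat//; near: n; exact: nbhs_infty_ger.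
Unshelve. all: by end_near. Qed.

Lemma integral_FTC_left f F (B : R) :
  (forall x : R, is_derive x (1 : R) F (f x)) -> continuous f ->
  leb1.-integrable `]-oo, 0[ (EFin \o f) ->
  F x @[x --> -oo] --> B ->
  \int[leb1]_(x in `]-oo, 0[) f x = F 0 - B.
Proof.
move=> dF cf If FB; have mf : measurable_fun setT f.
  exact: continuous_measurable_fun.
have If' : leb1.-integrable `]-oo, 0] (EFin \o f).
  apply/integrableP; split; first exact/measurable_EFinP/measurable_funTS.
  case/integrableP: If => _; apply: le_lt_trans.
  rewrite -integral_itv_bndo_bndc//; apply: measurableT_comp => //.
  exact/measurable_EFinP/measurable_funTS.
rewrite Rintegral_itv_bndo_bndc//.
apply: (@integral_FTC_cvg _ (fun n => - n.+1%:R) (fun n => 0) _ F) => //.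
- by move=> n x /=; rewrite !in_itv/= => /andP[].
- move=> x /=; rewrite in_itv/= => x0; near=> n; rewrite in_itv/= x0/= andbT.
  rewrite lerNl (@le_trans _ _ n%:R) ?ler_nat//; near: n; exact: nbhs_infty_ger.
- apply: cvgB; first exact: cvg_cst.
  apply: cvg_comp FB; apply/cvgrNyPle => M; near=> n.
  rewrite lerNl (@le_trans _ _ n%:R) ?ler_nat//; near: n; exact: nbhs_infty_ger.
Unshelve. all: by end_near. Qed.

Lemma integrable_oneDsqrVM (C : R) :
  leb1.-integrable setT (EFin \o (fun y : R => C * (1 + y ^+ 2)^-1)).
Proof.
by apply: (eq_integrable _ _ _ _ (integrableZl measurableT C integrable_oneDsqrV)).
Qed.

Lemma le_integrable_oneDsqrV (C : R) (h : R -> R) : measurable_fun setT h ->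
  (forall y, `|h y| <= C * (1 + y ^+ 2)^-1) ->
  leb1.-integrable setT (EFin \o h).
Proof.
move=> mh hC; apply: (le_integrable measurableT _ _ (integrable_oneDsqrVM C)).
  exact/measurable_EFinP.
by move=> y _; rewrite /= lee_fin (le_trans (hC y))// ler_norm.
Qed.

Lemma is_derive_expM (a x : R) :
  is_derive x (1 : R) (fun y => expR (a * y)) (a * expR (a * x)).
Proof.
have -> : a * expR (a * x) = expR (a * x) *: (a * 1) by rewrite mulr1 mulrC.
by apply: is_derive1_comp.
Qed.

Lemma is_derive_cosM (a x : R) :
  is_derive x (1 : R) (fun y => cos (a * y)) (- (a * sin (a * x))).
Proof.
have -> : - (a * sin (a * x)) = (- sin (a * x)) *: (a * 1).
  by rewrite mulr1 scaleNr mulrC.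
by apply: is_derive1_comp.
Qed.

Lemma is_derive_sinM (a x : R) :
  is_derive x (1 : R) (fun y => sin (a * y)) (a * cos (a * x)).
Proof.
have -> : a * cos (a * x) = cos (a * x) *: (a * 1) by rewrite mulr1 mulrC.
by apply: is_derive1_comp.
Qed.

(* [expcos a x] and [expsin a x] are antiderivatives of [exp (a y) cos (x y)]
   and [exp (a y) sin (x y)]. *)
Definition expcos (a x y : R) : R :=
  expR (a * y) * (x * sin (x * y) + a * cos (x * y)) / (a ^+ 2 + x ^+ 2).
Definition expsin (a x y : R) : R :=
  expR (a * y) * (a * sin (x * y) - x * cos (x * y)) / (a ^+ 2 + x ^+ 2).

Lemma is_derive_expcos (a x y : R) : a != 0 ->
  is_derive y (1 : R) (expcos a x) (expR (a * y) * cos (x * y)).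
Proof.
move=> a0; have D0 : a ^+ 2 + x ^+ 2 != 0.
  by rewrite gt_eqF// ltr_pwDl ?sqr_ge0// exprn_even_gt0.
have := is_derive_expM a y; have := is_derive_cosM x y; have := is_derive_sinM x y.
move=> ds dc de; rewrite /expcos.
apply: is_derive_eq; rewrite /GRing.scale/=; field.
by [].
Qed.

Lemma is_derive_expsin (a x y : R) : a != 0 ->
  is_derive y (1 : R) (expsin a x) (expR (a * y) * sin (x * y)).
Proof.
move=> a0; have D0 : a ^+ 2 + x ^+ 2 != 0.
  by rewrite gt_eqF// ltr_pwDl ?sqr_ge0// exprn_even_gt0.
have := is_derive_expM a y; have := is_derive_cosM x y; have := is_derive_sinM x y.
move=> ds dc de; rewrite /expsin.
apply: is_derive_eq; rewrite /GRing.scale/=; field.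
by [].
Qed.

Lemma cvg_oneDsqrV (C : R) (G : R -> R) :
  (forall y, 0 <= y -> `|G y| <= C * (1 + y ^+ 2)^-1) ->
  G x @[x --> +oo] --> (0 : R).
Proof.
move=> GC; apply/cvgr0Pnorm_le => e e0; near=> y.
have y1 : 1 <= y by near: y; exact: nbhs_pinfty_ge.
have y0 : 0 <= y by rewrite (le_trans _ y1).
rewrite (le_trans (GC _ y0))// ler_pdivrMr ?ltr_wpDr ?sqr_ge0//.
have yC : C / e <= y by near: y; exact/nbhs_pinfty_ge/num_real.
rewrite mulrC -ler_pdivrMr//; apply: (le_trans yC).
by rewrite expr2 ler_wpDl// ler_peMl.
Unshelve. all: by end_near. Qed.

Lemma cvg_oneDsqrVNy (C : R) (G : R -> R) :
  (forall y, y <= 0 -> `|G y| <= C * (1 + y ^+ 2)^-1) ->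
  G x @[x --> -oo] --> (0 : R).
Proof.
move=> GC; apply/cvgNy_compNP; apply: (@cvg_oneDsqrV C) => y y0 /=.
by rewrite -(sqrrN y); apply: GC; rewrite oppr_le0.
Qed.

(** The Abel summation factor. The exponent is |y| rather than y^2 so that the integrals against cos
    and sin have the elementary antiderivatives [expcos] and [expsin] on each half-line. *)
Definition abel (e y : R) : R := expR (- (e * `|y|)).

Lemma abel_gt0 e y : 0 < abel e y. Proof. exact: expR_gt0. Qed.

(** With t = e |y| / 2, exp(2 t) >= (1 + t)^2 >= 1 + t^2; the factor 1 + 4 / e^2 then turns 1 + t^2
    into at least 1 + y^2. *)
Lemma abel_le e y : 0 < e -> abel e y <= (1 + 4 / e ^+ 2) * (1 + y ^+ 2)^-1.
Proof.
move=> e0; have ey : 0 <= e * `|y| / 2 by rewrite divr_ge0 ?mulr_ge0// ltW.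
have h : 1 + (e * `|y| / 2) ^+ 2 <= expR (e * `|y|).
  have {2}-> : e * `|y| = e * `|y| / 2 + e * `|y| / 2 by rewrite -splitr.
  rewrite expRD; have := expR_ge1Dx (e * `|y| / 2); rewrite -expr2.
  move: ey; move: (e * `|y| / 2) => t t0 et.
  have : (1 + t) ^+ 2 <= expR t ^+ 2 by rewrite lerXn2r ?nnegrE ?addr_ge0 ?expR_ge0.
  by apply: le_trans; rewrite sqrrD expr1n lerD2r mul1r lerDl mulrn_wge0.
rewrite /abel expRN ler_pdivlMr ?ltr_wpDr ?sqr_ge0// mulrC ler_pdivrMr ?expR_gt0//.
have -> : 1 + y ^+ 2 = 1 + `|y| ^+ 2 by rewrite real_normK ?num_real.
apply: le_trans (_ : (1 + 4 / e ^+ 2) * (1 + (e * `|y| / 2) ^+ 2) <= _); last first.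
  by rewrite ler_wpM2l// addr_ge0// divr_ge0 ?sqr_ge0.
have -> : (1 + 4 / e ^+ 2) * (1 + (e * `|y| / 2) ^+ 2) =
  1 + `|y| ^+ 2 + (4 / e ^+ 2 + (e * `|y| / 2) ^+ 2).
  by field; rewrite gt_eqF.
by rewrite lerDl addr_ge0 ?sqr_ge0// divr_ge0 ?sqr_ge0.
Qed.

Lemma measurable_abel e : measurable_fun setT (abel e).
Proof.
apply: measurableT_comp => //; apply: measurableT_comp => //.
exact: measurable_funM.
Qed.

Lemma expcos_le a x y : a != 0 ->
  `|expcos a x y| <= expR (a * y) * ((`|x| + `|a|) / (a ^+ 2 + x ^+ 2)).
Proof.
move=> a0; have D0 : 0 < a ^+ 2 + x ^+ 2.
  by rewrite ltr_pwDl ?sqr_ge0// exprn_even_gt0.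
rewrite /expcos -mulrA normrM (ger0_norm (expR_ge0 _)) ler_wpM2l ?expR_ge0//.
rewrite normrM normfV (gtr0_norm D0) ler_wpM2r ?invr_ge0 ?(ltW D0)//.
by rewrite (le_trans (ler_normD _ _))// !normrM lerD// ler_piMr ?sin_max ?cos_max.
Qed.

Lemma expsin_le a x y : a != 0 ->
  `|expsin a x y| <= expR (a * y) * ((`|x| + `|a|) / (a ^+ 2 + x ^+ 2)).
Proof.
move=> a0; have D0 : 0 < a ^+ 2 + x ^+ 2.
  by rewrite ltr_pwDl ?sqr_ge0// exprn_even_gt0.
rewrite /expsin -mulrA normrM (ger0_norm (expR_ge0 _)) ler_wpM2l ?expR_ge0//.
rewrite normrM normfV (gtr0_norm D0) ler_wpM2r ?invr_ge0 ?(ltW D0)//.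
by rewrite (le_trans (ler_normB _ _))// [leRHS]addrC !normrM lerD// ler_piMr ?sin_max ?cos_max.
Qed.

Lemma integrable_abelM e (h : R -> R) : 0 < e -> measurable_fun setT h ->
  (forall y, `|h y| <= 1) ->
  leb1.-integrable setT (EFin \o (fun y => abel e y * h y)).
Proof.
move=> e0 mh h1.
apply: (@le_integrable_oneDsqrV (1 + 4 / e ^+ 2)).
  by apply: measurable_funM => //; exact: measurable_abel.
move=> y; rewrite normrM (gtr0_norm (abel_gt0 _ _)).
by rewrite (le_trans _ (abel_le y e0))// ler_piMr// ltW// abel_gt0.
Qed.

Lemma Rintegral_halves (f : R -> R) : leb1.-integrable setT (EFin \o f) ->
  \int[leb1]_x f x =
  \int[leb1]_(x in `]-oo, 0[) f x + \int[leb1]_(x in `[0, +oo[) f x.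
Proof.
move=> If; rewrite -(@Rintegral_setU _ _ _ leb1)//.
- by rewrite itv_setU_setT.
- by apply: integrableS If => //; exact: measurableU.
- by apply/disj_setPS => x [] /=; rewrite !in_itv/= andbT ltNge => /negP.
Qed.

(** Shared by the cosine and the sine. The damping is exp(a y) with a = e on the left half-line and
    a = - e on the right one; the antiderivatives vanish at infinity, so only their values at 0
    survive. *)
Let abel_half e x (T : R -> R) (F : R -> R -> R -> R) (c : R -> R) : 0 < e ->
  continuous T -> (forall y, `|T y| <= 1) ->
  (forall a y : R, a != 0 -> is_derive y (1 : R) (F a x) (expR (a * y) * T y)) ->
  (forall a y, a != 0 -> `|F a x y| <= expR (a * y) * c a) ->
  \int[leb1]_y (abel e y * T y) = F e x 0 - F (- e) x 0.
Proof.
move=> e0 cT T1 dF FC.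
have mT : measurable_fun setT T by exact: continuous_measurable_fun.
have Ik := integrable_abelM e0 mT T1.
have cexp a : continuous (fun y : R => expR (a * y) * T y).
  move=> y; apply: cvgM; last exact: cT.
  by apply: continuous_comp; [exact: mulrl_continuous|exact: continuous_expR].
have en0 : e != 0 by rewrite gt_eqF.
have nen0 : - e != 0 by rewrite oppr_eq0.
have cge0 a : a != 0 -> 0 <= c a.
  move=> a0; have := le_trans (normr_ge0 _) (FC a 0 a0).
  by rewrite mulr0 expR0 mul1r.
have EL y : y \in (`]-oo, 0[%classic : set R) ->
    abel e y * T y = expR (e * y) * T y.
  rewrite inE/= in_itv/= => y0; rewrite /abel (ltr0_norm y0).
  by rewrite mulrN opprK.
have ER y : y \in (`[0, +oo[%classic : set R) ->
    abel e y * T y = expR (- e * y) * T y.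
  by rewrite inE/= in_itv/= andbT => y0; rewrite /abel (ger0_norm y0) mulNr.
rewrite (Rintegral_halves Ik).
rewrite (@eq_Rintegral _ _ R leb1 _ (fun y => expR (e * y) * T y)
  (fun y => abel e y * T y) EL).
rewrite (@eq_Rintegral _ _ R leb1 _ (fun y => expR (- e * y) * T y)
  (fun y => abel e y * T y) ER).
have -> : \int[leb1]_(y in `]-oo, 0[) (expR (e * y) * T y) = F e x 0 - 0.
  apply: (@integral_FTC_left _ (F e x) 0) => //.
  - by move=> y; exact: dF.
  - have : leb1.-integrable `]-oo, 0[ (EFin \o (fun y => abel e y * T y)).
      exact: integrableS Ik.
    by apply: eq_integrable => // y /EL /= ->.
  - apply: (@cvg_oneDsqrVNy (c e * (1 + 4 / e ^+ 2))) => y y0.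
    rewrite (le_trans (FC _ _ en0))// mulrC -mulrA ler_wpM2l ?cge0//.
    by rewrite (le_trans _ (abel_le y e0))// /abel ler0_norm// mulrN opprK.
have -> : \int[leb1]_(y in `[0, +oo[) (expR (- e * y) * T y) = 0 - F (- e) x 0.
  apply: (@integral_FTC_right _ (F (- e) x) 0) => //.
  - by move=> y; exact: dF.
  - have : leb1.-integrable `[0, +oo[ (EFin \o (fun y => abel e y * T y)).
      exact: integrableS Ik.
    by apply: eq_integrable => // y /ER /= ->.
  - apply: (@cvg_oneDsqrV (c (- e) * (1 + 4 / e ^+ 2))) => y y0.
    rewrite (le_trans (FC _ _ nen0))// mulrC -mulrA ler_wpM2l ?cge0//.
    by rewrite (le_trans _ (abel_le y e0))// /abel ger0_norm// mulNr.
by rewrite subr0 add0r.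
Qed.

(** The Poisson kernel of the half-plane at height [e], multiplied by 2 pi so as to be exactly the
    Fourier transform of [abel e]. *)
Definition poisson (e x : R) : R := 2 * e / (e ^+ 2 + x ^+ 2).

Lemma cintegrable_abel_cis e x : 0 < e ->
  cintegrable leb1 (fun y => (abel e y)%:C * cis (x * y)).
Proof.
move=> e0; split.
  apply: cmeasM; first by apply: cmeas_real; exact: measurable_abel.
  by apply: cmeas_cis; exact: measurable_funM.
have c1 y : `|(cst 1 : R -> R) y| <= 1 by rewrite normr1.
have /integrableP[_] := integrable_abelM e0 (measurable_cst (1 : R)) c1.
apply: le_lt_trans; rewrite le_eqVlt; apply/orP; left; apply/eqP.
by apply: eq_integral => y _; rewrite normcM normc_cis normc_real [RHS]/= !mulr1.
Qed.

Lemma cint_abel_cis e x : 0 < e ->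
  cint leb1 (fun y => (abel e y)%:C * cis (x * y)) = (poisson e x)%:C.
Proof.
move=> e0; rewrite /cint/=.
under eq_Rintegral do rewrite mul0r subr0.
under [X in _ +i* X]eq_Rintegral do rewrite mul0r addr0.
have -> : \int[leb1]_y (abel e y * cos (x * y)) = expcos e x 0 - expcos (- e) x 0.
  apply: (@abel_half e x (fun y => cos (x * y)) expcos
    (fun a => (`|x| + `|a|) / (a ^+ 2 + x ^+ 2))) => //.
  - by move=> y; apply: continuous_comp; [exact: mulrl_continuous|exact: continuous_cos].
  - by move=> y; exact: cos_max.
  - by move=> a y; exact: is_derive_expcos.
  - by move=> a y; exact: expcos_le.
have -> : \int[leb1]_y (abel e y * sin (x * y)) = expsin e x 0 - expsin (- e) x 0.
  apply: (@abel_half e x (fun y => sin (x * y)) expsin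
    (fun a => (`|x| + `|a|) / (a ^+ 2 + x ^+ 2))) => //.
  - by move=> y; apply: continuous_comp; [exact: mulrl_continuous|exact: continuous_sin].
  - by move=> y; exact: sin_max.
  - by move=> a y; exact: is_derive_expsin.
  - by move=> a y; exact: expsin_le.
have D0 : e ^+ 2 + x ^+ 2 != 0.
  by rewrite gt_eqF// ltr_pwDl ?sqr_ge0// exprn_gt0.
rewrite /expcos /expsin !mulr0 expR0 sin0 cos0 /poisson sqrrN.
by congr (_ +i* _); field.
Qed.

Lemma poisson_ge0 e x : 0 < e -> 0 <= poisson e x.
Proof.
by move=> e0; rewrite /poisson divr_ge0 ?mulr_ge0 ?addr_ge0 ?sqr_ge0// ltW.
Qed.

Lemma continuous_poisson e x : 0 < e -> continuous (fun y => poisson e (x - y)).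
Proof.
move=> e0 y; rewrite /poisson; apply: cvgM; first exact: cvg_cst.
apply: cvgV; first by rewrite gt_eqF// ltr_pwDl ?sqr_ge0// exprn_gt0.
apply: cvgD; first exact: cvg_cst.
by rewrite expr2; under eq_fun do rewrite expr2; apply: cvgM;
  (apply: cvgB; [exact: cvg_cst|exact: cvg_id]).
Qed.

Lemma integrable_poisson e x : 0 < e ->
  leb1.-integrable setT (EFin \o (fun y => poisson e (x - y))).
Proof.
move=> e0.
(* From 1 + y^2 <= (1 + 2 x^2) + 2 (x - y)^2, both terms being compared with e^2 + (x - y)^2. *)
pose K := (1 + 2 * x ^+ 2) / e ^+ 2 + 2.
apply: (@le_integrable_oneDsqrV (2 * e * K)).
  by apply: continuous_measurable_fun; exact: continuous_poisson.
move=> y; rewrite (ger0_norm (poisson_ge0 _ e0)) /poisson.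
have D0 : 0 < e ^+ 2 + (x - y) ^+ 2 by rewrite ltr_pwDl ?sqr_ge0// exprn_gt0.
have E0 : 0 < 1 + y ^+ 2 by rewrite ltr_pwDl ?sqr_ge0.
rewrite -[leRHS]mulrA ler_wpM2l ?mulr_ge0 ?(ltW e0)//.
rewrite ler_pdivlMr// mulrC ler_pdivrMr//.
have -> : y ^+ 2 = (x - (x - y)) ^+ 2 by rewrite opprB addrC subrK.
move: (x - y) D0 => t D0.
have -> : K * (e ^+ 2 + t ^+ 2) =
    1 + 2 * x ^+ 2 + 2 * t ^+ 2 + (2 * e ^+ 2 + (1 + 2 * x ^+ 2) / e ^+ 2 * t ^+ 2).
  by rewrite /K; field; rewrite gt_eqF.
have : 0 <= 2 * e ^+ 2 + (1 + 2 * x ^+ 2) / e ^+ 2 * t ^+ 2.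
  by rewrite addr_ge0// mulr_ge0 ?sqr_ge0// divr_ge0 ?sqr_ge0// addr_ge0// mulr_ge0// sqr_ge0.
have := sqr_ge0 (x + t); nra.
Qed.

Lemma Rintegral_poisson e x : 0 < e ->
  \int[leb1]_y poisson e (x - y) = 2 * pi.
Proof.
move=> e0; have -> : 2 * pi = pi - - pi :> R by ring.
apply: (@integral_FTC_line _ (fun y => 2 * atan (e^-1 * (y - x)))).
- move=> y.
  have da : is_derive y (1 : R) (fun y => atan (e^-1 * (y - x)))
      ((1 + (e^-1 * (y - x)) ^+ 2)^-1 * e^-1).
    have -> : (1 + (e^-1 * (y - x)) ^+ 2)^-1 * e^-1 =
      (1 + (e^-1 * (y - x)) ^+ 2)^-1 *: (e^-1 * (1 - 0)) by rewrite subr0 mulr1.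
    by apply: is_derive1_comp.
  apply: is_derive_eq; rewrite /poisson /GRing.scale/=; field.
  have D0 : 0 < e ^+ 2 + (x - y) ^+ 2 by rewrite ltr_pwDl ?sqr_ge0// exprn_gt0.
  rewrite !gt_eqF//.
- exact: continuous_poisson.
- exact: integrable_poisson.
- have -> : pi = 2 * (pi / 2) :> R by field.
  apply: cvgM; first exact: cvg_cst.
  apply: cvg_comp (@cvgy_atan R).
  apply/cvgryPge => A; near=> y.
  rewrite -ler_pdivrMl ?invr_gt0// invrK lerBrDr.
  by near: y; exact/nbhs_pinfty_ge/num_real.
- apply/cvgNy_compNP => /=; have -> : - pi = 2 * - (pi / 2) :> R by field.
  apply: cvgM; first exact: cvg_cst.
  under eq_fun do rewrite -opprD mulrN atanN.
  apply: cvgN; apply: cvg_comp (@cvgy_atan R).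
  apply/cvgryPge => A; near=> y.
  rewrite -ler_pdivrMl ?invr_gt0// invrK -lerBlDr.
  by near: y; exact/nbhs_pinfty_ge/num_real.
Unshelve. all: by end_near. Qed.

End calculus.

(** * The Fourier transform of integrable functions *)

Section fatou_bound.
Context d (T : measurableType d) (R : realType) (mu : {measure set T -> \bar R}).

Lemma fatou_cvg_le (f_ : nat -> T -> R) (f : T -> R) (C : \bar R) :
  (forall n, measurable_fun setT (f_ n)) -> measurable_fun setT f ->
  (forall n x, 0 <= f_ n x) ->
  {ae mu, forall x, f_ n x @[n --> \oo] --> f x} ->
  (forall n, \int[mu]_x (f_ n x)%:E <= C)%E ->
  (\int[mu]_x (f x)%:E <= C)%E.
Proof.
move=> mf_ mf f0 cf fC.
have mf_E n : measurable_fun setT (EFin \o f_ n) by exact/measurable_EFinP.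
have h := @fatou _ T R mu setT measurableT (fun n => EFin \o f_ n) mf_E
  (fun n x _ => f0 n x).
apply: le_trans (le_trans h _).
  rewrite le_eqVlt; apply/orP; left; apply/eqP.
  apply: ae_eq_integral => //; first exact/measurable_EFinP.
    apply: (emeasurable_fun_cvg (fun n x => einfs (fun m => EFin (f_ m x)) n)).
      by move=> n; exact: measurable_fun_einfs mf_E n.
    by move=> x _; rewrite limn_einf_lim; exact: is_cvg_einfs.
  apply: filterS cf => x fx _.
  apply/esym; have fxE : EFin (f_ n x) @[n --> \oo] --> (f x)%:E.
    by apply: cvg_EFin => //; exact: nearW.
  rewrite is_cvg_limn_einfE; first exact/cvg_lim.
  by apply/cvg_ex; exists (f x)%:E.
rewrite limn_einf_lim; apply: lime_le; first exact: is_cvg_einfs.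
apply: nearW => n; apply: le_trans (fC n).
by apply: ereal_inf_lbound => /=; exists n => /=.
Qed.

End fatou_bound.

(** Tonelli's theorem gives measurability of section integrals for nonnegative integrands; the
    general case is the difference of the positive and negative parts. *)
Lemma measurable_Rintegral_section d1 d2 (T1 : measurableType d1)
    (T2 : measurableType d2) (R : realType)
    (m : {sigma_finite_measure set T2 -> \bar R}) (h : T1 * T2 -> R) :
  measurable_fun setT h ->
  measurable_fun setT (fun x => \int[m]_y h (x, y)).
Proof.
move=> mh; apply: measurableT_comp => //.
have mhE : measurable_fun setT (EFin \o h) by exact/measurable_EFinP.
rewrite (_ : (fun _ => _) = fubini_F m ((EFin \o h)^\+)%E \- fubini_F m ((EFin \o h)^\-)%E)%E.
  apply: emeasurable_funB; apply: measurable_fun_fubini_tonelli_F => //.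
    exact: measurable_funepos.
  exact: measurable_funeneg.
apply/funext => x; rewrite [LHS]integralE /fubini_F.
by congr (_ - _)%E; apply: eq_integral => y _; rewrite ?funeposE ?funenegE.
Qed.

Section fourier_transform.
Context {R : realType} {d : nat}.
Local Notation leb := (lebesgue_rV R d).
Local Notation leb1 := (@lebesgue_measure R).
Local Notation E := 'rV[R]_d.
Implicit Types (f g u v w : E -> R[i]) (s : R).

(** The sign s = -1 is the forward transform, s = 1 the inverse one without its factor (2 pi)^-d.
    Results under [s ^+ 2 = 1] cover both. *)
Definition FT s f : E -> R[i] := fun xi =>
  cint leb (fun t => f t * cis (s * dotp t xi)).

(** The square of [l2norm], kept as an extended real so that estimates are comparisons of integrals,
    with no square roots. *)
Definition nsq f : \bar R := (\int[leb]_x (normc (f x) ^+ 2)%:E)%E.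

Lemma nsq_ge0 f : (0 <= nsq f)%E.
Proof. by apply: integral_ge0 => x _; rewrite lee_fin sqr_ge0. Qed.

Lemma dotpC (x y : E) : dotp x y = dotp y x.
Proof. by apply: eq_bigr => i _; rewrite mulrC. Qed.

Lemma measurable_dotp : measurable_fun setT (fun z : E * E => dotp z.1 z.2).
Proof.
rewrite /dotp; under eq_fun do rewrite -[index_enum _]/(index_enum _).
apply: measurable_sum => i; apply: measurable_funM.
  exact: measurableT_comp (measurable_coord i) measurable_fst.
exact: measurableT_comp (measurable_coord i) measurable_snd.
Qed.

Lemma cmeas_kernel s : cmeas (fun z : E * E => cis (s * dotp z.1 z.2)).
Proof. by apply: cmeas_cis; apply: measurable_funM => //; exact: measurable_dotp. Qed.

Lemma cmeas_cisr s (y : E) : cmeas (fun x : E => cis (s * dotp x y)).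
Proof.
apply: cmeas_cis; apply: measurable_funM => //.
exact: measurableT_comp measurable_dotp (measurable_pair2 y).
Qed.

Lemma cintegrable_cisM s f (y : E) : cintegrable leb f ->
  cintegrable leb (fun x => f x * cis (s * dotp x y)).
Proof.
move=> If; apply: (@cintegrable_bounded _ _ _ _ 1 _ _ If (cmeas_cisr _ _)) => x.
by rewrite normc_cis.
Qed.

Lemma normc_FT s f (y : E) : cintegrable leb f ->
  normc (FT s f y) <= \int[leb]_x normc (f x).
Proof.
move=> If; apply: le_trans (normc_cint (cintegrable_cisM s y If)) _.
rewrite le_eqVlt; apply/orP; left; apply/eqP; apply: eq_Rintegral => x _.
by rewrite normcM normc_cis mulr1.
Qed.

Lemma cmeas_FT s f : cmeas f -> cmeas (FT s f).
Proof.
move=> mf.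
have mh : cmeas (fun z : E * E => f z.2 * cis (s * dotp z.2 z.1)).
  apply: cmeasM; first exact: cmeas_comp measurable_snd mf.
  by under eq_fun do rewrite dotpC; exact: cmeas_kernel.
by split; [have := measurable_Rintegral_section leb mh.1|
  have := measurable_Rintegral_section leb mh.2].
Qed.

(** The multiplication formula: u(x) v(y) times a unimodular kernel symmetric in x and y is
    integrable on the product, and the two orders of integration give the two sides. *)
Lemma cint_FT_transpose s u v : cintegrable leb u -> cintegrable leb v ->
  cint leb (fun x => FT s u x * v x) = cint leb (fun x => u x * FT s v x).
Proof.
move=> Iu Iv.
pose h := fun z : E * E => u z.1 * v z.2 * cis (s * dotp z.1 z.2).
have mh : cmeas h.
  apply: cmeasM; last exact: cmeas_kernel.
  apply: cmeasM; first exact: cmeas_comp measurable_fst Iu.1.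
  exact: cmeas_comp measurable_snd Iv.1.
have Ih : cintegrable (leb \x leb)%E h.
  apply: (cintegrable_tensor Iu Iv mh) => z.
  by rewrite /h !normcM normc_cis mulr1.
have I1 x : cintegrable leb (fun y => h (x, y)).
  have := cintegrableZ (u x) (cintegrable_cisM s x Iv).
  by under eq_fun do rewrite dotpC mulrA.
have I2 y : cintegrable leb (fun x => h (x, y)).
  have := cintegrableZ (v y) (cintegrable_cisM s y Iu).
  by under eq_fun do rewrite mulrA (mulrC (v y)).
have [h1 h2] := cint_prod Ih I1 I2.
transitivity (cint (leb \x leb)%E h).
  rewrite -h2; apply: eq_cint => y; rewrite mulrC -cintZ; last exact: cintegrable_cisM.
  by apply: eq_cint => x; rewrite mulrA (mulrC (v y)).
rewrite -h1; apply: eq_cint => x; rewrite -cintZ; last exact: cintegrable_cisM.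
by apply: eq_cint => y; rewrite dotpC mulrA.
Qed.

Lemma FT_prodf s (F : 'I_d -> R -> R[i]) (xi : E) :
  (forall i, cintegrable leb1 (F i)) ->
  FT s (prodf F) xi =
  \prod_(i < d) cint leb1 (fun t => F i t * cis (s * xi ord0 i * t)).
Proof.
move=> IF; rewrite -cint_prodf; last first.
  move=> i; apply: (@cintegrable_bounded _ _ _ _ 1 _ _ (IF i)).
    by apply: cmeas_cis; exact: measurable_funM.
  by move=> x; rewrite normc_cis.
apply: eq_cint => t; rewrite /prodf /dotp mulr_sumr cis_sum -big_split/=.
by apply: eq_bigr => i _; rewrite mulrA (mulrAC s).
Qed.

Definition abel_rV e (x : E) : R := \prod_(i < d) abel e (x ord0 i).
Definition poisson_rV e (x : E) : R := \prod_(i < d) poisson e (x ord0 i).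

Lemma abel_rVE e : (fun x => (abel_rV e x)%:C) = prodf (fun _ y => (abel e y)%:C).
Proof. by apply/funext => x; rewrite /abel_rV rmorph_prod. Qed.

Lemma cintegrable_abel e : 0 < e -> cintegrable leb1 (fun y => (abel e y)%:C).
Proof.
move=> e0; have := cintegrable_abel_cis 0 e0.
by under eq_fun do rewrite mul0r cis0 mulr1.
Qed.

Lemma cintegrable_abel_rV e : 0 < e -> cintegrable leb (fun x => (abel_rV e x)%:C).
Proof.
by move=> e0; rewrite abel_rVE; apply: cintegrable_prodf => i; exact: cintegrable_abel.
Qed.

Lemma FT_abel_rV s e (x : E) : 0 < e -> s ^+ 2 = 1 ->
  FT s (fun x => (abel_rV e x)%:C) x = (poisson_rV e x)%:C.
Proof.
move=> e0 s1; rewrite abel_rVE FT_prodf; last by move=> i; exact: cintegrable_abel.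
rewrite /poisson_rV rmorph_prod; apply: eq_bigr => i _.
by rewrite cint_abel_cis// /poisson exprMn s1 mul1r.
Qed.

Lemma abel_rV_ge0 e x : 0 <= abel_rV e x.
Proof. by apply: prodr_ge0 => i _; rewrite ltW// abel_gt0. Qed.

Lemma poisson_rV_ge0 e x : 0 < e -> 0 <= poisson_rV e x.
Proof. by move=> e0; apply: prodr_ge0 => i _; exact: poisson_ge0. Qed.

Lemma measurable_poisson_rV e : 0 < e ->
  measurable_fun setT (fun z : E * E => poisson_rV e (z.1 - z.2)).
Proof.
move=> e0; apply: measurable_prod => i _.
under eq_fun do rewrite !mxE.
rewrite (_ : (fun _ => _) = (fun y => poisson e (0 - y)) \o
  (fun z : E * E => z.2 ord0 i - z.1 ord0 i)); last first.
  by apply/funext => z /=; rewrite sub0r opprB.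
apply: measurableT_comp.
  by apply: continuous_measurable_fun; exact: continuous_poisson.
by apply: measurable_funB; [exact: measurableT_comp (measurable_coord i) measurable_snd|
  exact: measurableT_comp (measurable_coord i) measurable_fst].
Qed.

Lemma integral_poisson_rV e (x : E) : 0 < e ->
  (\int[leb]_y (poisson_rV e (x - y))%:E = ((2 * pi) ^+ d)%:E)%E.
Proof.
move=> e0.
have I i : cintegrable leb1 (fun y => (poisson e (x ord0 i - y))%:C).
  split.
    apply: cmeas_real; apply: continuous_measurable_fun; exact: continuous_poisson.
  have /integrableP[_] := integrable_poisson (x ord0 i) e0.
  apply: le_lt_trans; rewrite le_eqVlt; apply/orP; left; apply/eqP.
  by apply: eq_integral => y _; rewrite normc_real.
have E1 : (fun y => (poisson_rV e (x - y))%:C) =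
    prodf (fun i y => (poisson e (x ord0 i - y))%:C).
  apply/funext => y; rewrite /poisson_rV rmorph_prod.
  by apply: eq_bigr => i _; rewrite !mxE.
have IP : cintegrable leb (fun y => (poisson_rV e (x - y))%:C).
  by rewrite E1; exact: cintegrable_prodf.
have := cint_prodf I; rewrite -E1.
under [in RHS]eq_bigr do rewrite cint_real Rintegral_poisson//.
rewrite cint_real prodr_const card_ord -rmorphXn/= => /complexI <-.
rewrite /Rintegral fineK//; exact: integrable_fin_num (cintegrable_Re IP).
Qed.

Lemma cint_conj f : cintegrable leb f ->
  cint leb (fun x => (f x)^*%C) = (cint leb f)^*%C.
Proof.
move=> If; rewrite /cint /=; congr (_ +i* _).
  by apply: eq_Rintegral => x _; case: (f x).
rewrite -[RHS]mulN1r -RintegralZl//; last exact: cintegrable_Im.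
by apply: eq_Rintegral => x _; rewrite mulN1r; case: (f x).
Qed.

Lemma conjcM (z w : R[i]) : (z * w)^*%C = z^*%C * w^*%C.
Proof. exact: rmorphM. Qed.

Lemma FT_conj s f (y : E) : cintegrable leb f ->
  (FT s f y)^*%C = FT (- s) (fun x => (f x)^*%C) y.
Proof.
move=> If; rewrite /FT -cint_conj; last exact: cintegrable_cisM.
by apply: eq_cint => x; rewrite conjcM conj_cis mulNr.
Qed.

Lemma cintegrable_conj f : cintegrable leb f ->
  cintegrable leb (fun x => (f x)^*%C).
Proof.
move=> [mf If]; split; first exact: cmeas_conj.
by under eq_integral do rewrite normc_conj.
Qed.

Lemma poisson_rVC e (x y : E) : poisson_rV e (x - y) = poisson_rV e (y - x).
Proof.
by apply: eq_bigr => i _; rewrite !mxE /poisson -[in RHS]opprB sqrrN.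
Qed.

Lemma dotpBr (t x y : E) : dotp t (x - y) = dotp t x - dotp t y.
Proof.
by rewrite /dotp -sumrB; apply: eq_bigr => i _; rewrite !mxE mulrBr.
Qed.

(** The conjugate of [FT s v] is the transform with sign - s of the conjugate of v. Moving that
    transform onto the damped exponential by the multiplication formula produces a shifted Poisson
    kernel. *)
Lemma FT_weighted s e v (x : E) : s ^+ 2 = 1 -> 0 < e -> cintegrable leb v ->
  cintegrable leb (fun y => (v y)^*%C * (poisson_rV e (x - y))%:C) /\
  FT s (fun xi => (abel_rV e xi)%:C * (FT s v xi)^*%C) x =
  cint leb (fun y => (v y)^*%C * (poisson_rV e (x - y))%:C).
Proof.
move=> s1 e0 Iv.
have IW := cintegrable_abel_rV e0.
have Icv := cintegrable_conj Iv.
pose Wx xi := (abel_rV e xi)%:C * cis (s * dotp xi x).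
have IWx : cintegrable leb Wx by exact: cintegrable_cisM.
have E1 y : FT (- s) Wx y = (poisson_rV e (x - y))%:C.
  rewrite -(@FT_abel_rV s)//; apply: eq_cint => xi.
  by rewrite /Wx -mulrA -cisD mulNr -mulrBr dotpBr.
have Icv2 : cintegrable leb (fun y => (v y)^*%C * (poisson_rV e (x - y))%:C).
  under eq_fun do rewrite -E1.
  by apply: cintegrable_bounded Icv (cmeas_FT _ IWx.1) _ => y; exact: normc_FT.
split => //.
under eq_fun do rewrite FT_conj//.
transitivity (cint leb (fun xi => FT (- s) (fun x => (v x)^*%C) xi * Wx xi)).
  by apply: eq_cint => xi; rewrite /Wx mulrCA mulrA.
by rewrite cint_FT_transpose//; apply: eq_cint => y; rewrite E1.
Qed.

(** A Schur test. By the multiplication formula the damped integral of |FT v|^2 equals the integral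
    of v(x) conj(v(y)) P(x - y), P being the Poisson kernel; bound |v(x)| |v(y)| by (|v(x)|^2 +
    |v(y)|^2) / 2 and use that P has mass (2 pi)^d in either variable. *)
Lemma nsq_FT_abel_le s e v : s ^+ 2 = 1 -> 0 < e -> cintegrable leb v ->
  (\int[leb]_xi (abel_rV e xi * normc (FT s v xi) ^+ 2)%:E <=
   ((2 * pi) ^+ d)%:E * nsq v)%E.
Proof.
move=> s1 e0 Iv.
have mv : measurable_fun setT (fun x => normc (v x)) by exact: cmeas_normc Iv.1.
pose w xi := (abel_rV e xi)%:C * (FT s v xi)^*%C.
have mFT := cmeas_FT s Iv.1.
have Iw : cintegrable leb w.
  apply: cintegrable_bounded (cintegrable_abel_rV e0) (cmeas_conj mFT) _ => y.
  by rewrite normc_conj; exact: normc_FT.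
have IvF : cintegrable leb (fun x => v x * FT s w x).
  by apply: cintegrable_bounded Iv (cmeas_FT _ Iw.1) _ => y; exact: normc_FT.
have FE xi : FT s v xi * w xi = (abel_rV e xi * normc (FT s v xi) ^+ 2)%:C.
  by rewrite /w mulrCA mulc_conj -rmorphM.
have IFw : cintegrable leb (fun x => FT s v x * w x).
  under eq_fun do rewrite mulrC.
  by apply: cintegrable_bounded Iw mFT _ => y; exact: normc_FT.
have -> : (\int[leb]_xi (abel_rV e xi * normc (FT s v xi) ^+ 2)%:E =
    (normc (cint leb (fun x => v x * FT s w x)))%:E)%E.
  rewrite -cint_FT_transpose//.
  rewrite (eq_cint _ FE) cint_real normc_real ger0_norm; last first.
    by apply: Rintegral_ge0 => x _; rewrite mulr_ge0 ?abel_rV_ge0 ?sqr_ge0.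
  rewrite /Rintegral fineK//.
  have := integrable_fin_num measurableT (cintegrable_Re IFw).
  congr (_ \is a _); apply: eq_integral => xi _.
  by have /= -> := congr1 (@complex.Re R) (FE xi).
apply: le_trans (normc_cintE IvF) _.
pose P (z : E * E) := poisson_rV e (z.1 - z.2).
have mP : measurable_fun setT P by exact: measurable_poisson_rV.
have mP1 x : measurable_fun setT (fun y => P (x, y)).
  exact: measurableT_comp mP (measurable_pair1 x).
have mP2 y : measurable_fun setT (fun x => P (x, y)).
  exact: measurableT_comp mP (measurable_pair2 y).
have P0 z : 0 <= P z by exact: poisson_rV_ge0.
have mv2 := cmeas_normc2 Iv.1.
pose A (z : E * E) := ((normc (v z.1) ^+ 2 * P z / 2)%:E).
pose B (z : E * E) := ((normc (v z.2) ^+ 2 * P z / 2)%:E).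
have A0 z : (0 <= A z)%E by rewrite lee_fin divr_ge0// mulr_ge0 ?sqr_ge0.
have B0 z : (0 <= B z)%E by rewrite lee_fin divr_ge0// mulr_ge0 ?sqr_ge0.
have mv1 : measurable_fun setT (fun z : E * E => normc (v z.1)).
  exact: measurableT_comp mv measurable_fst.
have mvs : measurable_fun setT (fun z : E * E => normc (v z.2)).
  exact: measurableT_comp mv measurable_snd.
have mA : measurable_fun setT A.
  apply/measurable_EFinP; apply: measurable_funM => //.
  by apply: measurable_funM => //; exact: measurable_funX.
have mB : measurable_fun setT B.
  apply/measurable_EFinP; apply: measurable_funM => //.
  by apply: measurable_funM => //; exact: measurable_funX.
apply: (@le_trans _ _ (\int[leb]_x \int[leb]_y (A (x, y) + B (x, y)))%E).
  apply: ge0_le_integral => //.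
  - by move=> x _; rewrite lee_fin normc_ge0.
  - exact: cmeas_normcE IvF.1.
  - apply: (measurable_fun_fubini_tonelli_F (fun z => (A z + B z)%E)).
      exact: emeasurable_funD.
    by move=> z; exact: adde_ge0.
  move=> x _; rewrite normcM.
  have [Ix Ex] := FT_weighted x s1 e0 Iv.
  rewrite Ex EFinM.
  apply: (@le_trans _ _ ((normc (v x))%:E * \int[leb]_y (normc (v y) * P (x, y))%:E)%E).
    rewrite lee_wpmul2l ?lee_fin ?normc_ge0//.
    apply: le_trans (normc_cintE Ix) _; rewrite le_eqVlt; apply/orP; left; apply/eqP.
    by apply: eq_integral => y _; rewrite normcM normc_conj normc_real ger0_norm// (P0 (x,y)).
  rewrite -ge0_integralZl//; last 3 first.
  - by apply/measurable_EFinP; exact: measurable_funM.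
  - by move=> y _; rewrite lee_fin mulr_ge0 ?normc_ge0.
  - by rewrite lee_fin normc_ge0.
  apply: ge0_le_integral => //.
  - by move=> y _; rewrite -EFinM lee_fin !mulr_ge0 ?normc_ge0.
  - under eq_fun do rewrite -EFinM; apply/measurable_EFinP.
    by apply: measurable_funM => //; exact: measurable_funM.
  - by apply: emeasurable_funD;
      [exact: measurableT_comp mA (measurable_pair1 x)|
       exact: measurableT_comp mB (measurable_pair1 x)].
  - move=> y _; rewrite -EFinM -EFinD lee_fin /A /B/= -mulrDl -mulrDl.
    rewrite mulrA [leRHS]mulrAC ler_wpM2r//.
    by have := sqr_ge0 (normc (v x) - normc (v y)); nra.
under eq_integral => x _.
  rewrite ge0_integralD//; last 2 first.
  - exact: measurableT_comp mA (measurable_pair1 x).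
  - exact: measurableT_comp mB (measurable_pair1 x).
  over.
rewrite ge0_integralD//; last 4 first.
- by move=> x _; apply: integral_ge0.
- exact: (measurable_fun_fubini_tonelli_F A).
- by move=> x _; apply: integral_ge0.
- exact: (measurable_fun_fubini_tonelli_F B).
have half (Q : E -> R) x : measurable_fun setT Q -> (forall y, 0 <= Q y) ->
   (\int[leb]_y (Q y)%:E = ((2 * pi) ^+ d)%:E)%E ->
   (\int[leb]_y (normc (v x) ^+ 2 * Q y / 2)%:E =
     ((2 * pi) ^+ d / 2)%:E * (normc (v x) ^+ 2)%:E)%E.
  move=> mQ Q0 IQ; under eq_integral do rewrite mulrAC EFinM.
  rewrite ge0_integralZl//; last 3 first.
  - exact/measurable_EFinP.
  - by move=> y _; rewrite lee_fin.
  - by rewrite lee_fin divr_ge0// sqr_ge0.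
  by rewrite IQ -!EFinM; congr EFin; ring.
have c0 : (0 <= ((2 * pi) ^+ d / 2)%:E :> \bar R)%E.
  by rewrite lee_fin divr_ge0// exprn_ge0// mulr_ge0// pi_ge0.
have EA : (\int[leb]_x \int[leb]_y A (x, y) = ((2 * pi) ^+ d / 2)%:E * nsq v)%E.
  under eq_integral => x _.
    rewrite half//; last exact: integral_poisson_rV.
    over.
  by rewrite ge0_integralZl// => x _; rewrite lee_fin sqr_ge0.
have EB : (\int[leb]_x \int[leb]_y B (x, y) = ((2 * pi) ^+ d / 2)%:E * nsq v)%E.
  (* Here |v|^2 depends on the inner variable, so the order of integration is exchanged first; the
     kernel is even, hence has the same mass. *)
  rewrite (@fubini_tonelli _ _ _ _ _ leb leb B mB B0)/=.
  under eq_integral => y _.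
    rewrite half//; last first.
      by rewrite -(integral_poisson_rV y e0); apply: eq_integral => x _; rewrite poisson_rVC.
    over.
  by rewrite ge0_integralZl// => x _; rewrite lee_fin sqr_ge0.
by rewrite [X in (X + _)%E]EA [X in (_ + X)%E]EB -ge0_muleDl// -EFinD -splitr.
Qed.

Lemma cvg_abel_rV (x : E) : abel_rV n.+1%:R^-1 x @[n --> \oo] --> (1 : R).
Proof.
have h i : abel n.+1%:R^-1 (x ord0 i) @[n --> \oo] --> (1 : R).
  rewrite -[X in _ --> X]expR0 -[X in expR X]oppr0 -[X in - X](mul0r `|x ord0 i|).
  apply: (@continuous_cvg _ _ _ _ _ _ (@expR R)); first exact: continuous_expR.
  by apply: cvgN; apply: cvgM; [exact: cvg_harmonic|exact: cvg_cst].
have := @cvg_big _ _ _ (1 : R) xpredT (@mul_continuous R) _ \oo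
  (index_enum 'I_d) (fun i n => abel n.+1%:R^-1 (x ord0 i)) (fun=> 1) _
  (fun i _ => h i).
by rewrite big1// => h'; exact: h'.
Qed.

(** The damped bound is uniform in the damping, so Fatou's lemma removes it. *)
Lemma nsq_FT_le s v : s ^+ 2 = 1 -> cintegrable leb v ->
  (nsq (FT s v) <= ((2 * pi) ^+ d)%:E * nsq v)%E.
Proof.
move=> s1 Iv; have mFT := cmeas_FT s Iv.1.
apply: (@fatou_cvg_le _ _ _ _
  (fun n xi => abel_rV n.+1%:R^-1 xi * normc (FT s v xi) ^+ 2)).
- move=> n; apply: measurable_funM; last exact/measurable_funX/cmeas_normc.
  apply: measurable_prod => i _.
  exact: measurableT_comp (measurable_abel _) (measurable_coord i).
- exact/measurable_funX/cmeas_normc.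
- by move=> n x; rewrite mulr_ge0 ?abel_rV_ge0 ?sqr_ge0.
- apply: nearW => x; rewrite -[X in _ --> X]mul1r; apply: cvgM; last exact: cvg_cst.
  exact: cvg_abel_rV.
- by move=> n; apply: nsq_FT_abel_le.
Qed.

End fourier_transform.

(** * Schwartz functions on the line *)

Section schwartz1.
Variable R : realType.
Local Notation leb1 := (@lebesgue_measure R).
Implicit Types (phi : R -> R) (x y t : R).

(* One-variable Schwartz functions, described through a class of rapidly
   decreasing functions that is closed under differentiation. *)
Definition schwartz1 phi : Prop := exists B : set (R -> R), B phi /\
  forall psi, B psi -> [/\ forall x, derivable psi x 1, B (psi^`())%classic &
    forall k, exists M, forall x, (1 + `|x|) ^+ k * `|psi x| <= M].

Lemma schwartz1_derivable phi x : schwartz1 phi -> derivable phi x 1.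
Proof. by move=> [B [Bp /(_ _ Bp)[]]]. Qed.

Lemma schwartz1_derive phi : schwartz1 phi -> schwartz1 (phi^`())%classic.
Proof. by move=> [B [Bp BB]]; exists B; split => //; have [] := BB _ Bp. Qed.

Lemma schwartz1_bound phi k : schwartz1 phi ->
  exists M, forall x, (1 + `|x|) ^+ k * `|phi x| <= M.
Proof. by move=> [B [Bp /(_ _ Bp)[]]]. Qed.

Lemma schwartz1_is_derive phi x : schwartz1 phi ->
  is_derive x (1 : R) phi ((phi^`())%classic x).
Proof.
by move=> sp; split; [exact: schwartz1_derivable|rewrite derive1E].
Qed.

Lemma schwartz1_continuous phi : schwartz1 phi -> continuous phi.
Proof.
move=> sp x; apply/differentiable_continuous/derivable1_diffP.
exact: schwartz1_derivable.
Qed.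

Lemma schwartz1_measurable phi : schwartz1 phi -> measurable_fun setT phi.
Proof.
by move=> sp; apply: continuous_measurable_fun; exact: schwartz1_continuous.
Qed.

Lemma schwartz1_bounded phi : schwartz1 phi ->
  exists M, forall x, `|phi x| <= M.
Proof.
move=> /(schwartz1_bound 0)[M pM]; exists M => x.
by have := pM x; rewrite expr0 mul1r.
Qed.

Lemma schwartz1_le phi : schwartz1 phi ->
  exists2 C, 0 <= C & forall x, `|phi x| <= C * (1 + x ^+ 2)^-1.
Proof.
move=> /(schwartz1_bound 2)[M pM]; exists M.
  by rewrite (le_trans _ (pM 0))// mulr_ge0// exprn_ge0// addr_ge0.
move=> x; rewrite ler_pdivlMr ?ltr_pwDl ?sqr_ge0// (le_trans _ (pM x))// mulrC.
rewrite ler_wpM2r// sqrrD expr1n -(real_normK (num_real x)) lerD2r mul1r lerDl.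
by rewrite mulrn_wge0.
Qed.

Lemma schwartz1_integrableM phi (h : R -> R) : schwartz1 phi ->
  measurable_fun setT h -> (forall x, `|h x| <= 1) ->
  leb1.-integrable setT (EFin \o (fun x => phi x * h x)).
Proof.
move=> sp mh h1; have [C C0 pC] := schwartz1_le sp.
apply: (@le_integrable_oneDsqrV _ C).
  by apply: measurable_funM => //; exact: schwartz1_measurable.
by move=> y; rewrite normrM (le_trans _ (pC y))// ler_piMr.
Qed.

Lemma schwartz1_integrable phi : schwartz1 phi ->
  leb1.-integrable setT (EFin \o phi).
Proof.
move=> sp; have c1 x : `|(cst 1 : R -> R) x| <= 1 by rewrite normr1.
have := schwartz1_integrableM sp (measurable_cst (1 : R)) c1.
by apply: eq_integrable => // x _; rewrite /= mulr1.
Qed.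

Lemma schwartz1_cintegrable phi : schwartz1 phi ->
  cintegrable leb1 (fun x => (phi x)%:C).
Proof.
move=> sp; split; first by apply: cmeas_real; exact: schwartz1_measurable.
have /integrableP[_] := schwartz1_integrable sp.
apply: le_lt_trans; rewrite le_eqVlt; apply/orP; left; apply/eqP.
by apply: eq_integral => x _; rewrite normc_real.
Qed.

Lemma schwartz1_cvg0 phi : schwartz1 phi ->
  phi x @[x --> +oo] --> (0 : R) /\ phi x @[x --> -oo] --> (0 : R).
Proof.
move=> sp; have [C _ pC] := schwartz1_le sp; split.
  exact: (@cvg_oneDsqrV _ C).
exact: (@cvg_oneDsqrVNy _ C).
Qed.

Lemma cvg0_bounded (F : set_system R) {FF : Filter F} phi (h : R -> R) :
  (forall x, `|h x| <= 1) -> phi x @[x --> F] --> (0 : R) ->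
  phi x * h x @[x --> F] --> (0 : R).
Proof.
move=> h1 /cvgr0Pnorm_le p0; apply/cvgr0Pnorm_le => e /p0.
by apply: filterS => x; apply: le_trans; rewrite normrM ler_piMr.
Qed.

Lemma schwartz1_ibp phi (a : R) : schwartz1 phi ->
  \int[leb1]_x ((phi^`())%classic x * cos (a * x)) =
    a * \int[leb1]_x (phi x * sin (a * x)) /\
  \int[leb1]_x ((phi^`())%classic x * sin (a * x)) =
    - a * \int[leb1]_x (phi x * cos (a * x)).
Proof.
move=> sp; have sp' := schwartz1_derive sp.
have [py pNy] := schwartz1_cvg0 sp.
have ccos : continuous (fun x : R => cos (a * x)).
  by move=> y; apply: continuous_comp; [exact: mulrl_continuous|exact: continuous_cos].
have csin : continuous (fun x : R => sin (a * x)).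
  by move=> y; apply: continuous_comp; [exact: mulrl_continuous|exact: continuous_sin].
have mcos := continuous_measurable_fun ccos.
have msin := continuous_measurable_fun csin.
have cos1 x : `|cos (a * x)| <= 1 by exact: cos_max.
have sin1 x : `|sin (a * x)| <= 1 by exact: sin_max.
have Ipc := schwartz1_integrableM sp mcos cos1.
have Ips := schwartz1_integrableM sp msin sin1.
have Ip'c := schwartz1_integrableM sp' mcos cos1.
have Ip's := schwartz1_integrableM sp' msin sin1.
(* Integrates the derivative of phi u over the line, where the boundary terms vanish; used for (u,
   v, b) = (cos, sin, - a) and (sin, cos, a). *)
have key (u v : R -> R) (b : R) : (forall x, `|u x| <= 1) ->
    (forall x : R, is_derive x (1 : R) u (b * v x)) -> continuous u -> continuous v ->
    leb1.-integrable setT (EFin \o (fun x => (phi^`())%classic x * u x)) ->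
    leb1.-integrable setT (EFin \o (fun x => phi x * v x)) ->
    \int[leb1]_x ((phi^`())%classic x * u x) = - b * \int[leb1]_x (phi x * v x).
  move=> u1 du cu cv I1 I2.
  have I2b : leb1.-integrable setT (EFin \o (fun x => b * (phi x * v x))).
    by apply: (eq_integrable _ _ _ _ (integrableZl measurableT b I2)).
  apply/eqP; rewrite mulNr -addr_eq0 -RintegralZl// -RintegralD//; apply/eqP.
  rewrite -[RHS](subr0 0); apply: (@integral_FTC_line _ _ (fun x => phi x * u x)).
  - move=> x; have dp := schwartz1_is_derive x sp; have dux := du x.
    by apply: is_derive_eq; rewrite /GRing.scale/=; ring.
  - move=> x; apply: cvgD.
      by apply: cvgM; [exact: schwartz1_continuous|exact: cu].
    by apply: cvgM; [exact: cvg_cst|apply: cvgM; [exact: schwartz1_continuous|exact: cv]].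
  - have := integrableD measurableT I1 I2b.
    by apply: eq_integrable.
  - exact: cvg0_bounded.
  - exact: cvg0_bounded.
split.
  have dcos x : is_derive x (1 : R) (fun x => cos (a * x)) (- a * sin (a * x)).
    by rewrite mulNr; exact: is_derive_cosM.
  by have := key _ _ _ cos1 dcos ccos csin Ip'c Ips; rewrite opprK.
exact: (key _ _ _ sin1 (is_derive_sinM a) csin ccos Ip's Ipc).
Qed.

Definition FT1 phi (a : R) : R[i] := cint leb1 (fun t => (phi t)%:C * cis (a * t)).

Lemma FT1E phi a : FT1 phi a =
  (\int[leb1]_x (phi x * cos (a * x))) +i* (\int[leb1]_x (phi x * sin (a * x))).
Proof.
rewrite /FT1 /cint; congr (_ +i* _); apply: eq_Rintegral => x _.
  by rewrite /= mul0r subr0.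
by rewrite /= mul0r addr0.
Qed.

Lemma normc_FT1_derive phi a : schwartz1 phi ->
  normc (FT1 (phi^`())%classic a) = `|a| * normc (FT1 phi a).
Proof.
move=> sp; rewrite !FT1E; have [-> ->] := schwartz1_ibp a sp.
set u := Rintegral _ _ _; set v := Rintegral _ _ _.
rewrite /normc !exprMn sqrrN -mulrDr sqrtrM ?sqr_ge0// sqrtr_sqr.
by rewrite (addrC (u ^+ 2)).
Qed.

Lemma cintegrable_FT1_kernel phi a : schwartz1 phi ->
  cintegrable leb1 (fun t => (phi t)%:C * cis (a * t)).
Proof.
move=> sp; apply: (@cintegrable_bounded _ _ _ _ 1 _ _ (schwartz1_cintegrable sp)).
  by apply: cmeas_cis; exact: measurable_funM.
by move=> t; rewrite normc_cis.
Qed.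

Lemma normc_FT1 phi : schwartz1 phi -> exists C, forall a, normc (FT1 phi a) <= C.
Proof.
move=> sp; exists (\int[leb1]_x normc ((phi x)%:C)) => a.
apply: le_trans (normc_cint (cintegrable_FT1_kernel a sp)) _.
rewrite le_eqVlt; apply/orP; left; apply/eqP; apply: eq_Rintegral => t _.
by rewrite normcM normc_cis mulr1.
Qed.

(** Two integrations by parts: a^2 |FT1 phi| is the modulus of the transform of the second
    derivative, which is bounded because that derivative is integrable. *)
Lemma FT1_le phi : schwartz1 phi ->
  exists C, forall a, normc (FT1 phi a) <= C * (1 + a ^+ 2)^-1.
Proof.
move=> sp; have [C pC] := normc_FT1 sp.
have [C2 pC2] := normc_FT1 (schwartz1_derive (schwartz1_derive sp)).
exists (C + C2) => a; rewrite ler_pdivlMr ?ltr_pwDl ?sqr_ge0//.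
rewrite mulrDr mulr1 lerD// (le_trans _ (pC2 a))//.
rewrite !normc_FT1_derive//; last exact: schwartz1_derive.
by rewrite mulrA -expr2 real_normK ?num_real// mulrC.
Qed.

Lemma cmeas_FT1 phi : schwartz1 phi -> cmeas (FT1 phi).
Proof.
move=> sp.
have mh : cmeas (fun z : R * R => (phi z.2)%:C * cis (z.1 * z.2)).
  apply: cmeasM.
    apply: cmeas_real; exact: measurableT_comp (schwartz1_measurable sp) measurable_snd.
  by apply: cmeas_cis; exact: measurable_funM.
by split; [have := measurable_Rintegral_section leb1 mh.1|
  have := measurable_Rintegral_section leb1 mh.2].
Qed.

Lemma cintegrable_FT1 phi : schwartz1 phi -> cintegrable leb1 (FT1 phi).
Proof.
move=> sp; have [C pC] := FT1_le sp.
have := integrable_oneDsqrVM C => /integrableP[mC IC].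
have := @cintegrable_le _ _ R leb1 (FT1 phi) (fun a => C * (1 + a ^+ 2)^-1)
  (cmeas_FT1 sp).
apply => //.
  by move/measurable_EFinP : mC.
apply: le_lt_trans IC; apply: ge0_le_integral => //.
- by move=> a _; rewrite lee_fin (le_trans _ (pC a))// normc_ge0.
- exact: measurableT_comp.
- by move=> a _; rewrite /= lee_fin ler_norm.
Qed.

Lemma schwartz1_lipschitz phi : schwartz1 phi ->
  exists2 L, 0 <= L & forall x y, `|phi x - phi y| <= L * `|x - y|.
Proof.
move=> sp; have [L pL] := schwartz1_bounded (schwartz1_derive sp).
exists L; first exact: le_trans (pL 0).
move=> x y; wlog xy : x y / x <= y.
  by move=> H; case: (leP x y) => [/H//|/ltW/H]; rewrite distrC (distrC y).
move: xy; rewrite le_eqVlt => /predU1P[->|xy]; first by rewrite !subrr normr0 mulr0.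
have [|c _ E] := MVT xy (fun z _ => schwartz1_is_derive z sp).
  by apply: continuous_subspaceT; exact: schwartz1_continuous.
by rewrite distrC E (distrC x) normrM ler_wpM2r.
Qed.

(** The Poisson kernel as an approximate identity, without splitting into near and far regions.
    After subtraction of phi(x) the integrand is dominated, uniformly in the height e <= 1, by a
    multiple of the kernel at height 1: with t = x - y, the Lipschitz bound and e |t| <= (e^2 + t^2)
    / 2 pay for the 1 in 1 + t^2, the bound 2 M pays for the t^2. *)
Lemma cvg_poisson_schwartz1 phi x : schwartz1 phi ->
  \int[leb1]_y (phi y * poisson n.+1%:R^-1 (x - y)) @[n --> \oo] --> 2 * pi * phi x.
Proof.
move=> sp; have [L L0 pL] := schwartz1_lipschitz sp.
have [M pM] := schwartz1_bounded sp.
have M0 : 0 <= M by exact: le_trans (pM 0).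
have mp (e : R) : 0 < e -> measurable_fun setT (fun y => poisson e (x - y)).
  by move=> e0; apply: continuous_measurable_fun; exact: continuous_poisson.
have mphi := schwartz1_measurable sp.
have Ip n : leb1.-integrable setT (EFin \o (fun y => poisson n.+1%:R^-1 (x - y))).
  exact: integrable_poisson.
have Ipp n : leb1.-integrable setT
    (EFin \o (fun y => phi y * poisson n.+1%:R^-1 (x - y))).
  apply: (le_integrable measurableT _ _ (integrableZl measurableT M (Ip n))).
    by apply/measurable_EFinP; apply: measurable_funM => //; exact: mp.
  move=> y _; rewrite /= lee_fin normrM.
  by rewrite !normrM ler_wpM2r// (ger0_norm M0).
have Icp n : leb1.-integrable setT
    (EFin \o (fun y => phi x * poisson n.+1%:R^-1 (x - y))).
  by apply: (eq_integrable _ _ _ _ (integrableZl measurableT (phi x) (Ip n))).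
have h : \int[leb1]_y ((phi y - phi x) * poisson n.+1%:R^-1 (x - y)) @[n --> \oo]
    --> \int[leb1]_y (0 : R).
  apply: (@Rintegral_dominated_cvg _ _ R leb1
    (fun n y => (phi y - phi x) * poisson n.+1%:R^-1 (x - y)) (fun=> 0)
    (fun y => (L + 4 * M) * poisson 1 (x - y))).
  - move=> n; apply: measurable_funM; last exact: mp.
    by apply: measurable_funB.
  - exact: measurable_cst.
  (* At y = x the kernel blows up, but the factor phi(y) - phi(x) is zero there. *)
  - apply: nearW => y; have [->|yx] := eqVneq y x.
      by rewrite subrr; under eq_fun do rewrite mul0r; exact: cvg_cst.
    have xy0 : x - y != 0 by rewrite subr_eq0 eq_sym.
    rewrite -(mulr0 (phi y - phi x)); apply: cvgM; first exact: cvg_cst.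
    rewrite /poisson -(mul0r ((0 ^+ 2 + (x - y) ^+ 2)^-1)) -{1}(mulr0 2).
    apply: cvgM; first by apply: cvgM; [exact: cvg_cst|exact: cvg_harmonic].
    apply: cvgV; first by rewrite expr0n/= add0r expf_neq0.
    apply: cvgD; last exact: cvg_cst.
    by rewrite !expr2; under eq_fun do rewrite expr2; apply: cvgM; exact: cvg_harmonic.
  - by apply: (eq_integrable _ _ _ _ (integrableZl measurableT _ (integrable_poisson x ltr01))).
  - move=> n y; set e := n.+1%:R^-1; have e0 : 0 < e by rewrite invr_gt0.
    have e1 : e <= 1 by rewrite invf_le1// ler1n.
    rewrite normrM (ger0_norm (poisson_ge0 _ e0)) /poisson expr1n.
    have dL : `|phi y - phi x| <= L * `|x - y| by rewrite (distrC x).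
    have dM : `|phi y - phi x| <= 2 * M.
      by rewrite (le_trans (ler_normB _ _))// mulr_natl mulr2n lerD.
    move: (normr_ge0 (phi y - phi x)) dL dM.
    move: (x - y) (`|phi y - phi x|) => t D D0 dL dM.
    have t2 : 0 < 1 + t ^+ 2 by rewrite ltr_pwDl ?sqr_ge0.
    have et2 : 0 < e ^+ 2 + t ^+ 2 by rewrite ltr_pwDl ?sqr_ge0// exprn_gt0.
    rewrite mulr1 !mulrA ler_pdivlMr// mulrAC ler_pdivrMr//.
    have et : e * `|t| <= (e ^+ 2 + t ^+ 2) / 2.
      rewrite -(real_normK (num_real t)).
      by have := sqr_ge0 (e - `|t|); move: (`|t|) => a; nra.
    have h1 : D * e <= L * ((e ^+ 2 + t ^+ 2) / 2).
      apply: le_trans (_ : L * (e * `|t|) <= _); last by rewrite ler_wpM2l.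
      by rewrite mulrCA mulrC ler_wpM2l// ltW.
    have h2 : D * e * t ^+ 2 <= 2 * M * (e ^+ 2 + t ^+ 2).
      rewrite -mulrA; apply: ler_pM => //; first by rewrite mulr_ge0 ?sqr_ge0// ltW.
      rewrite (@le_trans _ _ (t ^+ 2))//; first by rewrite ler_piMl// sqr_ge0.
      by rewrite lerDr sqr_ge0.
    have h3 : 0 <= L * (e ^+ 2 + t ^+ 2) by rewrite mulr_ge0// ltW.
    have h4 : 0 <= M * (e ^+ 2 + t ^+ 2) by rewrite mulr_ge0// ltW.
    rewrite -subr_ge0.
    have -> : (L + 4 * M) * 2 * (e ^+ 2 + t ^+ 2) - D * 2 * e * (1 + t ^+ 2) =
      2 * (L * ((e ^+ 2 + t ^+ 2) / 2) - D * e) +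
      2 * (2 * M * (e ^+ 2 + t ^+ 2) - D * e * t ^+ 2) +
      L * (e ^+ 2 + t ^+ 2) + 4 * (M * (e ^+ 2 + t ^+ 2)) by field.
    by rewrite !addr_ge0// mulr_ge0// subr_ge0.
have E n : \int[leb1]_y ((phi y - phi x) * poisson n.+1%:R^-1 (x - y)) =
    \int[leb1]_y (phi y * poisson n.+1%:R^-1 (x - y)) - 2 * pi * phi x.
  under eq_Rintegral do rewrite mulrBl.
  by rewrite RintegralB// RintegralZl// Rintegral_poisson// mulrC.
rewrite Rintegral_cst// mul0r in h.
rewrite -[X in _ --> X]add0r.
apply: cvg_trans (cvgD h (cvg_cst (2 * pi * phi x))).
apply: near_eq_cvg; apply: nearW => n /=.
by rewrite -[RHS](subrK (2 * pi * phi x)) -E.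
Qed.

End schwartz1.

(** * Fourier inversion for tensor products *)

Lemma cint_dominated_cvg d (T : measurableType d) (R : realType)
    (mu : {measure set T -> \bar R}) (f_ : nat -> T -> R[i]) (f g : T -> R[i]) :
  (forall n, cmeas (f_ n)) -> cmeas f -> cintegrable mu g ->
  (forall n x, normc (f_ n x) <= normc (g x)) ->
  {ae mu, forall x, complex.Re (f_ n x) @[n --> \oo] --> complex.Re (f x)} ->
  {ae mu, forall x, complex.Im (f_ n x) @[n --> \oo] --> complex.Im (f x)} ->
  complex.Re (cint mu (f_ n)) @[n --> \oo] --> complex.Re (cint mu f) /\
  complex.Im (cint mu (f_ n)) @[n --> \oo] --> complex.Im (cint mu f).
Proof.
move=> mf_ mf Ig fg cRe cIm.
have H := fun a b c e => @Rintegral_dominated_cvg _ T R mu a b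
  (fun x => normc (g x)) c e.
split; rewrite /cint/=.
  apply: (H (fun n x => complex.Re (f_ n x)) (fun x => complex.Re (f x))) => //.
  - by move=> n; exact: (mf_ n).1.
  - exact: mf.1.
  - exact: cintegrable_normc.
  - by move=> n x; exact: le_trans (normc_Re _) (fg n x).
apply: (H (fun n x => complex.Im (f_ n x)) (fun x => complex.Im (f x))) => //.
- by move=> n; exact: (mf_ n).2.
- exact: mf.2.
- exact: cintegrable_normc.
- by move=> n x; exact: le_trans (normc_Im _) (fg n x).
Qed.

Lemma Re_mulr (R : realType) (r : R) (z : R[i]) :
  complex.Re (r%:C * z) = r * complex.Re z.
Proof. by case: z => a b /=; rewrite mul0r subr0. Qed.

Lemma Im_mulr (R : realType) (r : R) (z : R[i]) :
  complex.Im (r%:C * z) = r * complex.Im z.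
Proof. by case: z => a b /=; rewrite mul0r addr0. Qed.

Lemma cintegrable_real d (T : measurableType d) (R : realType)
    (mu : {measure set T -> \bar R}) (u : T -> R) :
  mu.-integrable setT (EFin \o u) -> cintegrable mu (fun x => (u x)%:C).
Proof.
move=> /integrableP[/measurable_EFinP mu' Iu]; split; first exact: cmeas_real.
by under eq_integral do rewrite normc_real.
Qed.

Section test_functions.
Context {R : realType} {d : nat}.
Local Notation leb := (lebesgue_rV R d).
Local Notation leb1 := (@lebesgue_measure R).
Local Notation E := 'rV[R]_d.
Implicit Types (f g u v w : E -> R[i]) (s : R) (phi : 'I_d -> R -> R).

Lemma nsq_bounded_lty (M : R) f : cintegrable leb f ->
  (forall x, normc (f x) <= M) -> (nsq f < +oo)%E.
Proof.
move=> If fM; have [mf If2] := If.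
have M0 : 0 <= M by exact: le_trans (normc_ge0 (f 0)) (fM 0).
have h : (nsq f <= \int[leb]_x (M%:E * (normc (f x))%:E))%E.
  apply: ge0_le_integral => //.
  - by move=> x _; rewrite lee_fin sqr_ge0.
  - exact: cmeas_normc2.
  - by apply/measurable_EFinP; apply: measurable_funM => //; exact: cmeas_normc.
  - by move=> x _; rewrite -EFinM lee_fin expr2 ler_wpM2r ?normc_ge0.
apply: le_lt_trans h _; rewrite ge0_integralZl//.
- by rewrite lte_mul_pinfty.
- exact: cmeas_normcE.
- by move=> x _; rewrite lee_fin normc_ge0.
Qed.

Definition rprod phi (x : E) : R := \prod_(i < d) phi i (x ord0 i).

Definition tensor phi (x : E) : R[i] := (rprod phi x)%:C.

Lemma tensorE phi : tensor phi = prodf (fun i y => (phi i y)%:C).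
Proof. by apply/funext => x; rewrite /tensor /rprod rmorph_prod. Qed.

Lemma cintegrable_tensor_schwartz1 phi : (forall i, schwartz1 (phi i)) ->
  cintegrable leb (tensor phi).
Proof.
by move=> sp; rewrite tensorE; apply: cintegrable_prodf => i; exact: schwartz1_cintegrable.
Qed.

Lemma tensor_bounded phi : (forall i, schwartz1 (phi i)) ->
  exists M, forall x, normc (tensor phi x) <= M.
Proof.
move=> sp; have /choice[M pM] i : exists M, forall x, `|phi i x| <= M.
  exact: schwartz1_bounded.
exists (\prod_i M i) => x; rewrite /tensor normc_real /rprod normr_prod.
by apply: ler_prod => i _; rewrite normr_ge0 pM.
Qed.

Lemma nsq_tensor_lty phi : (forall i, schwartz1 (phi i)) -> (nsq (tensor phi) < +oo)%E.
Proof.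
move=> sp; have [M pM] := tensor_bounded sp.
exact: nsq_bounded_lty (cintegrable_tensor_schwartz1 sp) pM.
Qed.

Lemma FT_tensor s phi (xi : E) : (forall i, schwartz1 (phi i)) ->
  FT s (tensor phi) xi = prodf (fun i a => FT1 (phi i) (s * a)) xi.
Proof.
move=> sp; rewrite tensorE FT_prodf//.
by move=> i; exact: schwartz1_cintegrable.
Qed.

Lemma cintegrable_FT1_sign s (phi : R -> R) : s ^+ 2 = 1 -> schwartz1 phi ->
  cintegrable leb1 (fun a => FT1 phi (s * a)).
Proof.
move=> s1 sp; have [mF IF] := cintegrable_FT1 sp.
(* For real phi, changing the sign of the frequency conjugates the transform, so its modulus is
   even. *)
have N a : normc (FT1 phi (s * a)) = normc (FT1 phi a).
  move/eqP: s1; rewrite sqrf_eq1 => /orP[]/eqP ->; first by rewrite mul1r.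
  rewrite !FT1E mulN1r /normc; congr (Num.sqrt _); rewrite -[in RHS](sqrrN (\int[leb1]_x (phi x * sin (a * x)))).
  congr (_ ^+ 2 + _ ^+ 2).
    by apply: eq_Rintegral => x _; rewrite mulNr cosN.
  rewrite -[RHS]mulN1r -RintegralZl//.
    by apply: eq_Rintegral => x _; rewrite mulNr sinN mulrN mulN1r.
  apply: schwartz1_integrableM => //; last by move=> x; exact: sin_max.
  apply: continuous_measurable_fun => y.
  by apply: continuous_comp; [exact: mulrl_continuous|exact: continuous_sin].
split; first by apply: (cmeas_comp _ mF); exact: measurable_funM.
by under eq_integral do rewrite N.
Qed.

Lemma cintegrable_FT_tensor s phi : s ^+ 2 = 1 -> (forall i, schwartz1 (phi i)) ->
  cintegrable leb (FT s (tensor phi)).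
Proof.
move=> s1 sp.
rewrite (_ : FT s _ = prodf (fun i a => FT1 (phi i) (s * a))); last first.
  by apply/funext => xi; rewrite FT_tensor.
by apply: cintegrable_prodf => i; exact: cintegrable_FT1_sign.
Qed.

Lemma FT_abel_cis s e (x y : E) : s ^+ 2 = 1 -> 0 < e ->
  FT s (fun xi => (abel_rV e xi)%:C * cis (- s * dotp xi x)) y =
  (poisson_rV e (x - y))%:C.
Proof.
move=> s1 e0; rewrite -(@FT_abel_rV _ _ (- s)) ?sqrrN//; apply: eq_cint => xi.
by rewrite -mulrA -cisD dotpBr; congr (_ * cis _); ring.
Qed.

(** Damp the outer integral; the damping is removed by dominated convergence because the transform
    of the tensor product is integrable. With damping, the multiplication formula gives a Poisson
    integral that factors over the coordinates, and each factor converges by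
    [cvg_poisson_schwartz1]. *)
Lemma FT_inversion s phi (x : E) : s ^+ 2 = 1 -> (forall i, schwartz1 (phi i)) ->
  FT (- s) (FT s (tensor phi)) x = ((2 * pi) ^+ d)%:C * tensor phi x.
Proof.
move=> s1 sp.
have Iv := cintegrable_tensor_schwartz1 sp.
have IF := cintegrable_FT_tensor s1 sp.
pose e (n : nat) : R := n.+1%:R^-1.
have e0 n : 0 < e n by rewrite invr_gt0.
pose k n xi := (abel_rV (e n) xi)%:C * cis (- s * dotp xi x).
have Ik n : cintegrable leb (k n).
  by apply: cintegrable_cisM; exact: cintegrable_abel_rV.
have le1 n (xi : E) : abel_rV (e n) xi <= 1.
  rewrite -[leRHS](@big1 R 1 *%R 'I_d (index_enum _) xpredT (fun=> 1))//.
  apply: ler_prod => i _; rewrite expR_ge0/= -expR0 ler_expR.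
  by rewrite oppr_le0 mulr_ge0// ltW.
have cvk xi (r : R) : abel_rV (e n) xi * r @[n --> \oo] --> r.
  rewrite -[X in _ --> X]mul1r; apply: cvgM; [exact: cvg_abel_rV|exact: cvg_cst].
have [|||cR cI] := @cint_dominated_cvg _ _ R leb
  (fun n xi => FT s (tensor phi) xi * k n xi)
  (fun xi => FT s (tensor phi) xi * cis (- s * dotp xi x)) (FT s (tensor phi))
  (fun n => cmeasM IF.1 (Ik n).1) (cmeasM IF.1 (cmeas_cisr _ _)) IF.
- move=> n xi; rewrite !normcM normc_cis mulr1 normc_real ger0_norm ?abel_rV_ge0//.
  by rewrite ler_piMr ?normc_ge0.
- apply: nearW => xi; set z := FT s (tensor phi) xi * _.
  rewrite (_ : (fun n => _) = fun n => abel_rV (e n) xi * complex.Re z).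
    exact: cvk.
  by apply/funext => n; rewrite /k mulrCA Re_mulr.
- apply: nearW => xi; set z := FT s (tensor phi) xi * _.
  rewrite (_ : (fun n => _) = fun n => abel_rV (e n) xi * complex.Im z).
    exact: cvk.
  by apply/funext => n; rewrite /k mulrCA Im_mulr.
have Gn n : cint leb (fun xi => FT s (tensor phi) xi * k n xi) =
    (\prod_(i < d) \int[leb1]_y (phi i y * poisson (e n) (x ord0 i - y)))%:C.
  rewrite cint_FT_transpose//.
  transitivity (cint leb (prodf (fun i y => (phi i y * poisson (e n) (x ord0 i - y))%:C))).
    apply: eq_cint => y; rewrite FT_abel_cis// tensorE /prodf /poisson_rV rmorph_prod.
    by rewrite -big_split/=; apply: eq_bigr => i _; rewrite !mxE -rmorphM.
  rewrite cint_prodf; last first.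
    move=> i; have [M pM] := schwartz1_bounded (sp i).
    under eq_fun do rewrite rmorphM mulrC.
    apply: (@cintegrable_bounded _ _ _ _ M).
    - by apply: cintegrable_real; exact: integrable_poisson.
    - by apply: cmeas_real; exact: schwartz1_measurable.
    - by move=> y; rewrite normc_real.
  by rewrite rmorph_prod; apply: eq_bigr => i _; rewrite cint_real.
rewrite /FT; apply/eqP; rewrite eq_complex Re_mulr Im_mulr.
rewrite [complex.Re (tensor _ _)]/= [complex.Im (tensor _ _)]/= mulr0.
pose p n := \prod_(i < d) \int[leb1]_y (phi i y * poisson (e n) (x ord0 i - y)).
apply/andP; split; apply/eqP.
  move: cR; rewrite (_ : (fun n => complex.Re _) = p); last first.
    by apply/funext => n; rewrite Gn.
  move=> /cvg_unique; apply => //.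
  have -> : (2 * pi) ^+ d * rprod phi x = \prod_(i < d) (2 * pi * phi i (x ord0 i)).
    by rewrite big_split/= prodr_const card_ord.
  apply: cvg_big => [|i _]; first exact: mul_continuous.
  exact: cvg_poisson_schwartz1.
move: cI; rewrite (_ : (fun n => complex.Im _) = cst 0); last first.
  by apply/funext => n; rewrite Gn.
by move=> /cvg_unique; apply => //; exact: cvg_cst.
Qed.

End test_functions.

(** * Tensor products as test functions *)

Section sigmoid.
Variable R : realType.
Variables (k : nat) (a : R).
Let c : R := k.+1%:R.

(* Smooth approximation of the indicator function of the half-line beyond [a];
   the factor [c] in front of the exponential makes it converge to 0 at [a]. *)
Definition sigmoid (x : R) : R := (1 + c * expR (- (c ^+ 2 * (x - a))))^-1.

Let c0 : 0 < c. Proof. by rewrite ltr0n. Qed.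

Let den_gt0 x : 0 < 1 + c * expR (- (c ^+ 2 * (x - a))).
Proof. by rewrite ltr_wpDr// mulr_ge0 ?expR_ge0// ltW. Qed.

Lemma sigmoid_ge0 x : 0 <= sigmoid x.
Proof. by rewrite invr_ge0 ltW. Qed.

Lemma sigmoid_le1 x : sigmoid x <= 1.
Proof. by rewrite invf_le1// lerDl mulr_ge0 ?expR_ge0// ltW. Qed.

(** The logistic differential equation: the derivative is a polynomial in [sigmoid] itself. *)
Lemma is_derive_sigmoid (x : R) :
  is_derive x (1 : R) sigmoid (c ^+ 2 * (sigmoid x - sigmoid x ^+ 2)).
Proof.
have de : is_derive x (1 : R) (fun x => expR (- (c ^+ 2 * (x - a))))
    (expR (- (c ^+ 2 * (x - a))) *: (- (c ^+ 2 * (1 - 0)))).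
  by apply: is_derive1_comp.
have n0 : 1 + c * expR (- (c ^+ 2 * (x - a))) != 0 by rewrite gt_eqF.
rewrite /sigmoid; apply: is_derive_eq; rewrite /GRing.scale/=.
move: n0; move: (expR _) => t; generalize c => r n0; field.
by [].
Qed.

(** The witness class for [schwartz1]: by the logistic equation, combinations of x^p sigmoid^m exp(-
    x^2) are closed under differentiation, and the Gaussian makes all of them decay rapidly. *)
Inductive sigmoid_gauss : (R -> R) -> Prop :=
| SGbase p m : sigmoid_gauss (fun x => x ^+ p * sigmoid x ^+ m * expR (- x ^+ 2))
| SGadd f g : sigmoid_gauss f -> sigmoid_gauss g -> sigmoid_gauss (fun x => f x + g x)
| SGscale r f : sigmoid_gauss f -> sigmoid_gauss (fun x => r * f x).

Lemma sigmoid_gauss_derive f : sigmoid_gauss f ->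
  exists2 g, sigmoid_gauss g & forall x : R, is_derive x (1 : R) f (g x).
Proof.
elim=> [p m|f1 f2 _ [g1 G1 d1] _ [g2 G2 d2]|r f1 _ [g1 G1 d1]].
- exists (fun x => (p%:R * (x ^+ p.-1 * sigmoid x ^+ m * expR (- x ^+ 2)) +
     (m%:R * c ^+ 2) * (x ^+ p * sigmoid x ^+ m * expR (- x ^+ 2))) +
     ((- (m%:R * c ^+ 2)) * (x ^+ p * sigmoid x ^+ m.+1 * expR (- x ^+ 2)) +
     (- 2) * (x ^+ p.+1 * sigmoid x ^+ m * expR (- x ^+ 2)))).
    by apply: SGadd; apply: SGadd; apply: SGscale; exact: SGbase.
  move=> x; have ds := is_derive_sigmoid x.
  have dX (h : R -> R) (dh : R) n : is_derive x (1 : R) h dh ->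
      is_derive x (1 : R) (fun y => h y ^+ n) (n%:R * h x ^+ n.-1 * dh).
    move=> hd; have := is_deriveX n hd.
    by rewrite (_ : h ^+ n = fun y => h y ^+ n)//; apply/funext => y; rewrite exprfctE.
  have dxp := dX _ _ p (is_derive_id x (1 : R)).
  have dx2 := dX _ _ 2 (is_derive_id x (1 : R)).
  have de : is_derive x (1 : R) (fun x => expR (- x ^+ 2))
      (expR (- x ^+ 2) * (- (2%:R * x ^+ 1 * 1))).
    by apply: is_derive1_comp.
  have dsm := dX _ _ m ds.
  apply: is_derive_eq; rewrite /GRing.scale/=.
  (* The truncated predecessor of the exponent m = 0 does no harm, since the coefficient m is then
     0. *)
  case: m dsm => [|m] dsm /=; rewrite ?exprS; ring.
- by exists (fun x => g1 x + g2 x); [exact: SGadd|move=> x; exact: is_deriveD].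
- exists (fun x => r * g1 x); first exact: SGscale.
  by move=> x; exact: is_deriveZ.
Qed.

(** With u = 1 + |x|, one term of the exponential series gives u^(j+1) <= (j+1)! exp(u), and u - x^2
    <= 2. *)
Lemma expR_sqr_decay j : exists M : R, forall x, (1 + `|x|) ^+ j * expR (- x ^+ 2) <= M.
Proof.
exists (j.+1`!%:R * expR 2 + expR 2) => x; set u := 1 + `|x|.
have u1 : 1 <= u by rewrite lerDl.
have u0 : 0 <= u by rewrite (le_trans _ u1).
have uj : u ^+ j <= u ^+ j.+1 by rewrite exprS ler_peMl ?exprn_ge0.
have eu : u ^+ j.+1 <= j.+1`!%:R * expR u.
  have := expR_ge1Dxn j u0; rewrite -lerBrDl ler_pdivrMr ?ltr0n ?fact_gt0// mulrC.
  move=> h; apply: le_trans h _; rewrite ler_wpM2l ?ler0n//.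
  by rewrite gerBl.
have ex : expR u * expR (- x ^+ 2) <= expR 2.
  rewrite -expRD ler_expR /u -(real_normK (num_real x)).
  by have := sqr_ge0 (`|x| - 1); move: (`|x|) => t; nra.
apply: le_trans (_ : u ^+ j.+1 * expR (- x ^+ 2) <= _).
  by rewrite ler_wpM2r ?expR_ge0.
apply: le_trans (_ : j.+1`!%:R * expR u * expR (- x ^+ 2) <= _).
  by rewrite ler_wpM2r ?expR_ge0.
rewrite -mulrA (le_trans (ler_wpM2l _ ex)) ?ler0n//.
by rewrite lerDl expR_ge0.
Qed.

Lemma sigmoid_gauss_decay f j : sigmoid_gauss f ->
  exists M, forall x, (1 + `|x|) ^+ j * `|f x| <= M.
Proof.
elim=> [p m|f1 f2 _ [M1 h1] _ [M2 h2]|r f1 _ [M1 h1]].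
- have [M pM] := expR_sqr_decay (j + p); exists M => x.
  apply: le_trans (pM x).
  rewrite 2!normrM (ger0_norm (expR_ge0 _)) mulrA ler_wpM2r ?expR_ge0//.
  rewrite exprD ler_wpM2l ?exprn_ge0 ?addr_ge0//.
  rewrite normrX normrX (ger0_norm (sigmoid_ge0 _)).
  apply: le_trans (_ : `|x| ^+ p * 1 <= _).
    by rewrite ler_wpM2l ?exprn_ge0// exprn_ile1 ?sigmoid_ge0 ?sigmoid_le1.
  by rewrite mulr1 lerXn2r ?nnegrE ?addr_ge0// lerDr.
- exists (M1 + M2) => x; apply: le_trans (lerD (h1 x) (h2 x)).
  by rewrite -mulrDr ler_wpM2l ?exprn_ge0 ?addr_ge0// ler_normD.
- exists (`|r| * M1) => x.
  by rewrite normrM mulrCA ler_wpM2l.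
Qed.

Lemma schwartz1_sigmoid_gauss f : sigmoid_gauss f -> schwartz1 f.
Proof.
move=> sf; exists sigmoid_gauss; split => // psi sp.
have [g sg dg] := sigmoid_gauss_derive sp; split.
- by move=> x; case: (dg x).
- rewrite (_ : (psi^`())%classic = g)//; apply/funext => x.
  by rewrite derive1E; case: (dg x).
- by move=> j; exact: sigmoid_gauss_decay.
Qed.

Lemma schwartz1_sigmoid : schwartz1 (fun x => sigmoid x * expR (- x ^+ 2)).
Proof.
have := schwartz1_sigmoid_gauss (SGbase 0 1).
by under eq_fun do rewrite expr0 mul1r expr1.
Qed.

End sigmoid.

Section sigmoid_limit.
Variable R : realType.

(** With c = k + 1: for x <= a the exponential is at least 1 and the value is below 1 / c; for x >
    a, exp(- t) <= 1 / t keeps the value above 1 - 1 / (c (x - a)). Both cases are squeezes. *)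
Lemma cvg_sigmoid (a x : R) :
  sigmoid k a x @[k --> \oo] --> (((a < x)%R)%:R : R).
Proof.
have [ax|xa] := ltP a x; last first.
  apply: (@squeeze_cvgr _ _ _ _ (fun=> 0) (fun k => k.+1%:R^-1)) => //.
  - apply: nearW => k; rewrite sigmoid_ge0/= /sigmoid.
    rewrite lef_pV2 ?posrE ?ltr_wpDr// ?mulr_ge0 ?expR_ge0//.
    apply: le_trans (_ : k.+1%:R * 1 <= _); first by rewrite mulr1.
    rewrite -[leLHS]add0r lerD// ler_wpM2l ?ler0n// -[leLHS]expR0 ler_expR.
    by rewrite oppr_ge0 mulr_ge0_le0 ?exprn_ge0 ?ler0n// subr_le0.
  - exact: cvg_cst.
  - exact: cvg_harmonic.
have t0 : 0 < x - a by rewrite subr_gt0.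
apply: (@squeeze_cvgr _ _ _ _ (fun k => 1 - k.+1%:R^-1 / (x - a)) (fun=> 1)) => //.
- apply: nearW => k; rewrite sigmoid_le1 andbT /sigmoid.
  set c := k.+1%:R; have c0 : 0 < c :> R by rewrite ltr0n.
  set t := c ^+ 2 * (x - a); have tp : 0 < t by rewrite mulr_gt0 ?exprn_gt0.
  have et : expR (- t) <= t^-1.
    rewrite expRN lef_pV2 ?posrE ?expR_gt0// (le_trans _ (expR_ge1Dx t))//.
    by rewrite lerDr.
  have ct : c * expR (- t) <= c^-1 / (x - a).
    apply: le_trans (_ : c * t^-1 <= _); first by rewrite ler_wpM2l// ltW.
    by rewrite /t le_eqVlt; apply/orP; left; apply/eqP; field; rewrite !gt_eqF.
  apply: le_trans (_ : 1 - c * expR (- t) <= _); first by rewrite lerD2l lerN2.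
  have : 0 <= c * expR (- t) by rewrite mulr_ge0 ?expR_ge0// ltW.
  move: (c * _) => z z0; rewrite -[leRHS]mul1r ler_pdivlMr ?ltr_wpDr//.
  have := sqr_ge0 z; nra.
- rewrite -[X in _ --> X]subr0; apply: cvgB; first exact: cvg_cst.
  rewrite -(mul0r (x - a)^-1); apply: cvgM; [exact: cvg_harmonic|exact: cvg_cst].
- exact: cvg_cst.
Qed.

End sigmoid_limit.

(** * Functions determined by their integrals against Gaussian-dominated tensor products *)

Section uniqueness.
Context {R : realType} {d : nat}.
Local Notation leb := (lebesgue_rV R d).
Local Notation E := 'rV[R]_d.
Implicit Types (a x : E) (u : E -> R[i]) (r : E -> R).

Definition quadrant a : set E := [set x | forall i, a ord0 i < x ord0 i].

Lemma measurable_quadrant a : measurable (quadrant a).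
Proof.
rewrite (_ : quadrant a = \bigcap_(i in [set: 'I_d])
    ((fun x : E => x ord0 i) @^-1` `]a ord0 i, +oo[%classic)); last first.
  apply/seteqP; split => x /= h i; first by move=> _; rewrite /= in_itv/= andbT.
  by have := h i I; rewrite /= in_itv/= andbT.
apply: fin_bigcap_measurable => [|i _]; first exact: finite_finset.
rewrite -[X in measurable X]setTI.
exact: measurable_coord.
Qed.

Lemma quadrantI a b : exists c, quadrant a `&` quadrant b = quadrant c.
Proof.
exists (\row_i Num.max (a ord0 i) (b ord0 i)).
apply/seteqP; split => x /=.
  by move=> [xa xb] i; rewrite mxE gt_max xa xb.
by move=> h; split => i; have := h i; rewrite mxE gt_max => /andP[].
Qed.

(** Together with [quadrantI] this makes the quadrants a generating pi-system. A half-space x_i > t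
    is the union over n of the quadrants whose other lower bounds are all - n. *)
Lemma measurable_rV_quadrant :
  @measurable _ E = <<s [set A | exists a, A = quadrant a] >>.
Proof.
apply/seteqP; split; last first.
  apply: smallest_sub; first exact: sigma_algebra_measurable.
  by move=> _ [a ->]; exact: measurable_quadrant.
set S := <<s _ >>.
have sS : sigma_algebra setT S by exact: smallest_sigma_algebra.
apply: smallest_sub => //.
rewrite -bigcup_seq/=; apply: bigcup_sub => i _ _ [B mB <-] /=; rewrite setTI.
have {mB} : (@RGenOInfty.G R).-sigma.-measurable B by rewrite -RGenOInfty.measurableE.
rewrite -[X in X -> _]/(<<s (@RGenOInfty.G R) >> B).
suff : <<s (@RGenOInfty.G R) >> `<=` [set B | S ((fun x : E => x ord0 i) @^-1` B)].
  by apply.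
apply: smallest_sub => [|_ [t ->]].
  split => /=.
  - by rewrite preimage_set0; exact: sigma_algebra0.
  - move=> A SA; rewrite setTD preimage_setC.
    by have [_ + _] := sS => /(_ _ SA); rewrite setTD.
  - by move=> F SF; rewrite preimage_bigcup; have [_ _] := sS; exact.
rewrite /= (_ : _ @^-1` _ = \bigcup_n quadrant (\row_j if j == i then t else - n%:R)).
  have [_ _] := sS; apply => n; apply: sub_gen_smallest.
  by eexists.
apply/seteqP; split => x /=; rewrite in_itv/= andbT.
  move=> tx; pose n := (\sum_j Num.trunc `|x ord0 j|).+1%N.
  exists n => // j; rewrite mxE; case: eqP => [->//|_].
  rewrite ltrNl (le_lt_trans (ler_norm _))// normrN.
  apply: lt_le_trans (_ : (Num.trunc `|x ord0 j|).+1%:R <= _).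
    by rewrite truncnS_gt.
  by rewrite ler_nat ltnS (bigD1 j)//= leq_addr.
by move=> [n _ /(_ i)]; rewrite mxE eqxx.
Qed.

(** Dynkin's theorem applied to the sets over which r integrates to 0. The whole space is one of
    them, as the limit of the quadrants with corner (- n, ..., - n). *)
Lemma integral_quadrant_ae0 r : leb.-integrable setT (EFin \o r) ->
  (forall a, (\int[leb]_(x in quadrant a) (r x)%:E = 0)%E) ->
  {ae leb, forall x, r x = 0}.
Proof.
move=> Ir r0.
have IS A : measurable A -> leb.-integrable A (EFin \o r).
  by move=> mA; exact: integrableS Ir.
have mr : measurable_fun setT r by apply/measurable_EFinP; case/integrableP: Ir.
have T0 : (\int[leb]_x (r x)%:E = 0)%E.
  pose Q n := quadrant (\row_(j < d) - (n%:R : R)).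
  have h : \int[leb]_x (r \_ (Q n)) x @[n --> \oo] --> \int[leb]_x r x.
    have := @Rintegral_dominated_cvg _ E R leb (fun n => r \_ (Q n)) r (fun x => `|r x|).
    apply => //.
    - move=> n; apply/(measurable_restrictT r (measurable_quadrant _)).
      exact: measurable_funTS.
    - apply: nearW => x; apply: (@cvg_near_cst); near=> n.
      rewrite patchE mem_set// => j; rewrite mxE ltrNl.
      rewrite (le_lt_trans (ler_norm _))// normrN.
      apply: lt_le_trans (_ : (Num.trunc `|x ord0 j|).+1%:R <= _).
        by rewrite truncnS_gt.
      rewrite ler_nat; apply: leq_trans (_ : (\sum_j Num.trunc `|x ord0 j|).+1 <= _)%N.
        by rewrite ltnS (bigD1 j)//= leq_addr.
      by near: n; exact: nbhs_infty_ge.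
    - by have := integrable_abse Ir; apply: eq_integrable.
    - by move=> n x; rewrite patchE; case: ifP => //; rewrite normr0.
  have : \int[leb]_x r x = 0.
    apply/esym/(cvg_unique _ _ h) => //; apply: cvg_near_cst; apply: nearW => n.
    by rewrite -Rintegral_mkcond /Rintegral r0.
  rewrite /Rintegral => h0; rewrite -[LHS]fineK ?h0//.
  exact: integrable_fin_num Ir.
suff H A : measurable A -> (\int[leb]_(x in A) (r x)%:E = 0)%E.
  have /= := @integral_ae_eq _ E R leb setT measurableT (cst 0%E) (EFin \o r) Ir
    (measurable_cst _).
  move=> /(_ _)[|N [mN N0 sub]].
    by move=> A _ mA; rewrite (H _ mA) integral0.
  exists N; split => //; apply: subset_trans sub => x /= h; apply: contra_not h.
  by move=> /(_ I)[].
rewrite measurable_rV_quadrant => mA.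
have setIG : setI_closed [set A | exists a, A = quadrant a].
  by move=> _ _ [a ->] [b ->]; exact: quadrantI.
apply: (@dynkin_induction _ E _ (fun A => \int[leb]_(x in A) (r x)%:E = 0)%E
  measurable_rV_quadrant setIG T0 _ _ _ _ mA).
- by move=> _ [a ->].
- move=> S mS S0; have := T0; rewrite -(setUv S) integral_setU_EFin//=.
  + by rewrite S0 add0e.
  + exact: measurableC.
  + by rewrite setUv; apply/measurable_EFinP; case/integrableP: Ir.
  + by apply/disj_setPCl.
- move=> F mF tF F0; rewrite integral_bigcup//.
    by rewrite eseries0.
  by apply: IS; exact: bigcup_measurable.
Unshelve. all: by end_near. Qed.

Definition gauss1 (y : R) : R := expR (- y ^+ 2).

Lemma quadrant_indic a x :
  \prod_(i < d) ((a ord0 i < x ord0 i)%R)%:R = \1_(quadrant a) x :> R.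
Proof.
rewrite indicE; have [/set_mem xa|/negP xa] := boolP (x \in quadrant a).
  by rewrite big1// => i _; rewrite xa.
have [i ai] : exists i, ~~ (a ord0 i < x ord0 i).
  apply/existsP; rewrite -negb_forall; apply/negP => /forallP h; apply: xa.
  by rewrite inE.
by rewrite (bigD1 i)//= (negbTE ai) mul0r.
Qed.

Lemma integral_quadrant0 r : leb.-integrable setT (EFin \o r) ->
  (forall k a, \int[leb]_x (r x * \prod_(i < d) sigmoid k (a ord0 i) (x ord0 i)) = 0) ->
  {ae leb, forall x, r x = 0}.
Proof.
move=> Ir r0; apply: integral_quadrant_ae0 => // a.
have mr : measurable_fun setT r by apply/measurable_EFinP; case/integrableP: Ir.
have mQ := measurable_quadrant a.
have msig k : measurable_fun setT (fun x : E => \prod_(i < d) sigmoid k (a ord0 i) (x ord0 i)).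
  apply: measurable_prod => i _; apply: measurableT_comp (measurable_coord i).
  apply: continuous_measurable_fun => y; apply/differentiable_continuous/derivable1_diffP.
  by case: (is_derive_sigmoid k (a ord0 i) y).
have h : \int[leb]_x (r x * \prod_(i < d) sigmoid k (a ord0 i) (x ord0 i))
    @[k --> \oo] --> \int[leb]_x (r x * \1_(quadrant a) x).
  have := @Rintegral_dominated_cvg _ E R leb
    (fun k x => r x * \prod_(i < d) sigmoid k (a ord0 i) (x ord0 i))
    (fun x => r x * \1_(quadrant a) x) (fun x => `|r x|).
  apply => //.
  - by move=> k; exact: measurable_funM.
  - by apply: measurable_funM => //; exact: measurable_indic.
  - apply: nearW => x; apply: cvgM; first exact: cvg_cst.
    rewrite -quadrant_indic; apply: cvg_big => [|i _]; first exact: mul_continuous.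
    exact: cvg_sigmoid.
  - by have := integrable_abse Ir; apply: eq_integrable.
  - move=> k x; rewrite normrM ler_piMr// normr_prod.
    rewrite -[leRHS](@big1 R 1 *%R 'I_d (index_enum _) xpredT (fun=> 1))//.
    apply: ler_prod => i _.
    by rewrite normr_ge0 ger0_norm ?sigmoid_ge0 ?sigmoid_le1.
have E0 : \int[leb]_x (r x * \1_(quadrant a) x) = 0.
  by apply/esym/(cvg_unique _ _ h) => //; apply: cvg_near_cst; apply: nearW => k.
have Er : \int[leb]_(x in quadrant a) r x = 0.
  rewrite Rintegral_mkcond -[RHS]E0; apply: eq_Rintegral => x _.
  by rewrite patchE indicE; case: ifPn => _; rewrite ?mulr1 ?mulr0.
have IQ : leb.-integrable (quadrant a) (EFin \o r) by exact: integrableS Ir.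
by rewrite -[LHS]fineK; [rewrite -[fine _]/(Rintegral _ _ _) Er|
  exact: integrable_fin_num IQ].
Qed.

(** Only the product of u with the Gaussian has to be integrable, so u may grow. The tests are
    sigmoids times Gaussians; absorbing the Gaussian into u leaves products of sigmoids, which
    converge to indicators of quadrants. *)
Lemma tensor_test_ae0 u : cmeas u ->
  cintegrable leb (fun x => u x * tensor (fun=> gauss1) x) ->
  (forall phi : 'I_d -> R -> R, (forall i, schwartz1 (phi i)) ->
    (forall i y, `|phi i y| <= gauss1 y) ->
    cint leb (fun x => u x * tensor phi x) = 0) ->
  {ae leb, forall x, u x = 0}.
Proof.
move=> mu Iw u0; set w := fun x => _ in Iw.
have wE x : w x = (rprod (fun=> gauss1) x)%:C * u x by rewrite /w mulrC.
have g0 x : rprod (fun=> gauss1) x != 0.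
  by rewrite gt_eqF//; apply: prodr_gt0 => i _; exact: expR_gt0.
have key k a : cint leb (fun x =>
    (\prod_(i < d) sigmoid k (a ord0 i) (x ord0 i))%:C * w x) = 0.
  rewrite -[RHS](u0 (fun i y => sigmoid k (a ord0 i) y * gauss1 y)).
  - apply: eq_cint => x; rewrite wE mulrA -rmorphM mulrC; congr (_ * _%:C).
    by rewrite /rprod big_split.
  - by move=> i; exact: schwartz1_sigmoid.
  - move=> i y; rewrite normrM (ger0_norm (sigmoid_ge0 _ _ _)).
    by rewrite (ger0_norm (expR_ge0 _)) ler_piMl ?expR_ge0 ?sigmoid_le1.
have HR : {ae leb, forall x, complex.Re (w x) = 0}.
  apply: integral_quadrant0 => [|k a]; first exact: cintegrable_Re.
  have := congr1 (@complex.Re R) (key k a); rewrite /cint => /= <-.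
  by apply: eq_Rintegral => x _; rewrite Re_mulr mulrC.
have HI : {ae leb, forall x, complex.Im (w x) = 0}.
  apply: integral_quadrant0 => [|k a]; first exact: cintegrable_Im.
  have := congr1 (@complex.Im R) (key k a); rewrite /cint => /= <-.
  by apply: eq_Rintegral => x _; rewrite Im_mulr mulrC.
apply: filterS2 HR HI => x; rewrite wE Re_mulr Im_mulr.
move=> /eqP; rewrite mulf_eq0 (negbTE (g0 x)) => /eqP xR.
move=> /eqP; rewrite mulf_eq0 (negbTE (g0 x)) => /eqP xI.
by apply/eqP; rewrite eq_complex xR xI !eqxx.
Qed.

End uniqueness.

(** * Schwartz functions on the whole space *)

Section coordinate_lines.
Context {R : realType} {d : nat}.
Local Notation E := 'rV[R]_d.
Implicit Types (F : E -> R) (x : E) (j : 'I_d).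

(** Parametrised by the value of the j-th coordinate, not by the displacement from x: a tensor
    product restricted to the line is then a constant times its j-th factor. *)
Definition line x j (t : R) : E := x + (t - x ord0 j) *: delta_mx ord0 j.

Lemma lineE x j t i : line x j t ord0 i = if i == j then t else x ord0 i.
Proof.
rewrite /line !mxE eqxx/=; case: eqP => [->|_].
  by rewrite mulr1 addrC subrK.
by rewrite mulr0 addr0.
Qed.

Lemma line_quotient F x j :
  (fun h : R => h^-1 *: (F (h *: delta_mx ord0 j + x) - F x)) =
  (fun h : R => h^-1 *: (F (line x j (h *: 1 + x ord0 j)) - F (line x j (x ord0 j)))).
Proof.
apply/funext => h; rewrite /line addrK subrr scale0r addr0.
by rewrite [_%:A]mulr1 (addrC x).
Qed.

Lemma derivable_line F x j :
  derivable F x (delta_mx ord0 j) <-> derivable (F \o line x j) (x ord0 j) 1.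
Proof.
by rewrite /derivable /= line_quotient.
Qed.

Lemma derive_line F x j :
  'D_(delta_mx ord0 j) F x = 'D_1 (F \o line x j) (x ord0 j).
Proof.
by rewrite /derive /= line_quotient.
Qed.

End coordinate_lines.

(** * Tensor products of one-variable Schwartz functions belong to S *)

Section tensor_schwartz.
Context {R : realType} {d : nat}.
Local Notation E := 'rV[R]_d.
Implicit Types (phi : 'I_d -> R -> R) (x : E) (j : 'I_d).

Definition derive_at phi j : 'I_d -> R -> R :=
  fun i => if i == j then ((phi i)^`())%classic else phi i.

Lemma schwartz1_derive_at phi j : (forall i, schwartz1 (phi i)) ->
  forall i, schwartz1 (derive_at phi j i).
Proof.
by move=> sp i; rewrite /derive_at; case: ifP => // _; exact: schwartz1_derive.
Qed.

Lemma rprod_line phi x j t : rprod phi (line x j t) =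
  (\prod_(i < d | i != j) phi i (x ord0 i)) * phi j t.
Proof.
rewrite /rprod (bigD1 j)//= lineE eqxx mulrC; congr (_ * _).
by apply: eq_bigr => i /negbTE ij; rewrite lineE ij.
Qed.

Lemma is_derive_rprod phi x j : (forall i, schwartz1 (phi i)) ->
  derivable (rprod phi) x (delta_mx ord0 j) /\
  'D_(delta_mx ord0 j) (rprod phi) x = rprod (derive_at phi j) x.
Proof.
move=> sp; rewrite derivable_line derive_line.
have -> : rprod phi \o line x j = (\prod_(i < d | i != j) phi i (x ord0 i)) \*: phi j.
  by apply/funext => t; rewrite /= rprod_line.
have dp : derivable (phi j) (x ord0 j) 1 by exact: schwartz1_derivable.
split; first exact: derivableZ.
rewrite deriveZ//= /rprod [RHS](bigD1 j)//= /derive_at eqxx derive1E mulrC; congr (_ * _).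
by apply: eq_bigr => i /negbTE ->.
Qed.

Lemma pderiv_tensor phi j : (forall i, schwartz1 (phi i)) ->
  pderivable j (tensor phi) /\ pderiv j (tensor phi) = tensor (derive_at phi j).
Proof.
move=> sp; split.
  move=> x; split; first exact: (is_derive_rprod x j sp).1.
  exact: derivable_cst.
apply/funext => x; rewrite /pderiv /tensor; congr (_ +i* _).
  exact: (is_derive_rprod x j sp).2.
exact: derive_cst.
Qed.

Lemma pderivs_tensor s phi : (forall i, schwartz1 (phi i)) ->
  exists2 psi, (forall i, schwartz1 (psi i)) & pderivs s (tensor phi) = tensor psi.
Proof.
move=> sp; elim: s => [|j s [psi spsi E]]; first by exists phi.
exists (derive_at psi j); first exact: schwartz1_derive_at.
by rewrite /= -/(pderivs s _) E; exact: (pderiv_tensor j spsi).2.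
Qed.

Lemma pderivs_rcons s j (f : E -> R[i]) : pderivs (rcons s j) f = pderivs s (pderiv j f).
Proof. by rewrite /pderivs -cats1 foldr_cat. Qed.

Lemma coord_le_norm x i : `|x ord0 i| <= `|x|.
Proof.
rewrite [leRHS]/Num.Def.normr/= mx_normrE.
by apply: (le_bigmax _ (fun ij => `|x ij.1 ij.2|) (ord0, i)).
Qed.

Lemma norm_le_prod x : 1 + `|x| <= \prod_(i < d) (1 + `|x ord0 i|).
Proof.
have ge1 (P : pred 'I_d) : 1 <= \prod_(i < d | P i) (1 + `|x ord0 i|).
  elim/big_ind: _ => // [a b a1 b1|i _]; first exact: mulr_ege1.
  by rewrite lerDl.
rewrite -lerBrDl [leLHS]/Num.Def.normr/= mx_normrE; apply: bigmax_le.
  by rewrite subr_ge0.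
case=> p i _; rewrite /= (ord1 p) lerBrDl (bigD1 i)//=.
by rewrite ler_peMr// addr_ge0.
Qed.

Lemma tensor_decay k phi : (forall i, schwartz1 (phi i)) ->
  exists M, forall x, (1 + `|x|) ^+ k * normc (tensor phi x) <= M.
Proof.
move=> sp.
have /choice[M pM] i : exists M, forall y, (1 + `|y|) ^+ k * `|phi i y| <= M.
  exact: schwartz1_bound.
exists (\prod_i M i) => x; rewrite /tensor normc_real /rprod normr_prod.
apply: le_trans (_ : (\prod_(i < d) (1 + `|x ord0 i|)) ^+ k *
    \prod_(i < d) `|phi i (x ord0 i)| <= _).
  rewrite ler_wpM2r ?prodr_ge0// lerXn2r ?nnegrE ?addr_ge0 ?norm_le_prod//.
  by apply: prodr_ge0 => i _; rewrite addr_ge0.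
rewrite -prodrXl -big_split/=; apply: ler_prod => i _.
by rewrite pM mulr_ge0 ?exprn_ge0// addr_ge0.
Qed.

(** The weight exponent k and the order n, tied together in [schwartz_bound], are separated so that
    n alone runs through the induction. The derivative applied first, the last of the list, is
    peeled off: it turns one tensor product into another. *)
Lemma tensor_schwartz_bound k n phi : (forall i, schwartz1 (phi i)) ->
  exists M, forall s x, (size s <= n)%N ->
    (1 + `|x|) ^+ k * normc (pderivs s (tensor phi) x) <= M.
Proof.
elim: n phi => [|n IH] phi sp; have [M0 pM0] := tensor_decay k sp.
  by exists M0 => s x; rewrite leqn0 size_eq0 => /eqP ->; exact: pM0.
have /choice[M pM] j := IH _ (schwartz1_derive_at j sp).
have M00 : 0 <= M0.
  by apply: le_trans (pM0 0); rewrite mulr_ge0 ?normc_ge0// exprn_ge0// addr_ge0.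
exists (M0 + \sum_j `|M j|) => s x; case/lastP: s => [_|s j].
  by rewrite (le_trans (pM0 x))// lerDl sumr_ge0.
rewrite size_rcons ltnS pderivs_rcons (pderiv_tensor j sp).2 => sn.
rewrite (le_trans (pM j s x sn))// (le_trans (ler_norm _))//.
by rewrite (bigD1 j)//= addrCA lerDl addr_ge0// sumr_ge0.
Qed.

Lemma schwartz_tensor phi : (forall i, schwartz1 (phi i)) -> schwartz (tensor phi).
Proof.
move=> sp; split.
  move=> s j; have [psi spsi ->] := pderivs_tensor s sp.
  exact: (pderiv_tensor j spsi).1.
by move=> k; have [M pM] := tensor_schwartz_bound k k sp; exists M.
Qed.

End tensor_schwartz.

(** * Schwartz functions are measurable, integrable and square integrable *)

Section schwartz_functions.
Context {R : realType} {d : nat}.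
Local Notation leb := (lebesgue_rV R d).
Local Notation leb1 := (@lebesgue_measure R).
Local Notation E := 'rV[R]_d.
Implicit Types (F : E -> R) (x y : E) (j : 'I_d) (f : E -> R[i]).

Lemma line_line x j t s : line (line x j t) j s = line x j s.
Proof. by apply/rowP => i; rewrite !lineE; case: eqP. Qed.

(** Lipschitz along coordinate lines only, which is what the mean value theorem yields from bounded
    partial derivatives. *)
Definition coord_lipschitz (L : R) F :=
  forall x j t, `|F (line x j t) - F x| <= L * `|t - x ord0 j|.

Lemma bounded_derive_lipschitz L F :
  (forall x j, derivable F x (delta_mx ord0 j)) ->
  (forall x j, `|'D_(delta_mx ord0 j) F x| <= L) -> coord_lipschitz L F.
Proof.
move=> dF DF x j t.
have dg s : is_derive s (1 : R) (F \o line x j) ('D_(delta_mx ord0 j) F (line x j s)).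
  have E1 : F \o line (line x j s) j = F \o line x j.
    by apply/funext => z; rewrite /= line_line.
  have := derivable_line F (line x j s) j; have := derive_line F (line x j s) j.
  rewrite E1 lineE eqxx => Ed -[h _].
  by split; [exact: h|rewrite Ed].
have lx : line x j (x ord0 j) = x.
  by apply/rowP => i; rewrite lineE; case: eqP => [->|].
rewrite -{2}lx; move: (x ord0 j) => s.
wlog st : s t / s <= t.
  by move=> H; case: (leP s t) => [/H//|/ltW/H]; rewrite distrC (distrC s).
move: st; rewrite le_eqVlt => /predU1P[->|st]; first by rewrite !subrr normr0 mulr0.
have [|c _ Ec] := MVT st (fun z _ => dg z).
  apply: continuous_subspaceT => z; apply/differentiable_continuous/derivable1_diffP.
  by case: (dg z).
by rewrite -[F _ - F _]/((F \o line x j) t - (F \o line x j) s) Ec normrM ler_wpM2r.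
Qed.

Lemma coord_lipschitz_sum L F x y : coord_lipschitz L F ->
  `|F x - F y| <= L * \sum_j `|x ord0 j - y ord0 j|.
Proof.
move=> LF.
(* Passes from y to x one coordinate at a time: [z n] has the first n coordinates of x and the
   others of y. *)
pose z n : E := \row_i (if (i < n)%N then x ord0 i else y ord0 i).
have z0 : z 0 = y by apply/rowP => i; rewrite mxE.
have zd : z d = x by apply/rowP => i; rewrite mxE ltn_ord.
suff H n : (n <= d)%N ->
    `|F (z n) - F y| <= L * \sum_(j < d | (j < n)%N) `|x ord0 j - y ord0 j|.
  have := H d (leqnn d); rewrite zd => /le_trans; apply.
  rewrite le_eqVlt; apply/orP; left; apply/eqP; congr (_ * _).
  by apply: eq_bigl => j; rewrite ltn_ord.
elim: n => [_|n IH nd].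
  by rewrite z0 subrr normr0 big_pred0 ?mulr0.
pose j := Ordinal nd.
have zS : z n.+1 = line (z n) j (x ord0 j).
  apply/rowP => i; rewrite lineE !mxE; case: eqP => [->/=|ij]; first by rewrite leqnn.
  by rewrite ltnS leq_eqVlt (_ : (i == n :> nat) = false)//; apply/negbTE/eqP => h;
    apply: ij; apply/val_inj.
rewrite -(subrK (F (z n)) (F (z n.+1))) -addrA (le_trans (ler_normD _ _))//.
rewrite (bigD1 j)//= mulrDr lerD//.
  by rewrite zS (le_trans (LF _ _ _))// mxE /= ltnn.
apply: le_trans (IH (ltnW nd)) _; rewrite le_eqVlt; apply/orP; left; apply/eqP.
congr (_ * _); apply: eq_bigl => i; by rewrite -(inj_eq val_inj)/= ltnS ltn_neqAle andbC.
Qed.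

Definition grid (n : nat) (x : E) : 'rV[int]_d := \row_j Num.floor (n.+1%:R * x ord0 j).

Lemma measurable_grid n (z : 'rV[int]_d) : measurable [set x | grid n x = z].
Proof.
rewrite (_ : [set x | _] = \bigcap_(i in [set: 'I_d])
    ((fun x : E => x ord0 i) @^-1`
      `[(z ord0 i)%:~R / n.+1%:R, (z ord0 i + 1)%:~R / n.+1%:R[%classic)).
  apply: fin_bigcap_measurable => [|i _]; first exact: finite_finset.
  by rewrite -[X in measurable X]setTI; exact: measurable_coord.
have h (t : R) (k : int) : (t \in `[k%:~R / n.+1%:R, (k + 1)%:~R / n.+1%:R[) =
    (Num.floor (n.+1%:R * t) == k).
  by rewrite in_itv/= ler_pdivrMr// ltr_pdivlMr// mulrC floor_eq.
apply/seteqP; split => x /=.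
  by move=> <- i _ /=; rewrite h mxE.
by move=> H; apply/rowP => i; rewrite mxE; apply/eqP; rewrite -h; exact: H.
Qed.

(** Measurability for the product sigma-algebra, obtained from the Lipschitz bound: F is the
    pointwise limit of its values at the grid points floor((n+1) x) / (n+1), and each such function
    is constant on the countably many measurable cells of a grid. *)
Lemma coord_lipschitz_measurable L F : 0 <= L -> coord_lipschitz L F ->
  measurable_fun setT F.
Proof.
move=> L0 LF.
pose G n x := F (\row_j ((grid n x ord0 j)%:~R / n.+1%:R)).
apply: (@measurable_fun_cvg _ _ _ _ G) => [n|x _].
  move=> _ Y mY; rewrite setTI.
  pose Z := [set z : 'rV[int]_d | Y (F (\row_j ((z ord0 j)%:~R / n.+1%:R)))].
  rewrite (_ : G n @^-1` Y = \bigcup_(z in Z) [set x | grid n x = z]).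
    rewrite bigcup_mkcond; apply: countable_bigcupT_measurable => [|z].
      exact: countableP.
    by case: ifP => // _; exact: measurable_grid.
  apply/seteqP; split => x /=; first by move=> Yx; exists (grid n x).
  by move=> [z Zz xz]; rewrite /G xz.
pose e n : R := L * (d%:R * n.+1%:R^-1).
have He n : `|G n x - F x| <= e n.
  apply: le_trans (coord_lipschitz_sum _ _ LF) _; rewrite ler_wpM2l//.
  apply: le_trans (_ : \sum_(j < d) n.+1%:R^-1 <= _); last first.
    by rewrite sumr_const card_ord mulr_natl.
  apply: ler_sum => j _; rewrite !mxE distrC.
  have fl := floor_itv (n.+1%:R * x ord0 j).
  move/andP: fl => [f1 f2].
  rewrite ger0_norm; last by rewrite subr_ge0 ler_pdivrMr// [leRHS]mulrC.
  rewrite lerBlDr -[X in _ <= X + _]mul1r -mulrDl ler_pdivlMr// [leLHS]mulrC ltW//.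
  by rewrite addrC -[X in _ + X]/(1%:~R) -intrD.
have e0 : e n @[n --> \oo] --> (0 : R).
  rewrite -[X in _ --> X](mulr0 L) -[X in _ --> L * X](mulr0 d%:R).
  apply: cvgM; first exact: cvg_cst.
  by apply: cvgM; [exact: cvg_cst|exact: cvg_harmonic].
apply/cvgrPdist_le => r r0; have /cvgr0Pnorm_le /(_ _ r0) := e0.
apply: filterS => n h; rewrite distrC (le_trans (He n))//.
exact: le_trans (ler_norm _) h.
Qed.

Lemma schwartz_cmeas f : schwartz f -> cmeas f.
Proof.
move=> [df bf]; have [M pM] := bf 1%N.
have DM x j : normc (pderiv j f x) <= M.
  apply: le_trans (pM [:: j] x isT); rewrite ler_peMl ?normc_ge0//.
  by rewrite expr1 lerDl.
have M0 : 0 <= M.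
  by apply: le_trans (pM [::] 0 isT); rewrite mulr_ge0 ?normc_ge0// expr1 addr_ge0.
split; apply: (coord_lipschitz_measurable M0); apply: bounded_derive_lipschitz.
- by move=> x j; exact: (df [::] j x).1.
- by move=> x j; exact: le_trans (normc_Re _) (DM x j).
- by move=> x j; exact: (df [::] j x).2.
- by move=> x j; exact: le_trans (normc_Im _) (DM x j).
Qed.

Definition weight (x : E) : R := \prod_(i < d) (1 + x ord0 i ^+ 2)^-1.

Lemma weight_ge0 x : 0 <= weight x.
Proof. by apply: prodr_ge0 => i _; rewrite invr_ge0 addr_ge0// sqr_ge0. Qed.

Lemma weight_le1 x : weight x <= 1.
Proof.
rewrite -[leRHS](@big1 R 1 *%R 'I_d (index_enum _) xpredT (fun=> 1))//.
apply: ler_prod => i _; rewrite invr_ge0 addr_ge0 ?sqr_ge0//=.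
by rewrite invf_le1 ?lerDl ?sqr_ge0// ltr_pwDl// sqr_ge0.
Qed.

Lemma cintegrable_weight : cintegrable leb (fun x => (weight x)%:C).
Proof.
rewrite (_ : (fun _ => _) = prodf (fun _ t => ((1 + t ^+ 2)^-1)%:C)).
  by apply: cintegrable_prodf => i; apply: cintegrable_real; exact: integrable_oneDsqrV.
by apply/funext => x; rewrite /weight rmorph_prod.
Qed.

(** The order 2 d is what it takes for (1 + |x|)^(2 d) to dominate the product of the d factors 1 +
    x_i^2, each being at most (1 + |x|)^2 in the maximum norm. *)
Lemma schwartz_bound_weight f M x : schwartz_bound (2 * d) f M ->
  normc (f x) <= M * weight x.
Proof.
move=> /(_ [::] x isT) /= h.
rewrite /weight prodfV ler_pdivlMr; last first.
  by apply: prodr_gt0 => i _; rewrite ltr_pwDl// sqr_ge0.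
apply: le_trans h; rewrite mulrC ler_wpM2r ?normc_ge0//.
rewrite exprM -[X in _ <= _ ^+ X]card_ord -prodr_const.
apply: ler_prod => i _; rewrite addr_ge0 ?sqr_ge0//=.
rewrite sqrrD expr1n mul1r -(real_normK (num_real (x ord0 i))).
rewrite -addrA lerD2l ler_wpDl ?mulrn_wge0//.
by rewrite lerXn2r ?nnegrE ?coord_le_norm.
Qed.

Lemma schwartz_cintegrable f : schwartz f -> cintegrable leb f.
Proof.
move=> sf; have [_ /(_ (2 * d)%N)[M pM]] := sf.
have [mw Iw] := cintegrableZ M%:C cintegrable_weight.
apply: (cintegrable_le (schwartz_cmeas sf) (cmeas_normc mw) Iw) => x.
apply: le_trans (schwartz_bound_weight x pM) _.
by rewrite -rmorphM normc_real ler_norm.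
Qed.

Lemma schwartz_nsq_lty f : schwartz f -> (nsq f < +oo)%E.
Proof.
move=> sf; have [_ /(_ (2 * d)%N)[M pM]] := sf.
apply: (@nsq_bounded_lty _ _ M) => [|x]; first exact: schwartz_cintegrable.
apply: le_trans (schwartz_bound_weight x pM) _.
rewrite ler_piMr ?weight_le1//; apply: le_trans (pM [::] 0 isT).
by rewrite mulr_ge0 ?normc_ge0// exprn_ge0// addr_ge0.
Qed.

End schwartz_functions.

(** * The Plancherel theorem *)

Lemma cvg_geometric_increments (R : realType) (u : nat -> R) (M : R) :
  (forall k, 4 ^+ k * (u k.+1 - u k) ^+ 2 <= M) -> cvgn u.
Proof.
move=> uM.
have M0 : 0 <= M by apply: le_trans (uM 0%N); rewrite expr0 mul1r sqr_ge0.
(* M + 1 serves as an upper bound of the square root of M. *)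
have dle k : `|telescope u k| <= geometric (M + 1) 2^-1 k.
  rewrite /geometric/= exprVn ler_pdivlMr ?exprn_gt0//.
  rewrite -(@ler_pXn2r _ 2) ?nnegrE ?mulr_ge0 ?exprn_ge0 ?addr_ge0//.
  rewrite exprMn real_normK ?num_real// -exprM mulnC exprM mulrC.
  have -> : 2 ^+ 2 = 4 :> R by rewrite expr2 -natrM.
  by apply: le_trans (uM k) _; rewrite sqrrD; nra.
have : cvgn [normed series (telescope u)].
  apply: (@series_le_cvg _ _ (geometric (M + 1) 2^-1)) => //.
  - by move=> k; exact: normr_ge0.
  - by move=> k; exact: le_trans (normr_ge0 _) (dle k).
  apply: is_cvg_geometric_series.
  by rewrite ger0_norm ?invr_ge0// invf_lt1// ltr1n.
move=> /normed_cvg cs.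
have -> : u = (fun n => u 0%N + series (telescope u) n).
  by apply/funext => n; exact: eq_sum_telescope.
by apply: is_cvgD => //; exact: is_cvg_cst.
Qed.

Lemma schwartz1_gauss1 (R : realType) : schwartz1 (gauss1 : R -> R).
Proof.
have := @SGbase R 0 0 0 0.
rewrite (_ : (fun x => _) = gauss1); first exact: schwartz1_sigmoid_gauss.
by apply/funext => x; rewrite !expr0 !mul1r.
Qed.

Section L2_theory.
Context {R : realType} {d : nat}.
Local Notation leb := (lebesgue_rV R d).
Local Notation E := 'rV[R]_d.
Implicit Types (f g h u v w : E -> R[i]) (s : R).

Lemma normc_sqr_le (z w : R[i]) : normc (z - w) ^+ 2 <= 2 * normc z ^+ 2 + 2 * normc w ^+ 2.
Proof.
rewrite !sqr_normc; case: z => a b; case: w => c e /=.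
by have := sqr_ge0 (a + c); have := sqr_ge0 (b + e); nra.
Qed.

Lemma le_nsq u v : cmeas u -> cmeas v -> (forall x, normc (u x) <= normc (v x)) ->
  (nsq u <= nsq v)%E.
Proof.
move=> mu mv uv; apply: ge0_le_integral => //; try exact: cmeas_normc2.
- by move=> x _; rewrite lee_fin sqr_ge0.
- by move=> x _; rewrite lee_fin lerXn2r ?nnegrE ?normc_ge0.
Qed.

Lemma nsqB_le u v (a b : R) : cmeas u -> cmeas v ->
  (nsq u <= a%:E)%E -> (nsq v <= b%:E)%E ->
  (nsq (fun x => u x - v x)%R <= (2 * a + 2 * b)%:E)%E.
Proof.
move=> mu mv ua vb.
apply: (@le_trans _ _ (2%:E * nsq u + 2%:E * nsq v)%E); last first.
  by rewrite [leRHS]EFinD; apply: leeD; rewrite [leRHS]EFinM lee_wpmul2l.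
rewrite -!ge0_integralZl//; try exact: cmeas_normc2;
  try by move=> x _; rewrite lee_fin sqr_ge0.
rewrite -ge0_integralD//.
- apply: ge0_le_integral => //.
  + by move=> x _; rewrite lee_fin sqr_ge0.
  + by apply: cmeas_normc2; exact: cmeasB.
  + apply: emeasurable_funD; apply: emeasurable_funM => //; exact: cmeas_normc2.
  + by move=> x _; rewrite -!EFinM -EFinD lee_fin normc_sqr_le.
- by move=> x _; rewrite -EFinM lee_fin mulr_ge0 ?sqr_ge0.
- by apply: emeasurable_funM => //; exact: cmeas_normc2.
- by move=> x _; rewrite -EFinM lee_fin mulr_ge0 ?sqr_ge0.
- by apply: emeasurable_funM => //; exact: cmeas_normc2.
Qed.

Lemma nsqB_lty u v : cmeas u -> cmeas v -> (nsq u < +oo)%E -> (nsq v < +oo)%E ->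
  (nsq (fun x => u x - v x)%R < +oo)%E.
Proof.
move=> mu mv uoo voo; apply: le_lt_trans (ltry _).
apply: (nsqB_le mu mv (a := fine (nsq u)) (b := fine (nsq v)));
  by rewrite fineK// ge0_fin_numE ?nsq_ge0.
Qed.

Lemma nsqZ (c : R[i]) u : cmeas u ->
  nsq (fun x => c * u x) = ((normc c ^+ 2)%:E * nsq u)%E.
Proof.
move=> mu; rewrite -ge0_integralZl//; first last.
- by rewrite lee_fin sqr_ge0.
- by move=> x _; rewrite lee_fin sqr_ge0.
- exact: cmeas_normc2.
by apply: eq_integral => x _; rewrite normcM exprMn EFinM.
Qed.

(* The free parameter [t] makes this as good as the Cauchy-Schwarz inequality. *)
Lemma integral_normcM_le u v (a b t : R) : cmeas u -> cmeas v -> 0 < t ->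
  (nsq u <= a%:E)%E -> (nsq v <= b%:E)%E ->
  (\int[leb]_x (normc (u x * v x))%:E <= ((t * a + b / t) / 2)%:E)%E.
Proof.
move=> mu mv t0 ua vb.
apply: (@le_trans _ _ ((t / 2)%:E * nsq u + (t^-1 / 2)%:E * nsq v)%E); last first.
  have -> : (t * a + b / t) / 2 = t / 2 * a + t^-1 / 2 * b by ring.
  rewrite [leRHS]EFinD; apply: leeD; rewrite [leRHS]EFinM lee_wpmul2l// lee_fin divr_ge0//.
    exact: ltW.
  by rewrite invr_ge0 ltW.
rewrite -!ge0_integralZl//; try exact: cmeas_normc2;
  try by [move=> x _; rewrite lee_fin sqr_ge0|rewrite lee_fin divr_ge0// ?invr_ge0 ltW].
have c1 : 0 <= t / 2 by rewrite divr_ge0// ltW.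
have c2 : 0 <= t^-1 / 2 by rewrite divr_ge0// invr_ge0 ltW.
rewrite -ge0_integralD//.
- apply: ge0_le_integral => //.
  + by move=> x _; rewrite lee_fin normc_ge0.
  + by apply: cmeas_normcE; exact: cmeasM.
  + apply: emeasurable_funD; apply: emeasurable_funM => //; exact: cmeas_normc2.
  + move=> x _; rewrite -!EFinM -EFinD lee_fin normcM.
    move: (normc (u x)) (normc (v x)) => p q.
    have -> : t / 2 * p ^+ 2 + t^-1 / 2 * q ^+ 2 = p * q + (t * p - q) ^+ 2 / (2 * t).
      by field; rewrite gt_eqF.
    by rewrite lerDl divr_ge0 ?sqr_ge0// mulr_ge0// ltW.
- by move=> x _; rewrite -EFinM lee_fin mulr_ge0 ?sqr_ge0.
- by apply: emeasurable_funM => //; exact: cmeas_normc2.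
- by move=> x _; rewrite -EFinM lee_fin mulr_ge0 ?sqr_ge0.
- by apply: emeasurable_funM => //; exact: cmeas_normc2.
Qed.

Lemma cintegrable_nsqM u v : cmeas u -> cmeas v -> (nsq u < +oo)%E -> (nsq v < +oo)%E ->
  cintegrable leb (fun x => u x * v x).
Proof.
move=> mu mv uoo voo; split; first exact: cmeasM.
apply: le_lt_trans (ltry _).
apply: (@integral_normcM_le u v (fine (nsq u)) (fine (nsq v)) 1) => //;
  by rewrite fineK// ge0_fin_numE ?nsq_ge0.
Qed.

(** An identity between bilinear pairings survives L_2 limits: the difference of the two sides is
    controlled by the pairings of the approximation errors with v and w. *)
Lemma cint_approx_eq g h v w : cmeas g -> cmeas h -> cmeas v -> cmeas w ->
  (nsq g < +oo)%E -> (nsq h < +oo)%E -> (nsq v < +oo)%E -> (nsq w < +oo)%E ->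
  (forall e, 0 < e -> exists g' h', [/\ cmeas g', cmeas h',
    (nsq (fun x => g x - g' x)%R <= e%:E)%E, (nsq (fun x => h x - h' x)%R <= e%:E)%E &
    [/\ (nsq g' < +oo)%E, (nsq h' < +oo)%E &
    cint leb (fun x => h' x * v x) = cint leb (fun x => g' x * w x)]]) ->
  cint leb (fun x => h x * v x) = cint leb (fun x => g x * w x).
Proof.
move=> mg mh mv mw goo hoo voo woo approx.
apply/eqP; rewrite -subr_eq0; apply/eqP/eq0_normc/eqP.
rewrite eq_le normc_ge0 andbT; apply/ler_addgt0Pl => r r0; rewrite addr0.
pose B := fine (nsq v) + fine (nsq w) + 1.
have v0 : 0 <= fine (nsq v) by rewrite fine_ge0 ?nsq_ge0.
have w0 : 0 <= fine (nsq w) by rewrite fine_ge0 ?nsq_ge0.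
have B0 : 0 < B by rewrite ltr_wpDl// addr_ge0.
have vB : (nsq v <= B%:E)%E.
  rewrite -[leLHS]fineK ?ge0_fin_numE ?nsq_ge0// lee_fin /B -addrA lerDl.
  by rewrite addr_ge0.
have wB : (nsq w <= B%:E)%E.
  rewrite -[leLHS]fineK ?ge0_fin_numE ?nsq_ge0// lee_fin /B addrAC lerDr.
  by rewrite addr_ge0.
(* Chosen so that (t e + B / t) / 2 = r / 2, the bound of [integral_normcM_le] for each of the two
   errors. *)
pose t := 2 * B / r; have t0 : 0 < t by rewrite divr_gt0// mulr_gt0.
pose e := r / (2 * t); have e0 : 0 < e by rewrite divr_gt0// mulr_gt0.
have [g' [h' [mg' mh' ge he [g'oo h'oo E1]]]] := approx e e0.
have bnd u z : cmeas u -> cmeas z -> (nsq u <= e%:E)%E -> (nsq z <= B%:E)%E ->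
    normc (cint leb (fun x => u x * z x)) <= r / 2.
  move=> mu mz ue zB; rewrite -lee_fin.
  have Iuz : cintegrable leb (fun x => u x * z x).
    by apply: cintegrable_nsqM => //; [apply: le_lt_trans ue _|apply: le_lt_trans zB _];
      exact: ltry.
  apply: le_trans (normc_cintE Iuz) _.
  apply: le_trans (integral_normcM_le mu mz t0 ue zB) _.
  rewrite lee_fin /e /t le_eqVlt; apply/orP; left; apply/eqP; field.
  by rewrite !gt_eqF.
have dgoo := nsqB_lty mg mg' goo g'oo; have dhoo := nsqB_lty mh mh' hoo h'oo.
have -> : cint leb (fun x => h x * v x) - cint leb (fun x => g x * w x) =
    cint leb (fun x => (h x - h' x) * v x) - cint leb (fun x => (g x - g' x) * w x).
  have Ih := cintegrable_nsqM mh mv hoo voo; have Ih' := cintegrable_nsqM mh' mv h'oo voo.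
  have Ig := cintegrable_nsqM mg mw goo woo; have Ig' := cintegrable_nsqM mg' mw g'oo woo.
  rewrite (eq_cint _ (fun x => mulrBl _ (h x) (h' x))) (eq_cint _ (fun x => mulrBl _ (g x) (g' x))).
  by rewrite !cintB// E1; ring.
rewrite (le_trans (normcB _ _))// [leRHS]splitr lerD// bnd//; exact: cmeasB.
Qed.

(** Riesz-Fischer for a sequence given with its rate. Weighting the squared increments by 4^k
    against the rate 8^-k leaves a series with integral at most 2 C, hence finite almost everywhere;
    there the increments are O(2^-k) and the sequence converges. Fatou's lemma carries the bounds to
    the limit. *)
Lemma L2_complete (h_ : nat -> E -> R[i]) (C : R) : 0 <= C ->
  (forall k, cmeas (h_ k)) ->
  (forall k m, (k <= m)%N -> (nsq (fun x => h_ m x - h_ k x)%R <= (C / 8 ^+ k)%:E)%E) ->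
  exists h, [/\ cmeas h,
    (forall k, nsq (fun x => h x - h_ k x)%R <= (C / 8 ^+ k)%:E)%E &
    forall B : \bar R, (forall k, nsq (h_ k) <= B)%E -> (nsq h <= B)%E].
Proof.
move=> C0 mh hC.
pose dk k x := normc (h_ k.+1 x - h_ k x).
pose T k x := (4 ^+ k * dk k x ^+ 2)%:E.
have mT k : measurable_fun setT (T k).
  apply/measurable_EFinP; apply: measurable_funM => //.
  by apply/measurable_funX/cmeas_normc; exact: cmeasB.
have T0 k x : (0 <= T k x)%E by rewrite lee_fin mulr_ge0 ?sqr_ge0 ?exprn_ge0.
pose S x := (\sum_(k <oo) T k x)%E.
have mS : measurable_fun setT S by exact: ge0_emeasurable_sum.
have S0 x : (0 <= S x)%E by exact: nneseries_ge0.
have IS : (\int[leb]_x S x < +oo)%E.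
  rewrite integral_nneseries//.
  apply: le_lt_trans (_ : (2 * C)%:E < +oo)%E; last exact: ltry.
  apply: le_trans (epsilon_trick0 xpredT _); last by rewrite mulr_ge0.
  apply: lee_nneseries => k; first by move=> _ _; exact: integral_ge0.
  move=> _; under eq_integral do rewrite /T EFinM.
  rewrite ge0_integralZl//; last 2 first.
  - by apply: cmeas_normc2; exact: cmeasB.
  - by move=> x _; rewrite lee_fin sqr_ge0.
  apply: le_trans (lee_wpmul2l _ (hC k k.+1 (leqnSn k))) _.
    by rewrite lee_fin exprn_ge0.
  rewrite -EFinM lee_fin natrX exprS le_eqVlt; apply/orP; left; apply/eqP.
  have -> : (8 : R) ^+ k = 4 ^+ k * 2 ^+ k by rewrite -exprMn -natrM.
  by field; rewrite !expf_neq0.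
have IS' : leb.-integrable setT S.
  by apply/integrableP; split => //; under eq_integral do rewrite gee0_abs//.
pose A := [set x | S x \is a fin_num].
have mA : measurable A.
  by have := emeasurable_fin_num measurableT mS; rewrite setTI.
have Afull : {ae leb, forall x, A x}.
  by have := integrable_ae measurableT IS'; apply: filterS => x /(_ I).
have cA x : A x -> cvgn (fun k => complex.Re (h_ k x)) /\ cvgn (fun k => complex.Im (h_ k x)).
  move=> Ax; have bnd k : 4 ^+ k * dk k x ^+ 2 <= fine (S x).
    rewrite -lee_fin fineK// -/(T k x).
    apply: le_trans (@nneseries_lim_ge _ (T ^~ x) xpredT 0 k.+1 (fun n _ _ => T0 n x)).
    by rewrite big_mkord big_ord_recr/= leeDr// sume_ge0.
  split; apply: (@cvg_geometric_increments _ _ (fine (S x))) => k;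
    apply: le_trans (bnd k); rewrite ler_wpM2l ?exprn_ge0// /dk sqr_normc Re_add Im_add Re_opp Im_opp.
  - by rewrite lerDl sqr_ge0.
  - by rewrite lerDr sqr_ge0.
(* Off the full set A the sequence is replaced by 0, so that it converges at every point and the
   limit is measurable. *)
pose hR x := lim ((fun k => ((fun x => complex.Re (h_ k x)) \_ A) x) @ \oo).
pose hI x := lim ((fun k => ((fun x => complex.Im (h_ k x)) \_ A) x) @ \oo).
have cvR x : ((fun x => complex.Re (h_ k x)) \_ A) x @[k --> \oo] --> hR x.
  rewrite /hR; have [xA|xA] := boolP (x \in A); last first.
    rewrite (_ : (fun k => _) = fun=> 0); first exact: is_cvg_cst.
    by apply/funext => k; rewrite patchE (negbTE xA).
  rewrite (_ : (fun k => _) = fun k => complex.Re (h_ k x)).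
    by have [] := cA x (set_mem xA).
  by apply/funext => k; rewrite patchE xA.
have cvI x : ((fun x => complex.Im (h_ k x)) \_ A) x @[k --> \oo] --> hI x.
  rewrite /hI; have [xA|xA] := boolP (x \in A); last first.
    rewrite (_ : (fun k => _) = fun=> 0); first exact: is_cvg_cst.
    by apply/funext => k; rewrite patchE (negbTE xA).
  rewrite (_ : (fun k => _) = fun k => complex.Im (h_ k x)).
    by have [] := cA x (set_mem xA).
  by apply/funext => k; rewrite patchE xA.
pose h x := hR x +i* hI x.
have mh' : cmeas h.
  split.
    apply: (measurable_fun_cvg (h := fun k => (fun x => complex.Re (h_ k x)) \_ A)) => //.
    by move=> k; apply/(measurable_restrictT _ mA); exact: measurable_funTS (mh k).1.
  apply: (measurable_fun_cvg (h := fun k => (fun x => complex.Im (h_ k x)) \_ A)) => //.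
  by move=> k; apply/(measurable_restrictT _ mA); exact: measurable_funTS (mh k).2.
have cvh x : A x -> complex.Re (h_ k x) @[k --> \oo] --> complex.Re (h x) /\
    complex.Im (h_ k x) @[k --> \oo] --> complex.Im (h x).
  move=> Ax; have := cvR x; have := cvI x.
  rewrite (_ : (fun k => ((fun x => complex.Im (h_ k x)) \_ A) x) =
    fun k => complex.Im (h_ k x)); last by apply/funext => k; rewrite patchE mem_set.
  by rewrite (_ : (fun k => ((fun x => complex.Re (h_ k x)) \_ A) x) =
    fun k => complex.Re (h_ k x)); last by apply/funext => k; rewrite patchE mem_set.
have cvn (z : E -> R[i]) x : A x ->
    normc (h_ k x - z x) ^+ 2 @[k --> \oo] --> normc (h x - z x) ^+ 2.
  move=> /cvh[c1 c2]; rewrite (_ : (fun k => _) = fun k =>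
    (complex.Re (h_ k x) - complex.Re (z x)) * (complex.Re (h_ k x) - complex.Re (z x)) +
    (complex.Im (h_ k x) - complex.Im (z x)) * (complex.Im (h_ k x) - complex.Im (z x))).
    rewrite sqr_normc Re_add Im_add Re_opp Im_opp !expr2.
    by apply: cvgD; apply: cvgM; apply: cvgB => //; exact: cvg_cst.
  by apply/funext => k; rewrite sqr_normc Re_add Im_add Re_opp Im_opp !expr2.
exists h; split => // [k|B hB].
  apply: (@fatou_cvg_le _ _ _ _ (fun m x => normc (h_ (m + k)%N x - h_ k x) ^+ 2)).
  - by move=> m; apply/measurable_funX/cmeas_normc; exact: cmeasB.
  - by apply/measurable_funX/cmeas_normc; exact: cmeasB.
  - by move=> m x; exact: sqr_ge0.
  - apply: filterS Afull => x /(cvn (h_ k)); rewrite -(cvg_shiftn k).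
    exact.
  - by move=> m; apply: hC; exact: leq_addl.
apply: (@fatou_cvg_le _ _ _ _ (fun m x => normc (h_ m x) ^+ 2)).
- by move=> m; apply/measurable_funX/cmeas_normc.
- exact/measurable_funX/cmeas_normc.
- by move=> m x; exact: sqr_ge0.
- apply: filterS Afull => x /(cvn (fun=> 0)); rewrite subr0.
  by rewrite (_ : (fun k => _) = fun k => normc (h_ k x) ^+ 2)//;
    apply/funext => k; rewrite subr0.
- exact: hB.
Qed.

Lemma abel_rV_le1 (e : R) (x : E) : 0 <= e -> abel_rV e x <= 1.
Proof.
move=> e0; rewrite -[leRHS](@big1 R 1 *%R 'I_d (index_enum _) xpredT (fun=> 1))//.
apply: ler_prod => i _; rewrite expR_ge0/= -expR0 ler_expR.
by rewrite oppr_le0 mulr_ge0.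
Qed.

(** The damped function is a product of two square-integrable functions, hence integrable, and tends
    to g in L_2 by dominated convergence. *)
Lemma L2_abel_approx g (r : R) : cmeas g -> (nsq g < +oo)%E -> 0 < r ->
  exists g', [/\ cintegrable leb g', (nsq g' <= nsq g)%E &
    (nsq (fun x => g x - g' x)%R <= r%:E)%E].
Proof.
move=> mg goo r0.
pose e (n : nat) : R := n.+1%:R^-1.
have e0 n : 0 < e n by rewrite invr_gt0.
pose a n (x : E) := (abel_rV (e n) x)%:C.
have Ia n : cintegrable leb (a n) by exact: cintegrable_abel_rV.
have a1 n x : normc (a n x) <= 1.
  by rewrite normc_real ger0_norm ?abel_rV_ge0// abel_rV_le1// ltW.
have aoo n : (nsq (a n) < +oo)%E by exact: nsq_bounded_lty (Ia n) (a1 n).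
have Ig n : cintegrable leb (fun x => a n x * g x) by apply: cintegrable_nsqM => //; exact: (Ia n).1.
pose D n x := normc (g x - a n x * g x) ^+ 2.
have mD n : measurable_fun setT (D n).
  by apply/measurable_funX/cmeas_normc; apply: cmeasB => //; exact: (Ig n).1.
have DE n x : D n x = (1 - abel_rV (e n) x) ^+ 2 * normc (g x) ^+ 2.
  rewrite /D -{1}[g x]mul1r -mulrBl normcM exprMn; congr (_ * _).
  have -> : 1 - a n x = (1 - abel_rV (e n) x)%:C by rewrite /a rmorphB rmorph1.
  by rewrite normc_real real_normK ?num_real.
have Ig2 : leb.-integrable setT (EFin \o (fun x => normc (g x) ^+ 2)).
  apply/integrableP; split; first exact: cmeas_normc2.
  by under eq_integral do rewrite /= ger0_norm ?sqr_ge0//.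
have Dg n x : `|D n x| <= normc (g x) ^+ 2.
  rewrite ger0_norm ?sqr_ge0// DE ler_piMl ?sqr_ge0//.
  by rewrite exprn_ile1// ?subr_ge0 ?abel_rV_le1 ?(ltW (e0 n))// gerBl abel_rV_ge0.
have h : \int[leb]_x D n x @[n --> \oo] --> \int[leb]_x (0 : R).
  have := @Rintegral_dominated_cvg _ E R leb D (fun=> 0) (fun x => normc (g x) ^+ 2).
  apply => //; apply: nearW => x.
  rewrite (_ : (fun n => _) = fun n => (1 - abel_rV (e n) x) * (1 - abel_rV (e n) x) * normc (g x) ^+ 2).
    have c0 : 1 - abel_rV (e n) x @[n --> \oo] --> (0 : R).
      rewrite -[X in _ --> X](subrr (1 : R)).
      by apply: cvgB; [exact: cvg_cst|exact: cvg_abel_rV].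
    have := cvgM (cvgM c0 c0) (cvg_cst (normc (g x) ^+ 2)).
    by rewrite mulr0 mul0r; exact.
  by apply/funext => n; rewrite DE expr2.
rewrite Rintegral_cst// mul0r in h.
have [n hn] : exists n, \int[leb]_x D n x <= r.
  move/cvgr0Pnorm_le: h => /(_ _ r0)[N _ /(_ N (leqnn N)) hN].
  by exists N; exact: le_trans (ler_norm _) hN.
exists (fun x => a n x * g x); split => //.
  apply: le_nsq => //; first exact: (Ig n).1.
  by move=> x; rewrite normcM ler_piMl ?normc_ge0.
have ID : leb.-integrable setT (EFin \o D n).
  apply: (le_integrable measurableT _ _ Ig2); first exact/measurable_EFinP.
  by move=> x _; rewrite /= lee_fin (le_trans (Dg n x))// ler_norm.
rewrite /nsq -[leLHS]fineK; first by rewrite lee_fin.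
exact: integrable_fin_num ID.
Qed.

Lemma FTB s u v (x : E) : cintegrable leb u -> cintegrable leb v ->
  FT s (fun t => u t - v t) x = FT s u x - FT s v x.
Proof.
move=> Iu Iv; rewrite /FT -cintB; try exact: cintegrable_cisM.
by apply: eq_cint => t; rewrite mulrBl.
Qed.

Lemma pi2_ge0 : 0 <= (2 * pi) ^+ d :> R.
Proof. by rewrite exprn_ge0// mulr_ge0// pi_ge0. Qed.

(** Transforms of integrable approximants form a fast Cauchy sequence by [nsq_FT_le], and h is their
    limit. For g in L_2 the defining integral may diverge, so h is characterised by the
    multiplication formula against integrable v in L_2. *)
Lemma FT_extend s g : s ^+ 2 = 1 -> cmeas g -> (nsq g < +oo)%E ->
  exists h, [/\ cmeas h, (nsq h <= ((2 * pi) ^+ d)%:E * nsq g)%E &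
    forall v, cintegrable leb v -> (nsq v < +oo)%E ->
      cint leb (fun x => h x * v x) = cint leb (fun x => g x * FT s v x)].
Proof.
move=> s1 mg goo.
have /choice[gs Hgs] k : exists g', [/\ cintegrable leb g', (nsq g' <= nsq g)%E &
    (nsq (fun x => g x - g' x)%R <= (8 ^- k)%:E)%E].
  by apply: L2_abel_approx => //; rewrite invr_gt0 exprn_gt0.
have Igs k : cintegrable leb (gs k) by have [] := Hgs k.
have mFgs k : cmeas (FT s (gs k)) by apply: cmeas_FT; exact: (Igs k).1.
have gsoo k : (nsq (gs k) < +oo)%E by have [_ /le_lt_trans->] := Hgs k.
have finN v : (nsq v < +oo)%E -> (((2 * pi) ^+ d)%:E * nsq v < +oo)%E.
  by move=> voo; rewrite lte_mul_pinfty// lee_fin pi2_ge0.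
(* The 4 comes from two approximants, each within 8^-k of g, compared by [nsqB_le]: 2 + 2. *)
pose C : R := (2 * pi) ^+ d * 4.
have C0 : 0 <= C by rewrite mulr_ge0 ?pi2_ge0.
have e8 k : 0 <= 8 ^- k :> R by rewrite invr_ge0 exprn_ge0.
have hC k m : (k <= m)%N ->
    (nsq (fun x => FT s (gs m) x - FT s (gs k) x)%R <= (C / 8 ^+ k)%:E)%E.
  move=> km.
  rewrite (_ : (fun x => _) = FT s (fun x => gs m x - gs k x)); last first.
    by apply/funext => x; rewrite FTB.
  apply: le_trans (nsq_FT_le s1 (cintegrableB (Igs m) (Igs k))) _.
  rewrite /C -mulrA EFinM lee_wpmul2l ?lee_fin ?pi2_ge0//.
  rewrite (_ : (fun x => _) = fun x => (g x - gs k x) - (g x - gs m x)); last first.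
    by apply/funext => x; ring.
  have [_ _ Hk] := Hgs k; have [_ _ Hm] := Hgs m.
  apply: le_trans (nsqB_le _ _ Hk Hm) _.
  - by apply: cmeasB => //; exact: (Igs k).1.
  - by apply: cmeasB => //; exact: (Igs m).1.
  rewrite lee_fin; apply: le_trans (_ : 2 * 8 ^- k + 2 * 8 ^- k <= _).
    rewrite lerD2l ler_wpM2l// lef_pV2 ?posrE ?exprn_gt0//.
    by rewrite ler_eXn2l// ltr1n.
  by rewrite -mulrDl -natrD.
have [h [mh hk hB]] := L2_complete C0 mFgs hC.
have hle : (nsq h <= ((2 * pi) ^+ d)%:E * nsq g)%E.
  apply: hB => k; apply: le_trans (nsq_FT_le s1 (Igs k)) _.
  by rewrite lee_wpmul2l ?lee_fin ?pi2_ge0//; have [] := Hgs k.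
have hoo : (nsq h < +oo)%E by apply: le_lt_trans hle (finN _ goo).
exists h; split => // v Iv voo.
have mFv := cmeas_FT s Iv.1.
have Fvoo : (nsq (FT s v) < +oo)%E by apply: le_lt_trans (nsq_FT_le s1 Iv) (finN _ voo).
apply: cint_approx_eq => //; first exact: Iv.1.
move=> r r0.
have [k kr] : exists k, (C + 1) / 8 ^+ k <= r.
  have : geometric (C + 1) (8^-1 : R) n @[n --> \oo] --> (0 : R).
    by apply: cvg_geometric; rewrite ger0_norm// invf_lt1// ltr1n.
  move/cvgr0Pnorm_le => /(_ _ r0)[N _ /(_ N (leqnn N)) hN].
  by exists N; apply: le_trans (ler_norm _) _; rewrite -exprVn.
have [_ _ Hk] := Hgs k.
exists (gs k), (FT s (gs k)); split.
- exact: (Igs k).1.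
- exact: mFgs.
- apply: le_trans Hk _; rewrite lee_fin (le_trans _ kr)//.
  by rewrite ler_peMl// lerDr.
- apply: le_trans (hk k) _; rewrite lee_fin (le_trans _ kr)//.
  by rewrite ler_wpM2r// lerDl.
- split; first exact: gsoo.
    by apply: le_lt_trans (nsq_FT_le s1 (Igs k)) (finN _ (gsoo k)).
  exact: cint_FT_transpose.
Qed.

Lemma L2_test_ae0 u : cmeas u -> (nsq u < +oo)%E ->
  (forall phi : 'I_d -> R -> R, (forall i, schwartz1 (phi i)) ->
    cint leb (fun x => u x * tensor phi x) = 0) ->
  {ae leb, forall x, u x = 0}.
Proof.
move=> mu uoo u0.
have sg := schwartz1_gauss1 R.
apply: tensor_test_ae0 => // [|phi sp _]; last exact: u0.
apply: cintegrable_nsqM => //; last exact: nsq_tensor_lty.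
exact: (cintegrable_tensor_schwartz1 _).1.
Qed.

Lemma ae_eq_nsq u v : cmeas u -> cmeas v -> {ae leb, forall x, u x = v x} -> nsq u = nsq v.
Proof. exact: ae_eq_integral_normc. Qed.

(** Extend twice, with opposite signs. Tests against tensor products and their inversion formula
    identify the second extension as (2 pi)^d g, whence (2 pi)^(2 d) |g|^2 <= (2 pi)^d |h|^2 for the
    squared norms: the reverse inequality. The last clause is inversion in weak form. *)
Lemma plancherel s g : s ^+ 2 = 1 -> cmeas g -> (nsq g < +oo)%E ->
  exists h, [/\ cmeas h, nsq h = (((2 * pi) ^+ d)%:E * nsq g)%E,
    forall v, cintegrable leb v -> (nsq v < +oo)%E ->
      cint leb (fun x => h x * v x) = cint leb (fun x => g x * FT s v x) &
    forall v, cintegrable leb v -> (nsq v < +oo)%E ->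
      cint leb (fun x => h x * FT (- s) v x) =
      ((2 * pi) ^+ d)%:C * cint leb (fun x => g x * v x)].
Proof.
move=> s1 mg goo.
have s1' : (- s) ^+ 2 = 1 by rewrite sqrrN.
have finN v : (nsq v < +oo)%E -> (((2 * pi) ^+ d)%:E * nsq v < +oo)%E.
  by move=> voo; rewrite lte_mul_pinfty// lee_fin pi2_ge0.
have [h [mh hle hp]] := FT_extend s1 mg goo.
have hoo : (nsq h < +oo)%E by apply: le_lt_trans hle (finN _ goo).
have [k [mk kle kp]] := FT_extend s1' mh hoo.
have koo : (nsq k < +oo)%E by apply: le_lt_trans kle (finN _ hoo).
pose c : R[i] := ((2 * pi) ^+ d)%:C.
have mcg : cmeas (fun x => c * g x) by apply: cmeasM => //; exact: cmeas_cst.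
have cgE : nsq (fun x => c * g x) = (((2 * pi) ^+ d)%:E * (((2 * pi) ^+ d)%:E * nsq g))%E.
  by rewrite nsqZ// normc_real ger0_norm ?pi2_ge0// expr2 EFinM muleA.
have cgoo : (nsq (fun x => c * g x)%R < +oo)%E.
  by rewrite cgE lte_mul_pinfty ?lee_fin ?pi2_ge0// finN.
have kE : {ae leb, forall x, k x = c * g x}.
  suff : {ae leb, forall x, k x - c * g x = 0}.
    by apply: filterS => x /eqP; rewrite subr_eq0 => /eqP.
  apply: L2_test_ae0; [exact: cmeasB|exact: nsqB_lty|move=> phi sp].
  have Iv := cintegrable_tensor_schwartz1 sp; have voo := nsq_tensor_lty sp.
  rewrite (eq_cint _ (fun x => mulrBl _ (k x) (c * g x))).
  rewrite cintB; try by apply: cintegrable_nsqM => //; exact: Iv.1.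
  apply/eqP; rewrite subr_eq0; apply/eqP; rewrite kp// hp//; last 2 first.
  - exact: cintegrable_FT_tensor.
  - by apply: le_lt_trans (nsq_FT_le s1' Iv) (finN _ voo).
  apply: eq_cint => x; have := FT_inversion x s1' sp; rewrite opprK => ->.
  by rewrite mulrCA mulrA.
exists h; split => //.
  apply/eqP; rewrite eq_le hle/=.
  have := kle; rewrite (ae_eq_nsq mk mcg kE) cgE.
  by rewrite lee_pmul2l// lte_fin exprn_gt0// mulr_gt0// pi_gt0.
move=> v Iv voo; rewrite -kp//.
rewrite -cintZ; last by apply: cintegrable_nsqM => //; exact: Iv.1.
rewrite (eq_cint _ (fun x => mulrA c (g x) (v x))).
apply: ae_eq_cint; try by apply: cmeasM => //; exact: Iv.1.
by apply: filterS kE => x ->.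
Qed.

End L2_theory.

(** * Tempered distributions represented by square-integrable functions *)

Definition twopi_d {R : realType} (d : nat) : R := (2 * pi) ^+ d.

Section distributions.
Context {R : realType} {d : nat}.
Local Notation leb := (lebesgue_rV R d).
Local Notation E := 'rV[R]_d.
Implicit Types (f g h u v w : E -> R[i]) (T U : (E -> R[i]) -> R[i]).

Lemma l2normE g : l2norm g = (nsq g `^ 2^-1)%E.
Proof.
rewrite /l2norm unlock; congr (_ `^ _)%E; apply: eq_integral => x _.
by rewrite /= ger0_norm ?normc_ge0// powR_mulrn// normc_ge0.
Qed.

Lemma L2P g : L2 g <-> cmeas g /\ (nsq g < +oo)%E.
Proof.
rewrite /L2/= l2normE; split=> -[mg goo]; split => //.
  by apply: lty_poweRy goo; rewrite invr_neq0.
exact: poweR_lty.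
Qed.

Lemma sqrt_poweR_le (x : \bar R) (c : R) : (0 <= x)%E -> 0 <= c ->
  (x `^ 2^-1 <= c%:E)%E = (x <= (c ^+ 2)%:E)%E.
Proof.
case: x => [r| |]//= r0 c0; last by rewrite invr_eq0 (negbTE (_ : 2 != 0)).
rewrite !lee_fin in r0 *; rewrite powR12_sqrt//.
by rewrite -[in RHS](sqr_sqrtr r0) ler_pXn2r// ?nnegrE ?sqrtr_ge0.
Qed.

Lemma cmeas_tensor (phi : 'I_d -> R -> R) : (forall i, schwartz1 (phi i)) ->
  cmeas (tensor phi).
Proof. by move=> sp; exact: (cintegrable_tensor_schwartz1 sp).1. Qed.

Lemma represents_L2 T g : represents T g -> cmeas g /\ (nsq g < +oo)%E.
Proof. by move=> -[/L2P]. Qed.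

Lemma represents_unique T g h : represents T g -> represents T h ->
  {ae leb, forall x, g x = h x}.
Proof.
move=> [/L2P[mg goo] Tg] [/L2P[mh hoo] Th].
suff : {ae leb, forall x, g x - h x = 0}.
  by apply: filterS => x /eqP; rewrite subr_eq0 => /eqP.
apply: L2_test_ae0; [exact: cmeasB|exact: nsqB_lty|move=> phi sp].
have mp := cmeas_tensor sp; have poo := nsq_tensor_lty sp.
have sT := schwartz_tensor sp.
rewrite (eq_cint _ (fun x => mulrBl _ (g x) (h x))) cintB; try exact: cintegrable_nsqM.
by apply/eqP; rewrite subr_eq0; apply/eqP; have := Tg _ sT; rewrite Th.
Qed.

Lemma dist_l2norm_represents T g : represents T g -> dist_l2norm T = l2norm g.
Proof.
move=> Tg; rewrite /dist_l2norm.
have -> : [set l2norm h | h in represents T] = [set l2norm g].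
  apply/seteqP; split=> [_ [h Th <-]|_ ->]/=; last by exists g.
  rewrite !l2normE (ae_eq_nsq (represents_L2 Th).1 (represents_L2 Tg).1)//.
  exact: represents_unique Th Tg.
exact: ereal_inf1.
Qed.

Lemma dist_l2norm_nsq T g : represents T g -> dist_l2norm T = (nsq g `^ 2^-1)%E.
Proof. by move=> /dist_l2norm_represents ->; exact: l2normE. Qed.

Lemma eq_represents T U g : dist_eq T U -> represents U g -> represents T g.
Proof. by move=> TU [Lg Ug]; split=> // f sf; rewrite TU// Ug. Qed.

Lemma represents_regular g : cmeas g -> (nsq g < +oo)%E -> represents (regular g) g.
Proof. by move=> mg goo; split => //; apply/L2P. Qed.

Definition repr_L2 T : E -> R[i] := xget (fun=> 0) (represents T).

Lemma mul_L2E w T : mul_L2 w T = regular (fun x => w x * repr_L2 T x).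
Proof. by []. Qed.

Lemma repr_L2P T g : represents T g -> represents T (repr_L2 T).
Proof. by move=> Tg; rewrite /repr_L2; case: xgetP => // /(_ g). Qed.

Lemma repr_L2_ae T g : represents T g -> {ae leb, forall x, repr_L2 T x = g x}.
Proof. by move=> Tg; apply: represents_unique (repr_L2P Tg) Tg. Qed.

(** The product w x is not known to be in L_2, so [L2_test_ae0] cannot be applied to it. Tests below
    the Gaussian make w times the test at most K [weight], which is square integrable, and
    [tensor_test_ae0] applies. *)
Lemma weighted_represents w x k : cmeas w -> cmeas x -> (nsq x < +oo)%E ->
  (exists K, forall xi, normc (w xi) * rprod (fun=> gauss1) xi <= K * weight xi) ->
  represents (regular (fun xi => w xi * x xi)) k ->
  {ae leb, forall xi, w xi * x xi = k xi}.
Proof.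
move=> mw mx xoo [K wK] [/L2P[mk koo] wxk].
have sg : schwartz1 (gauss1 : R -> R) by exact: schwartz1_gauss1 R.
suff : {ae leb, forall xi, w xi * x xi - k xi = 0}.
  by apply: filterS => xi /eqP; rewrite subr_eq0 => /eqP.
have K0 (xi : E) : 0 <= K * weight xi.
  apply: le_trans (wK xi); rewrite mulr_ge0 ?normc_ge0//.
  by apply: prodr_ge0 => i _; exact: expR_ge0.
have tg phi (xi : E) : (forall i y, `|phi i y| <= gauss1 y) ->
    normc (w xi * tensor phi xi) <= normc (K%:C * (weight xi)%:C).
  move=> pg; rewrite !normcM !(normc_real K) (normc_real (weight xi)) -normrM (ger0_norm (K0 _)).
  apply: le_trans (wK xi); rewrite ler_wpM2l ?normc_ge0//.
  rewrite /tensor normc_real /rprod normr_prod ler_prod// => i _.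
  by rewrite normr_ge0 pg.
have IK : cintegrable leb (fun xi => K%:C * (weight xi)%:C).
  by apply: cintegrableZ; exact: cintegrable_weight.
have Koo : (nsq (fun xi : E => K%:C * (weight xi)%:C)%R < +oo)%E.
  apply: (@nsq_bounded_lty _ _ `|K|) => // xi.
  by rewrite normcM !normc_real ler_piMr// ger0_norm ?weight_ge0 ?weight_le1.
have It phi : (forall i, schwartz1 (phi i)) -> (forall i y, `|phi i y| <= gauss1 y) ->
    cintegrable leb (fun xi => w xi * x xi * tensor phi xi) /\
    cintegrable leb (fun xi => k xi * tensor phi xi).
  move=> sp pg; have mp := cmeas_tensor sp; split; last first.
    by apply: cintegrable_nsqM => //; exact: nsq_tensor_lty.
  rewrite (_ : (fun xi => _) = fun xi => x xi * (w xi * tensor phi xi)); last first.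
    by apply/funext => xi; rewrite mulrAC mulrC.
  apply: cintegrable_nsqM => //; first exact: cmeasM.
  apply: le_lt_trans Koo; apply: le_nsq; [exact: cmeasM|exact: IK.1|].
  by move=> xi; exact: tg.
apply: tensor_test_ae0.
- by apply: cmeasB => //; exact: cmeasM.
- rewrite (_ : (fun xi => _) = fun xi => w xi * x xi * tensor (fun=> gauss1) xi
      - k xi * tensor (fun=> gauss1) xi); last by apply/funext => xi; rewrite mulrBl.
  have [||I1 I2] := It (fun=> gauss1) => //.
    by move=> _ y; rewrite ger0_norm// expR_ge0.
  exact: cintegrableB.
- move=> phi sp pg; have [I1 I2] := It phi sp pg.
  rewrite (eq_cint _ (fun xi => mulrBl _ (w xi * x xi) (k xi))) cintB//.
  by apply/eqP; rewrite subr_eq0; apply/eqP; exact: wxk (schwartz_tensor sp).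
Qed.

Lemma regular_ae g h v : cmeas g -> cmeas h -> cmeas v ->
  {ae leb, forall x, g x = h x} -> regular g v = regular h v.
Proof.
move=> mg mh mv gh; apply: ae_eq_cint; try exact: cmeasM.
by apply: filterS gh => x ->.
Qed.

Lemma twopi_d_gt0 : 0 < twopi_d d :> R.
Proof. by rewrite exprn_gt0// mulr_gt0// pi_gt0. Qed.

Lemma inv_fourier_funE f : inv_fourier_fun f = fun t => (twopi_d d)^-1%:C * FT 1 f t.
Proof.
by apply/funext => t; congr (_ * _); apply: eq_cint => x; rewrite mul1r dotpC.
Qed.

Lemma fourier_funE f : fourier_fun f = FT (-1) f.
Proof. by apply/funext => t; apply: eq_cint => x; rewrite mulN1r. Qed.

Lemma cmeas_inv_fourier_fun f : schwartz f -> cmeas (inv_fourier_fun f).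
Proof.
move=> sf; rewrite inv_fourier_funE; apply: cmeasM; first exact: cmeas_cst.
by apply: cmeas_FT; exact: schwartz_cmeas.
Qed.

Lemma nsq_inv_fourier_fun_lty f : schwartz f -> (nsq (inv_fourier_fun f) < +oo)%E.
Proof.
move=> sf; have mf := schwartz_cmeas sf; rewrite inv_fourier_funE nsqZ; last exact: cmeas_FT.
rewrite lte_mul_pinfty ?lee_fin ?sqr_ge0//.
apply: le_lt_trans (nsq_FT_le (expr1n _ _) (schwartz_cintegrable sf)) _.
by rewrite lte_mul_pinfty ?lee_fin ?pi2_ge0// schwartz_nsq_lty.
Qed.

Lemma inv_fourier_ae g h : cmeas g -> cmeas h -> {ae leb, forall x, g x = h x} ->
  dist_eq (inv_fourier (regular g)) (inv_fourier (regular h)).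
Proof.
by move=> mg mh gh f sf; apply: regular_ae => //; exact: cmeas_inv_fourier_fun.
Qed.

Lemma inv_fourier_represents g : cmeas g -> (nsq g < +oo)%E ->
  exists h, represents (inv_fourier (regular g)) h /\
    nsq h = ((twopi_d d)^-1%:E * nsq g)%E.
Proof.
move=> mg goo; have [h [mh hE hp _]] := plancherel (expr1n _ _) mg goo.
have p0 : 0 < twopi_d d :> R := twopi_d_gt0.
have hoo : (nsq h < +oo)%E by rewrite hE lte_mul_pinfty// lee_fin pi2_ge0.
have cE : nsq (fun x => (twopi_d d)^-1%:C * h x) = ((twopi_d d)^-1%:E * nsq g)%E.
  rewrite nsqZ// hE normc_real muleA -EFinM ger0_norm ?invr_ge0 ?(ltW p0)//.
  by congr (_%:E * _)%E; rewrite -[(2 * pi) ^+ d]/(twopi_d d); field; rewrite gt_eqF.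
exists (fun x => (twopi_d d)^-1%:C * h x); split => //; split.
  apply/L2P; rewrite cE lte_mul_pinfty ?lee_fin ?invr_ge0 ?(ltW p0)//; split => //.
  by apply: cmeasM => //; exact: cmeas_cst.
move=> f sf; have If := schwartz_cintegrable sf; have foo := schwartz_nsq_lty sf.
have I1 : cintegrable leb (fun x => g x * FT 1 f x).
  apply: cintegrable_nsqM => //; first exact: cmeas_FT If.1.
  apply: le_lt_trans (nsq_FT_le (expr1n _ _) If) _.
  by rewrite lte_mul_pinfty ?lee_fin ?pi2_ge0.
have I2 : cintegrable leb (fun x => h x * f x).
  by apply: cintegrable_nsqM => //; exact: If.1.
rewrite /inv_fourier inv_fourier_funE.
transitivity (cint leb (fun x => (twopi_d d)^-1%:C * (g x * FT 1 f x))).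
  by apply: eq_cint => x; rewrite mulrCA.
rewrite cintZ// -hp// -cintZ//.
by apply: eq_cint => x; rewrite mulrA.
Qed.

Lemma dist_l2norm_inv_fourier g : cmeas g -> (nsq g < +oo)%E ->
  dist_l2norm (inv_fourier (regular g)) = (((twopi_d d)^-1%:E * nsq g) `^ 2^-1)%E.
Proof.
move=> mg goo; have [h [hr hE]] := inv_fourier_represents mg goo.
by rewrite (dist_l2norm_nsq hr) hE.
Qed.

Lemma inv_fourier_subr g h : cmeas g -> cmeas h -> (nsq g < +oo)%E -> (nsq h < +oo)%E ->
  dist_eq (dist_sub (inv_fourier (regular g)) (inv_fourier (regular h)))
    (inv_fourier (regular (fun x => g x - h x))).
Proof.
move=> mg mh goo hoo f sf; rewrite /dist_sub /inv_fourier.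
have mf := cmeas_inv_fourier_fun sf; have foo := nsq_inv_fourier_fun_lty sf.
rewrite {3}/regular.
by rewrite [RHS](eq_cint _ (fun x => mulrBl _ (g x) (h x))) [RHS]cintB//; exact: cintegrable_nsqM.
Qed.

Lemma eq_dist_l2norm T U : dist_eq T U -> dist_l2norm T = dist_l2norm U.
Proof.
move=> TU; rewrite /dist_l2norm; congr (ereal_inf [set l2norm h | h in _]).
apply/seteqP; split=> g; last exact: eq_represents.
by apply: eq_represents => f sf; rewrite TU.
Qed.

Lemma represents_sub T U g h : represents T g -> represents U h ->
  represents (dist_sub T U) (fun x => g x - h x).
Proof.
move=> [/L2P[mg goo] Tg] [/L2P[mh hoo] Uh]; split.
  by apply/L2P; split; [exact: cmeasB|exact: nsqB_lty].
move=> f sf; have mf := schwartz_cmeas sf; have foo := schwartz_nsq_lty sf.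
rewrite /dist_sub Tg// Uh// /regular.
by rewrite [RHS](eq_cint _ (fun x => mulrBl _ (g x) (h x))) [RHS]cintB//; exact: cintegrable_nsqM.
Qed.

(** A bound M on the seminorm of order 2 d gives |f| <= M [weight], so the constant is the integral
    of |h| [weight], finite as a pairing of L_2 functions. *)
Lemma regular_tempered h : cmeas h -> (nsq h < +oo)%E -> tempered (regular h).
Proof.
move=> mh hoo.
have I f : schwartz f -> cintegrable leb (fun x => h x * f x).
  by move=> sf; apply: cintegrable_nsqM => //; [exact: schwartz_cmeas|exact: schwartz_nsq_lty].
split.
  move=> c f g sf sg; rewrite /regular.
  rewrite [LHS](eq_cint _ (g := fun x => c * (h x * f x) + h x * g x)); last first.
    by move=> x; rewrite mulrDr mulrCA.
  rewrite [LHS]cintD; [|exact: cintegrableZ (I _ sf)|exact: I].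
  by rewrite cintZ//; exact: I.
have Iw : cintegrable leb (fun x => h x * (weight x)%:C).
  have [mw _] := @cintegrable_weight R d.
  apply: cintegrable_nsqM => //; apply: (@nsq_bounded_lty _ _ 1); first exact: cintegrable_weight.
  by move=> x; rewrite normc_real ger0_norm ?weight_ge0 ?weight_le1.
exists (2 * d)%N, (\int[leb]_x normc (h x * (weight x)%:C)) => f M sf bf.
apply: le_trans (normc_cint (I _ sf)) _.
rewrite -RintegralZr//; last exact: cintegrable_normc.
apply: le_Rintegral => //.
- exact: cintegrable_normc (I _ sf).
- exact: (@integrableZr _ _ _ _ _ measurableT M _ (cintegrable_normc Iw)).
move=> x _; rewrite !normcM -mulrA ler_wpM2l ?normc_ge0// normc_real ger0_norm ?weight_ge0//.
by rewrite mulrC; exact: schwartz_bound_weight.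
Qed.

(** T is regular with density the inverse transform of g. Its value at the transform of a test
    function is a pairing of L_2 functions, evaluated by the weak inversion clause of
    [plancherel]. *)
Lemma fourier_surj g : cmeas g -> (nsq g < +oo)%E ->
  exists T, tempered T /\ represents (fourier T) g.
Proof.
move=> mg goo; have [h [mh hE _ hp]] := plancherel (expr1n _ _) mg goo.
have p0 : 0 < twopi_d d :> R := twopi_d_gt0.
have hoo : (nsq h < +oo)%E by rewrite hE lte_mul_pinfty// lee_fin pi2_ge0.
pose h' x := (twopi_d d)^-1%:C * h x.
have mh' : cmeas h' by apply: cmeasM => //; exact: cmeas_cst.
exists (regular h'); split.
  by apply: regular_tempered => //; rewrite nsqZ// lte_mul_pinfty// lee_fin sqr_ge0.
split; first exact/L2P.
move=> f sf; have If := schwartz_cintegrable sf; have foo := schwartz_nsq_lty sf.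
rewrite /fourier fourier_funE /regular.
rewrite [LHS](eq_cint _ (g := fun x => (twopi_d d)^-1%:C * (h x * FT (-1) f x))); last first.
  by move=> x; rewrite mulrA.
rewrite cintZ; last first.
  apply: cintegrable_nsqM => //; first exact: cmeas_FT If.1.
  apply: le_lt_trans (nsq_FT_le _ If) _; first by rewrite sqrrN expr1n.
  by rewrite lte_mul_pinfty ?lee_fin ?pi2_ge0.
by rewrite hp// mulrA -rmorphM mulVf ?rmorph1 ?mul1r// gt_eqF.
Qed.

End distributions.

(** * Fractional derivatives *)

Lemma measurable_sgr (R : realType) : measurable_fun setT (@Num.sg R).
Proof.
rewrite (_ : Num.sg = fun t : R => if 0 < t then 1 else if t < 0 then -1 else 0).
  by apply: measurable_fun_ifT => //; first exact: measurable_fun_ltr;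
    apply: measurable_fun_ifT => //; exact: measurable_fun_ltr.
by apply/funext => t; case: (sgrP t).
Qed.

Section sobolev_class.
Context {R : realType} {d : nat}.
Local Notation leb := (lebesgue_rV R d).
Local Notation E := 'rV[R]_d.
Implicit Types (f g h u v w : E -> R[i]) (T U : (E -> R[i]) -> R[i]) (nu : R).

Lemma normc_ipow nu (t : R) : normc (ipow nu t) = `|t| `^ nu.
Proof. by rewrite normcM normc_cis mulr1 normc_real ger0_norm ?powR_ge0. Qed.

Definition coord_ipow nu (j : 'I_d) (xi : E) : R[i] := ipow nu (xi ord0 j).

Lemma cmeas_ipow nu j : cmeas (coord_ipow nu j).
Proof.
have mj : measurable_fun setT (fun xi : E => xi ord0 j) by exact: measurable_coord.
apply: cmeasM.
  apply: cmeas_real; apply: (measurableT_comp (@measurable_powR R nu)).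
  exact: measurableT_comp.
apply: cmeas_cis; do 3 apply: measurable_funM => //.
exact: measurableT_comp (@measurable_sgr R) mj.
Qed.

Lemma ipow0 (t : R) : ipow 0 t = 1.
Proof. by rewrite /ipow powRr0 mulr0 !mul0r cis0 mulr1. Qed.

Lemma D_nuE nu j T : D_nu nu j T = inv_fourier (mul_L2 (coord_ipow nu j) (fourier T)).
Proof.
rewrite /D_nu /frac_deriv; set W := (W in mul_L2 W _).
suff -> : W = coord_ipow nu j by [].
apply/funext => xi; rewrite /W.
rewrite (bigD1 j)//= big1 ?mulr1; first by rewrite !mxE !eqxx mulr1.
by move=> k kj; rewrite !mxE eqxx (negbTE kj) mulr0 ipow0.
Qed.

Lemma inv_fourier_mul_L2 w U g : cmeas w -> represents U g ->
  dist_eq (inv_fourier (mul_L2 w U)) (inv_fourier (regular (fun xi => w xi * g xi))).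
Proof.
move=> mw Ug; have Ur := repr_L2P Ug; rewrite mul_L2E.
apply: inv_fourier_ae; try apply: cmeasM => //.
- exact: (represents_L2 Ur).1.
- exact: (represents_L2 Ug).1.
- by apply: filterS (repr_L2_ae Ug) => xi ->.
Qed.

Lemma dist_l2norm_inv_fourier_mul w U g : cmeas w -> represents U g ->
  (nsq (fun xi => w xi * g xi)%R < +oo)%E ->
  dist_l2norm (inv_fourier (mul_L2 w U)) =
  (((twopi_d d)^-1%:E * nsq (fun xi => w xi * g xi)%R) `^ 2^-1)%E.
Proof.
move=> mw Ug wgoo; rewrite (eq_dist_l2norm (inv_fourier_mul_L2 mw Ug)).
by apply: dist_l2norm_inv_fourier => //; apply: cmeasM => //; exact: (represents_L2 Ug).1.
Qed.

(** Half of the Gaussian absorbs the power, since ln |t| <= |t| and nu |t| <= (nu^2 + t^2) / 2; the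
    other half absorbs 1 + t^2 <= 2 exp(t^2 / 2). *)
Lemma powR_gauss_le nu (t : R) : 0 <= nu ->
  `|t| `^ nu * gauss1 t <= 2 * expR (nu ^+ 2 / 2) * (1 + t ^+ 2)^-1.
Proof.
move=> nu0; rewrite ler_pdivlMr ?ltr_pwDl ?sqr_ge0// /gauss1.
have -> : expR (- t ^+ 2) = expR (- (t ^+ 2 / 2)) * expR (- (t ^+ 2 / 2)).
  by rewrite -expRD; congr expR; field.
have h1 : `|t| `^ nu <= expR (nu ^+ 2 / 2) * expR (t ^+ 2 / 2).
  have [->|t0] := eqVneq t 0.
    rewrite normr0 expr0n/= mul0r expR0 mulr1.
    have [->|n0] := eqVneq nu 0; first by rewrite powRr0 -expR0 ler_expR divr_ge0 ?sqr_ge0.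
    by rewrite powR0// expR_ge0.
  rewrite /powR normr_eq0 (negbTE t0) -expRD ler_expR.
  apply: (@le_trans _ _ (nu * `|t|)).
    by rewrite ler_wpM2l// (ltW (ln_sublinear _)) ?normr_gt0.
  have : t ^+ 2 = `|t| ^+ 2 by rewrite real_normK ?num_real.
  by move=> ->; have := sqr_ge0 (nu - `|t|); lra.
have h2 : 1 + t ^+ 2 <= 2 * expR (t ^+ 2 / 2).
  by have := expR_ge1Dx (t ^+ 2 / 2); have := sqr_ge0 t; lra.
have e0 : 0 < expR (- (t ^+ 2 / 2)) by exact: expR_gt0.
have e1 : expR (t ^+ 2 / 2) * expR (- (t ^+ 2 / 2)) = 1 by rewrite -expRD subrr expR0.
rewrite [leLHS](_ : _ = (`|t| `^ nu * expR (- (t ^+ 2 / 2))) *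
  ((1 + t ^+ 2) * expR (- (t ^+ 2 / 2)))); last by ring.
rewrite [leRHS]mulrC; apply: ler_pM.
- by rewrite mulr_ge0 ?powR_ge0 ?ltW.
- by rewrite mulr_ge0 ?addr_ge0 ?sqr_ge0 ?ltW.
- by apply: le_trans (ler_wpM2r (ltW e0) h1) _; rewrite -mulrA e1 mulr1.
- by apply: le_trans (ler_wpM2r (ltW e0) h2) _; rewrite -mulrA e1 mulr1.
Qed.

Lemma coord_ipow_gauss nu j : 0 <= nu -> exists K, forall xi : E,
  normc (coord_ipow nu j xi) * rprod (fun=> gauss1) xi <= K * weight xi.
Proof.
move=> nu0; exists (2 * expR (nu ^+ 2 / 2)) => xi.
rewrite normc_ipow /rprod /weight (bigD1 j)//= [X in _ <= _ * X](bigD1 j)//= !mulrA.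
apply: ler_pM.
- by rewrite mulr_ge0 ?powR_ge0 ?expR_ge0.
- by apply: prodr_ge0 => i _; exact: expR_ge0.
- exact: powR_gauss_le.
apply: ler_prod => i _; rewrite expR_ge0/= /gauss1 expRN lef_pV2 ?posrE ?expR_gt0//.
  exact: expR_ge1Dx.
by rewrite ltr_pwDl// sqr_ge0.
Qed.

(** The integral of |xi_j|^(2 nu) |g|^2; for g = Fx it is (2 pi)^d times the squared norm of D^(nu
    e_j) x. *)
Definition moment nu j g : \bar R := nsq (fun xi => coord_ipow nu j xi * g xi).

(** With [X2_surj], trades distributions for functions: membership in X_2 becomes finiteness of the
    norm and of the d moments of one function g. *)
Lemma X2_represents nu T : 0 <= nu -> X2 nu T -> exists g,
  represents (fourier T) g /\ forall j, (moment nu j g < +oo)%E.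
Proof.
move=> nu0 [_ DT [g Tg]]; exists g; split => // j; have [k Dk] := DT j.
have Tr := repr_L2P Tg; have [mr roo] := represents_L2 Tr.
have mi := cmeas_ipow nu j; have [mg goo] := represents_L2 Tg.
have [mk koo] := represents_L2 Dk.
have h := weighted_represents mi mr roo (coord_ipow_gauss j nu0) Dk.
rewrite /moment (ae_eq_nsq _ mk) ?koo//; first exact: cmeasM.
by apply: filterS2 h (repr_L2_ae Tg) => xi <- ->.
Qed.

Lemma X2_surj nu g : cmeas g -> (nsq g < +oo)%E -> (forall j, (moment nu j g < +oo)%E) ->
  exists T, X2 nu T /\ represents (fourier T) g.
Proof.
move=> mg goo mom; have [T [tT Tg]] := fourier_surj mg goo.
exists T; split => //; split => //; last by exists g.
move=> j; have Tr := repr_L2P Tg; have [mr roo] := represents_L2 Tr.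
have mi := cmeas_ipow nu j.
have m1 : cmeas (fun xi => coord_ipow nu j xi * repr_L2 (fourier T) xi) by exact: cmeasM.
have m2 : cmeas (fun xi => coord_ipow nu j xi * g xi) by exact: cmeasM.
exists (fun xi => coord_ipow nu j xi * repr_L2 (fourier T) xi).
apply: represents_regular => //; rewrite (ae_eq_nsq m1 m2) ?mom//.
by apply: filterS (repr_L2_ae Tg) => xi ->.
Qed.

Lemma dist_l2norm_D_nu nu j T g : represents (fourier T) g -> (moment nu j g < +oo)%E ->
  dist_l2norm (D_nu nu j T) = (((twopi_d d)^-1%:E * moment nu j g) `^ 2^-1)%E.
Proof.
move=> Tg goo; rewrite D_nuE; apply: dist_l2norm_inv_fourier_mul => //.
exact: cmeas_ipow.
Qed.

Definition Lambda_weight (theta eta : R) (xi : E) : R[i] :=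
  (psi theta xi `^ (eta / 2))%:C.

Lemma cmeas_Lambda_weight theta eta : cmeas (Lambda_weight theta eta).
Proof.
apply: cmeas_real; apply: (measurableT_comp (@measurable_powR R _)).
apply: (measurableT_comp (@measurable_powR R _)).
apply: measurable_sum => j; apply: (measurableT_comp (@measurable_powR R _)).
by apply: measurableT_comp => //; exact: measurable_coord.
Qed.

Lemma normc_Lambda_weight theta eta xi :
  normc (Lambda_weight theta eta xi) ^+ 2 = psi theta xi `^ eta.
Proof.
rewrite /Lambda_weight normc_real; move: (psi theta xi) => p.
by rewrite ger0_norm ?powR_ge0// -powR_mulrn ?powR_ge0// -powRrM divfK.
Qed.

Lemma LambdaE theta eta T : Lambda theta eta T =
  inv_fourier (mul_L2 (Lambda_weight theta eta) (fourier T)).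
Proof. by []. Qed.

Lemma dist_l2norm_Lambda theta eta T g : represents (fourier T) g ->
  (nsq (fun xi => Lambda_weight theta eta xi * g xi)%R < +oo)%E ->
  dist_l2norm (Lambda theta eta T) =
  (((twopi_d d)^-1%:E * nsq (fun xi => Lambda_weight theta eta xi * g xi)%R) `^ 2^-1)%E.
Proof.
by move=> Tg goo; apply: dist_l2norm_inv_fourier_mul => //; exact: cmeas_Lambda_weight.
Qed.

Lemma dist_l2norm_Lambda_sub theta eta T g g' m : represents (fourier T) g ->
  (nsq (fun xi => Lambda_weight theta eta xi * g xi)%R < +oo)%E -> L2 g' ->
  dist_eq (regular m) (inv_fourier (regular g')) ->
  dist_l2norm (dist_sub (Lambda theta eta T) (regular m)) =
  (((twopi_d d)^-1%:E *
    nsq (fun xi => Lambda_weight theta eta xi * g xi - g' xi)%R) `^ 2^-1)%E.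
Proof.
move=> Tg goo /L2P[mg' g'oo] mg'E.
have mW := cmeas_Lambda_weight theta eta.
have mWg : cmeas (fun xi => Lambda_weight theta eta xi * g xi).
  by apply: cmeasM => //; exact: (represents_L2 Tg).1.
rewrite -dist_l2norm_inv_fourier; [|exact: cmeasB|exact: nsqB_lty].
apply: eq_dist_l2norm => f sf; rewrite -inv_fourier_subr//.
by rewrite /dist_sub mg'E// LambdaE (inv_fourier_mul_L2 mW Tg).
Qed.

End sobolev_class.

(** * The symbol inequality *)

Section power_inequalities.
Context {R : realType}.
Implicit Types (k p s t u x rho : R).

Lemma powR_sqr x k : 0 <= x -> (x `^ k) ^+ 2 = (x ^+ 2) `^ k.
Proof. by move=> x0; rewrite -powR_mulrn ?powR_ge0// powRAC powR_mulrn. Qed.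

(** Young's inequality for the product of u^k and 1, with exponents 1 / k and 1 / (1 - k). *)
Lemma powR_bernoulli k u : 0 <= k <= 1 -> 0 <= u -> u `^ k <= k * u + (1 - k).
Proof.
move=> /andP[k0 k1] u0.
have [->|kn0] := eqVneq k 0; first by rewrite powRr0 mul0r add0r subr0.
have [->|kn1] := eqVneq k 1; first by rewrite powRr1// mul1r subrr addr0.
have kp : 0 < k by rewrite lt_neqAle eq_sym kn0.
have kq : 0 < 1 - k by rewrite subr_gt0 lt_neqAle kn1.
have := @conjugate_powR R (u `^ k) 1 k^-1 (1 - k)^-1.
rewrite powR_ge0 ler01 !invr_gt0 kp kq !invrK => /(_ isT isT isT isT).
rewrite addrC subrK => /(_ erefl).
by rewrite mulr1 powR1 mul1r -powRrM mulfV// powRr1// mulrC.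
Qed.

(** The right-hand side is the tangent at s = rho of the concave function s^k; homogeneity reduces
    it to [powR_bernoulli] at s / rho. *)
Lemma powR_weighted_agm k s rho : 0 < k < 1 -> 0 <= s -> 0 < rho ->
  s `^ k <= k * rho `^ (k - 1) * s + (1 - k) * rho `^ k.
Proof.
move=> /andP[k0 k1] s0 r0.
have -> : rho `^ (k - 1) = rho `^ k / rho.
  by rewrite powRB ?(gt_eqF r0) ?implybT// powRr1// ltW.
have -> : s = rho * (s / rho) by rewrite mulrC divfK// gt_eqF.
set u := s / rho; have u0 : 0 <= u by rewrite divr_ge0// ltW.
rewrite powRM// ?(ltW r0)//.
have -> : k * (rho `^ k / rho) * (rho * u) + (1 - k) * rho `^ k =
    rho `^ k * (k * u + (1 - k)) by field; rewrite gt_eqF.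
by rewrite ler_wpM2l ?powR_ge0// powR_bernoulli// !ltW.
Qed.

(** Optimises over rho: for positive s and t the minimiser is rho = s / t, where the bound equals
    the claimed product. The degenerate cases are limits in rho. *)
Lemma powR_weighted_agm_le k s t x : 0 < k < 1 -> 0 <= s -> 0 <= t ->
  (forall rho, 0 < rho -> x <= k * rho `^ (k - 1) * s + (1 - k) * rho `^ k * t) ->
  x <= s `^ k * t `^ (1 - k).
Proof.
move=> /andP[k0 k1] s0 t0 xP; have k'0 : 0 < 1 - k by rewrite subr_gt0.
have [tz|tn0] := eqVneq t 0.
  rewrite tz powR0 ?gt_eqF// mulr0 leNgt; apply/negP => x0.
  have [sz|sn0] := eqVneq s 0.
    by have := xP 1 ltr01; rewrite sz tz !mulr0 addr0 leNgt x0.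
  have sp : 0 < s by rewrite lt_neqAle eq_sym sn0.
  have y0 : 0 < x / (2 * s) by rewrite divr_gt0// mulr_gt0.
  (* With t = 0 the bound tends to 0 as rho grows; this rho makes it k x / 2, less than x. *)
  have := xP ((x / (2 * s)) `^ (k - 1)^-1) (powR_gt0 _ y0).
  rewrite tz mulr0 addr0 -powRrM mulVf ?lt_eqF ?subr_lt0// powRr1 ?(ltW y0)//.
  rewrite (_ : k * (x / (2 * s)) * s = k * (x / 2)); last by field.
  by nra.
have tp : 0 < t by rewrite lt_neqAle eq_sym tn0.
have [sz|sn0] := eqVneq s 0.
  rewrite sz powR0 ?gt_eqF// mul0r leNgt; apply/negP => x0.
  have y0 : 0 < x / (2 * t) by rewrite divr_gt0// mulr_gt0.
  (* With s = 0 the bound tends to 0 with rho; this rho makes it (1 - k) x / 2. *)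
  have := xP ((x / (2 * t)) `^ k^-1) (powR_gt0 _ y0).
  rewrite sz mulr0 add0r -powRrM mulVf ?gt_eqF// powRr1 ?(ltW y0)//.
  rewrite (_ : (1 - k) * (x / (2 * t)) * t = (1 - k) * (x / 2)); last by field.
  by nra.
have sp : 0 < s by rewrite lt_neqAle eq_sym sn0.
have r0 : 0 < s / t by rewrite divr_gt0.
apply: le_trans (xP _ r0) _.
have -> : (s / t) `^ (k - 1) = (s / t) `^ k / (s / t).
  by rewrite powRB ?(gt_eqF r0) ?implybT// powRr1// ltW.
have -> : t `^ (1 - k) = t / t `^ k.
  by rewrite powRB ?(gt_eqF tp) ?implybT// powRr1// ltW.
have -> : (s / t) `^ k = s `^ k / t `^ k.
  by rewrite powRM ?invr_ge0 ?ltW// -powR_inv1 ?ltW// -powRrM mulN1r powRN.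
rewrite le_eqVlt; apply/orP; left; apply/eqP; field.
by rewrite !gt_eqF ?powR_gt0.
Qed.

Lemma power_mean (I : finType) (a : I -> R) p : (0 < #|I|)%N -> 1 <= p ->
  (forall i, 0 <= a i) ->
  #|I|%:R * ((\sum_i a i) / #|I|%:R) `^ p <= \sum_i a i `^ p.
Proof.
move=> I0 p1 a0; set d : R := #|I|%:R; have d0 : 0 < d by rewrite ltr0n.
have p0 : 0 < p by exact: lt_le_trans p1.
have A0 : 0 <= \sum_i a i by apply: sumr_ge0 => i _.
set m := (\sum_i a i) / d; have m0 : 0 <= m by rewrite divr_ge0// ltW.
have [mz|mn0] := eqVneq m 0.
  rewrite mz powR0 ?gt_eqF// mulr0; apply: sumr_ge0 => i _; exact: powR_ge0.
have mp : 0 < m by rewrite lt_neqAle eq_sym mn0.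
(* tangent line at the mean *)
have tangent i : m `^ p * (p * (a i / m) - p + 1) <= a i `^ p.
  have am : 0 <= a i / m by rewrite divr_ge0.
  have -> : a i `^ p = m `^ p * (a i / m) `^ p.
    by rewrite -powRM// mulrC divfK.
  rewrite ler_wpM2l ?powR_ge0//.
  (* Bernoulli's inequality for the exponent 1 / p at (a_i / m)^p, solved for that p-th power, is
     the inequality for p. *)
  have := @powR_bernoulli p^-1 ((a i / m) `^ p).
  rewrite powR_ge0 invr_ge0 (ltW p0) invf_le1// p1 -powRrM mulfV ?gt_eqF// powRr1//.
  rewrite /= => /(_ isT isT) h; rewrite -(ler_pM2l p0) in h.
  have : p * (p^-1 * (a i / m) `^ p + (1 - p^-1)) = (a i / m) `^ p + p - 1.
    by field; rewrite gt_eqF.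
  by move=> hp; rewrite hp in h; lra.
apply: le_trans (ler_sum _ (fun i _ => tangent i)); rewrite -mulr_sumr.
rewrite big_split sumrB -mulr_sumr -mulr_suml /= !sumr_const -/d.
rewrite -[_ *+ _]mulr_natl -[1 *+ _]mulr_natl mulr1 -/d.
have -> : \sum_i a i = m * d by rewrite divfK// gt_eqF.
rewrite le_eqVlt; apply/orP; left; apply/eqP; field.
by rewrite gt_eqF.
Qed.

End power_inequalities.

(** * Comparison of psi_theta with the sum of the |xi_j|^(2 nu) *)

Section symbol_inequality.
Context {R : realType} {d : nat}.
Local Notation E := 'rV[R]_d.
Variables nu eta theta : R.
Hypotheses (d_gt0 : (0 < d)%N) (eta_gt0 : 0 < eta) (eta_lt_nu : eta < nu).
Hypotheses (theta_gt0 : 0 < theta) (theta_le : theta <= 2 * nu).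

Definition sobolev_symbol (xi : E) : R := \sum_j `|xi ord0 j| `^ (2 * nu).

Lemma sobolev_symbol_ge0 xi : 0 <= sobolev_symbol xi.
Proof. by apply: sumr_ge0 => j _; exact: powR_ge0. Qed.

Lemma exponent_itv : 0 < eta / nu < 1.
Proof.
have nu0 : 0 < nu by exact: lt_trans eta_lt_nu.
by rewrite divr_gt0// ltr_pdivrMr// mul1r.
Qed.

(** The power mean inequality for the |xi_j|^theta with exponent 2 nu / theta >= 1, raised to the
    power eta / nu. *)
Lemma psi_powR_le xi : psi theta xi `^ eta <=
  d%:R `^ (2 * eta / theta) * (sobolev_symbol xi / d%:R) `^ (eta / nu).
Proof.
have nu0 : 0 < nu by exact: lt_trans eta_lt_nu.
have d0 : 0 < d%:R :> R by rewrite ltr0n.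
have := @power_mean R 'I_d (fun j => `|xi ord0 j| `^ theta) (2 * nu / theta).
rewrite card_ord ler_pdivlMr// mul1r => /(_ d_gt0 theta_le (fun=> powR_ge0 _ _)).
under [X in _ <= X -> _]eq_bigr do rewrite -powRrM mulrC divfK ?gt_eqF//.
rewrite -/(sobolev_symbol xi) mulrC -ler_pdivlMr// => h.
rewrite /psi; move: h; set A := \sum_j _ => h.
have A0 : 0 <= A by apply: sumr_ge0 => j _; exact: powR_ge0.
have -> : (A `^ (2 / theta)) `^ eta =
    d%:R `^ (2 * eta / theta) * ((A / d%:R) `^ (2 * nu / theta)) `^ (eta / nu).
  rewrite -!powRrM (_ : 2 / theta * eta = 2 * eta / theta); last by ring.
  rewrite (_ : 2 * nu / theta * (eta / nu) = 2 * eta / theta); last first.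
    by field; rewrite !gt_eqF.
  rewrite -powRM ?divr_ge0 ?(ltW d0)//; congr (_ `^ _).
  by rewrite mulrC divfK// gt_eqF.
rewrite ler_wpM2l ?powR_ge0// ge0_ler_powR ?nnegrE ?powR_ge0//.
  by rewrite divr_ge0 ?ltW.
by rewrite divr_ge0 ?sobolev_symbol_ge0 ?ltW.
Qed.

Lemma psi_powR_le_weighted rho xi : 0 < rho -> psi theta xi `^ eta <=
  eta / nu * d%:R `^ (2 * eta / theta - 1) * rho `^ (eta / nu - 1) * sobolev_symbol xi
  + d%:R `^ (2 * eta / theta) * (1 - eta / nu) * rho `^ (eta / nu).
Proof.
move=> r0; have d0 : 0 < d%:R :> R by rewrite ltr0n.
apply: le_trans (psi_powR_le xi) _.
have s0 : 0 <= sobolev_symbol xi / d%:R by rewrite divr_ge0 ?sobolev_symbol_ge0 ?ltW.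
have := powR_weighted_agm exponent_itv s0 r0.
rewrite -(@ler_pM2l _ (d%:R `^ (2 * eta / theta))) ?powR_gt0// => /le_trans; apply.
have -> : d%:R `^ (2 * eta / theta - 1) = d%:R `^ (2 * eta / theta) / d%:R :> R.
  by rewrite powRB ?(gt_eqF d0) ?implybT// powRr1// ltW.
rewrite le_eqVlt; apply/orP; left; apply/eqP; field.
by rewrite !gt_eqF//; exact: lt_trans eta_lt_nu.
Qed.

(** Settles the point where the denominator lambda_2 S of the multiplier condition is 0, so that
    division by it gives no information: psi_theta^eta vanishes there too. *)
Lemma sobolev_symbol_eq0_psi xi : sobolev_symbol xi = 0 -> psi theta xi `^ eta = 0.
Proof.
move=> S0; apply/eqP; rewrite eq_le powR_ge0 andbT.
apply: le_trans (psi_powR_le xi) _.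
by rewrite S0 mul0r powR0 ?mulr0// gt_eqF// (andP exponent_itv).1.
Qed.

End symbol_inequality.

(** * The upper bound *)

Section upper_bound.
Context {R : realType} {d : nat}.
Local Notation leb := (lebesgue_rV R d).
Local Notation E := 'rV[R]_d.
Implicit Types (f g h u v w y a : E -> R[i]) (T U : (E -> R[i]) -> R[i]).

Lemma sum_moment nu g : cmeas g -> (\sum_j moment nu j g =
  \int[leb]_xi (sobolev_symbol nu xi * normc (g xi) ^+ 2)%:E)%E.
Proof.
move=> mg; rewrite -ge0_integral_sum//.
- apply: eq_integral => xi _; rewrite sumEFin mulr_suml; congr _%:E.
  apply: eq_bigr => j _; rewrite normcM exprMn normc_ipow; congr (_ * _).
  by rewrite -powR_mulrn ?powR_ge0// -powRrM mulrC.
- by move=> j; apply: cmeas_normc2; apply: cmeasM => //; exact: cmeas_ipow.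
- by move=> j xi _; rewrite lee_fin sqr_ge0.
Qed.

Lemma measurable_sobolev_symbol nu : measurable_fun setT (@sobolev_symbol R d nu).
Proof.
apply: measurable_sum => j; apply: (measurableT_comp (@measurable_powR R _)).
by apply: measurableT_comp => //; exact: measurable_coord.
Qed.

Lemma nsq_le_moment nu u g h (A B : R) : cmeas u -> cmeas g -> cmeas h ->
  0 <= A -> 0 <= B ->
  {ae leb, forall xi, normc (u xi) ^+ 2 <=
     A * (sobolev_symbol nu xi * normc (g xi) ^+ 2) + B * normc (h xi) ^+ 2} ->
  (nsq u <= A%:E * \sum_j moment nu j g + B%:E * nsq h)%E.
Proof.
move=> mu mg mh A0 B0 ule; rewrite sum_moment//.
have mS := @measurable_sobolev_symbol nu; have mg2 := measurable_funX 2 (cmeas_normc mg).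
have mh2 := measurable_funX 2 (cmeas_normc mh).
have mSg : measurable_fun setT (fun xi => (sobolev_symbol nu xi * normc (g xi) ^+ 2)%:E).
  by apply/measurable_EFinP; apply: measurable_funM.
have Sg0 xi : 0 <= sobolev_symbol nu xi * normc (g xi) ^+ 2.
  by rewrite mulr_ge0 ?sqr_ge0 ?sobolev_symbol_ge0.
rewrite -!ge0_integralZl//; try by [move=> xi _; rewrite lee_fin ?sqr_ge0|exact: cmeas_normc2].
rewrite -ge0_integralD//; last first.
- by apply: emeasurable_funM => //; exact: cmeas_normc2.
- by move=> xi _; rewrite -EFinM lee_fin mulr_ge0 ?sqr_ge0.
- exact: emeasurable_funM.
- by move=> xi _; rewrite -EFinM lee_fin mulr_ge0.
apply: ae_ge0_le_integral => //.
- by move=> xi _; rewrite lee_fin sqr_ge0.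
- exact: cmeas_normc2.
- by move=> xi _; rewrite -!EFinM -EFinD lee_fin addr_ge0// mulr_ge0 ?sqr_ge0.
- by apply: emeasurable_funD; apply: emeasurable_funM => //; exact: cmeas_normc2.
- by apply: filterS ule => xi h1 _; rewrite -!EFinM -EFinD lee_fin.
Qed.

Lemma sqr_cauchy_schwarz (p q x z al be : R) : 0 < al -> 0 < be ->
  (p * x + q * z) ^+ 2 <= (p ^+ 2 / al + q ^+ 2 / be) * (al * x ^+ 2 + be * z ^+ 2).
Proof.
move=> a0 b0; rewrite -subr_ge0.
have -> : (p ^+ 2 / al + q ^+ 2 / be) * (al * x ^+ 2 + be * z ^+ 2) - (p * x + q * z) ^+ 2
  = (p * be * z - q * al * x) ^+ 2 / (al * be) by field; rewrite !gt_eqF.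
by rewrite divr_ge0 ?sqr_ge0// mulr_ge0// ltW.
Qed.

(** The error splits into bias and noise, w ((1 - a) g + a (g - y)), and Cauchy-Schwarz weighs them
    by al and be. *)
Lemma multiplier_error_le (w a g y : R[i]) (al be : R) : 0 < al -> 0 < be ->
  normc w ^+ 2 * (normc (1 - a) ^+ 2 / al + normc a ^+ 2 / be) <= 1 ->
  normc (w * g - a * w * y) ^+ 2 <= al * normc g ^+ 2 + be * normc (g - y) ^+ 2.
Proof.
move=> a0 b0 h.
have -> : w * g - a * w * y = w * ((1 - a) * g + a * (g - y)) by ring.
rewrite normcM exprMn; set x := normc g; set z := normc (g - y).
apply: (@le_trans _ _ (normc w ^+ 2 * (normc (1 - a) * x + normc a * z) ^+ 2)).
  rewrite ler_wpM2l ?sqr_ge0// lerXn2r ?nnegrE ?normc_ge0//.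
    by rewrite addr_ge0// mulr_ge0// normc_ge0.
  by rewrite (le_trans (normcD _ _))// !normcM.
apply: le_trans (ler_wpM2l (sqr_ge0 _) (sqr_cauchy_schwarz _ _ _ _ a0 b0)) _.
by rewrite mulrA -[leRHS]mul1r ler_wpM2r// addr_ge0// mulr_ge0 ?sqr_ge0// ltW.
Qed.

Lemma scaled_sqrt_le (x : \bar R) (c : R) : (0 <= x)%E -> 0 <= c ->
  (((twopi_d d)^-1%:E * x) `^ 2^-1 <= c%:E)%E = (x <= (twopi_d d * c ^+ 2)%:E)%E.
Proof.
move=> x0 c0; have p0 : 0 < twopi_d d :> R by exact: twopi_d_gt0.
rewrite sqrt_poweR_le//; last by rewrite mule_ge0// lee_fin invr_ge0 ltW.
by rewrite EFinM lee_pdivrMl.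
Qed.

Variables nu eta theta delta : R.
Hypotheses (d_gt0 : (0 < d)%N) (eta_gt0 : 0 < eta) (eta_lt_nu : eta < nu).
Hypotheses (theta_gt0 : 0 < theta) (theta_le : theta <= 2 * nu).
Hypothesis delta_gt0 : 0 < delta.

Let W := @Lambda_weight R d theta eta.
Let la2 : R := lambda2 d theta eta nu delta.
Let la1 : R := lambda1 d theta eta nu delta.
Let tp : R := twopi_d d.
Let rho : R := tp / delta ^+ 2.
Let kappa : R := eta / nu.

Definition optimal_value : R := d%:R `^ (eta / theta) *
  (delta / (2 * pi) `^ (d%:R / 2)) `^ (1 - eta / nu).

Definition sharp_constant : R :=
  d%:R `^ (eta / theta) / (2 * pi) `^ (d%:R * (1 - eta / nu) / 2).

Lemma optimal_value_sharp : optimal_value = sharp_constant * delta `^ (1 - eta / nu).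
Proof.
have pi0 : 0 < 2 * pi :> R by rewrite mulr_gt0// pi_gt0.
rewrite /optimal_value /sharp_constant.
rewrite powRM ?invr_ge0 ?powR_ge0 ?(ltW delta_gt0)//.
have -> : ((2 * pi) `^ (d%:R / 2))^-1 `^ (1 - eta / nu) =
    ((2 * pi) `^ (d%:R * (1 - eta / nu) / 2))^-1 :> R.
  by rewrite -!powRN -powRrM; congr (_ `^ _); ring.
by ring.
Qed.

Lemma optimal_value_gt0 : 0 < optimal_value.
Proof.
by rewrite mulr_gt0 ?powR_gt0 ?ltr0n// divr_gt0// powR_gt0// mulr_gt0// pi_gt0.
Qed.

Lemma sharp_constant_gt0 : 0 < sharp_constant.
Proof. by rewrite divr_gt0 ?powR_gt0 ?ltr0n// mulr_gt0// pi_gt0. Qed.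

Lemma sharp_constant_sqr : sharp_constant ^+ 2 =
  d%:R `^ (2 * eta / theta) / tp `^ (1 - kappa).
Proof.
have pi0 : 0 < 2 * pi :> R by rewrite mulr_gt0// pi_gt0.
rewrite /sharp_constant expr_div_n -!powR_mulrn ?powR_ge0// -!powRrM.
have -> : eta / theta * 2 = 2 * eta / theta by ring.
have -> : tp = (2 * pi) `^ d%:R by rewrite powR_mulrn// ltW.
by rewrite -powRrM divfK.
Qed.

Lemma rho_gt0 : 0 < rho.
Proof. by rewrite divr_gt0 ?twopi_d_gt0// exprn_gt0. Qed.

Lemma optimal_value_sqr : optimal_value ^+ 2 =
  d%:R `^ (2 * eta / theta) * rho `^ (kappa - 1).
Proof.
rewrite optimal_value_sharp exprMn sharp_constant_sqr -/kappa.
have -> : rho `^ (kappa - 1) = (delta `^ (1 - kappa)) ^+ 2 / tp `^ (1 - kappa).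
  rewrite -opprB powRN /rho powRM ?invr_ge0 ?sqr_ge0 ?ltW ?twopi_d_gt0//.
  rewrite -powR_invn ?(ltW delta_gt0)// -powR_mulrn ?powR_ge0// -!powRrM invfM.
  rewrite mulrC -[X in X * _]powRN (_ : - (-2 * (1 - kappa)) = (1 - kappa) * 2)//.
  by ring.
by ring.
Qed.

Lemma lambda1E : tp * la1 = d%:R `^ (2 * eta / theta) * (1 - kappa) * rho `^ kappa.
Proof.
rewrite /la1 /lambda1 -[(2 * pi) ^+ d]/tp -/rho -/kappa; field.
by rewrite gt_eqF// twopi_d_gt0.
Qed.

Lemma lambda2E : la2 = kappa * d%:R `^ (2 * eta / theta - 1) * rho `^ (kappa - 1).
Proof. by []. Qed.

Lemma lambda1_gt0 : 0 < tp * la1.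
Proof.
have /andP[k0 k1] := exponent_itv eta_gt0 eta_lt_nu.
by rewrite lambda1E !mulr_gt0 ?powR_gt0 ?ltr0n ?subr_gt0 ?rho_gt0.
Qed.

Lemma lambda2_gt0 : 0 < la2.
Proof.
have /andP[k0 k1] := exponent_itv eta_gt0 eta_lt_nu.
have d0 : 0 < d%:R :> R by rewrite ltr0n.
exact: mulr_gt0 (mulr_gt0 k0 (powR_gt0 _ d0)) (powR_gt0 _ rho_gt0).
Qed.

(** Lagrangian duality without gap: when the d moments are at their bound (2 pi)^d and the squared
    noise at delta^2, the integrated error bound is exactly (2 pi)^d times the square of the optimal
    value. *)
Lemma lambda_value : la2 * (d%:R * tp) + tp * la1 * delta ^+ 2 = tp * optimal_value ^+ 2.
Proof.
have d0 : 0 < d%:R :> R by rewrite ltr0n.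
have tp0 : 0 < tp by exact: twopi_d_gt0.
rewrite lambda1E lambda2E optimal_value_sqr.
have -> : d%:R `^ (2 * eta / theta - 1) = d%:R `^ (2 * eta / theta) / d%:R :> R.
  by rewrite powRB ?(gt_eqF d0) ?implybT// powRr1// ltW.
have -> : rho `^ kappa = rho `^ (kappa - 1) * rho.
  by rewrite mulrC mulr_powRB1 ?ltW ?rho_gt0// (andP (exponent_itv eta_gt0 eta_lt_nu)).1.
have -> : delta ^+ 2 = tp / rho by rewrite /rho invfM invrK mulrA mulfV ?mul1r// gt_eqF.
by field; rewrite !gt_eqF ?rho_gt0.
Qed.

Lemma lambda_coef2_ge0 r : 0 <= kappa * d%:R `^ (2 * eta / theta - 1) * r `^ (kappa - 1).
Proof.
have /andP[/ltW k0 _] := exponent_itv eta_gt0 eta_lt_nu.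
exact: mulr_ge0 (mulr_ge0 k0 (powR_ge0 _ _)) (powR_ge0 _ _).
Qed.

Lemma lambda_coef1_ge0 r : 0 <= d%:R `^ (2 * eta / theta) * (1 - kappa) * r `^ kappa.
Proof.
have /andP[_ /ltW k1] := exponent_itv eta_gt0 eta_lt_nu.
by rewrite -subr_ge0 in k1; exact: mulr_ge0 (mulr_ge0 (powR_ge0 _ _) k1) (powR_ge0 _ _).
Qed.

(** The parameter r stays free: r = 1 is enough for finiteness, and optimising over r yields the
    multiplicative inequality. *)
Lemma nsq_Lambda_le g r : cmeas g -> 0 < r ->
  (nsq (fun xi => W xi * g xi)%R <=
   (kappa * d%:R `^ (2 * eta / theta - 1) * r `^ (kappa - 1))%:E * \sum_j moment nu j g +
   (d%:R `^ (2 * eta / theta) * (1 - kappa) * r `^ kappa)%:E * nsq g)%E.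
Proof.
move=> mg r0; apply: nsq_le_moment => //.
- by apply: cmeasM => //; exact: cmeas_Lambda_weight.
- exact: lambda_coef2_ge0.
- exact: lambda_coef1_ge0.
apply: aeW => xi /=; rewrite normcM exprMn normc_Lambda_weight.
have h := psi_powR_le_weighted d_gt0 eta_gt0 eta_lt_nu theta_gt0 theta_le xi r0.
apply: le_trans (ler_wpM2r (sqr_ge0 (normc (g xi))) h) _.
by rewrite le_eqVlt; apply/orP; left; apply/eqP; rewrite /kappa; ring.
Qed.

Lemma nsq_Lambda_lty g : cmeas g -> (nsq g < +oo)%E -> (forall j, (moment nu j g < +oo)%E) ->
  (nsq (fun xi => W xi * g xi)%R < +oo)%E.
Proof.
move=> mg goo mom.
apply: le_lt_trans (nsq_Lambda_le mg ltr01) _; apply: lte_add_pinfty.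
  rewrite lte_mul_pinfty ?lee_fin ?lambda_coef2_ge0//.
  by apply: lte_sum_pinfty => j _; exact: mom.
by rewrite lte_mul_pinfty ?lee_fin ?lambda_coef1_ge0.
Qed.

Lemma multiplier_method_error a m : lebesgue_cmeasurable a ->
  multiplier_condition theta eta nu delta a -> multiplier_method theta eta a m ->
  (method_error theta eta nu delta m <= optimal_value%:E)%E.
Proof.
move=> [a' ma' aa'] acond [_ mP]; apply: ge_ereal_sup => _ [T [y [TW Ly yd ->]]].
have nu0 : 0 < nu by exact: lt_trans eta_lt_nu.
have tp0 : 0 < tp by exact: twopi_d_gt0.
have [TX TD] := TW; have [g [Tg mom]] := X2_represents (ltW nu0) TX.
have [mg goo] := represents_L2 Tg.
have Wgoo := nsq_Lambda_lty mg goo mom.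
have [g' [Lg' g'E mg']] := mP y Ly.
rewrite (dist_l2norm_Lambda_sub Tg Wgoo Lg' mg').
rewrite scaled_sqrt_le ?nsq_ge0 ?(ltW optimal_value_gt0)//.
have /L2P[my yoo] := Ly; have /L2P[mg'' g'oo] := Lg'.
have momle j : (moment nu j g <= tp%:E)%E.
  have := TD j; rewrite (dist_l2norm_D_nu Tg (mom j)) scaled_sqrt_le ?nsq_ge0//.
  by rewrite expr1n mulr1.
have gyd : (nsq (fun xi => g xi - y xi)%R <= (delta ^+ 2)%:E)%E.
  move: yd; rewrite (dist_l2norm_nsq (represents_sub Tg (represents_regular my yoo))).
  by rewrite sqrt_poweR_le ?nsq_ge0// ltW.
apply: (@le_trans _ _ (la2%:E * \sum_j moment nu j g +
    (tp * la1)%:E * nsq (fun xi => g xi - y xi)%R)%E).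
  apply: nsq_le_moment => //; try exact: cmeasB.
  - by apply: cmeasB => //; apply: cmeasM => //; exact: cmeas_Lambda_weight.
  - exact: ltW lambda2_gt0.
  - exact: ltW lambda1_gt0.
  apply: filterS2 g'E acond => xi -> ac.
  have [S0|Sn0] := eqVneq (sobolev_symbol nu xi) 0.
    have P0 := sobolev_symbol_eq0_psi d_gt0 eta_gt0 eta_lt_nu theta_gt0 theta_le S0.
    rewrite (_ : W xi * g xi - _ = W xi * (g xi - a xi * y xi)); last by rewrite /W/Lambda_weight; ring.
    rewrite normcM exprMn normc_Lambda_weight P0 mul0r.
    apply: addr_ge0; last exact: mulr_ge0 (ltW lambda1_gt0) (sqr_ge0 _).
    exact: mulr_ge0 (ltW lambda2_gt0) (mulr_ge0 (sobolev_symbol_ge0 _ _) (sqr_ge0 _)).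
  have Sp : 0 < sobolev_symbol nu xi by rewrite lt_neqAle eq_sym Sn0 sobolev_symbol_ge0.
  rewrite mulrA; apply: multiplier_error_le.
  - by rewrite mulr_gt0// lambda2_gt0.
  - exact: lambda1_gt0.
  - by rewrite normc_Lambda_weight.
rewrite -lambda_value EFinD; apply: leeD; rewrite [leRHS]EFinM; apply: lee_wpmul2l => //.
- by rewrite lee_fin ltW// lambda2_gt0.
- rewrite (_ : d%:R * tp = \sum_(j < d) tp); last by rewrite sumr_const card_ord mulr_natl.
  by rewrite -sumEFin; apply: lee_sum => j _.
- by rewrite lee_fin ltW// lambda1_gt0.
Qed.

(** A Borel representative of a makes the product Borel. It is square integrable because the second
    summand of the condition alone gives psi_theta^eta |a|^2 <= (2 pi)^d lambda_1. Respect for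
    almost everywhere equality follows from uniqueness of representing functions. *)
Lemma multiplier_method_exists a : lebesgue_cmeasurable a ->
  multiplier_condition theta eta nu delta a -> exists m, multiplier_method theta eta a m.
Proof.
move=> [a' ma' aa'] acond.
pose G y xi := a' xi * W xi * y xi.
have mG y : cmeas y -> cmeas (G y).
  by move=> my; do 2 apply: cmeasM => //; exact: cmeas_Lambda_weight.
have Goo y : cmeas y -> (nsq y < +oo)%E -> (nsq (G y) < +oo)%E.
  move=> my yoo.
  have m0 : cmeas ((fun=> 0) : E -> R[i]) by exact: cmeas_cst.
  (* [nsq_le_moment] with zero moment coefficient and g = 0: only the term in y is kept. *)
  apply: (@le_lt_trans _ _ (0%:E * \sum_j moment nu j (fun=> 0)%R + (tp * la1)%:E * nsq y)%E).
    apply: nsq_le_moment => //; [exact: mG|exact: ltW lambda1_gt0|].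
    apply: filterS2 aa' acond => xi ea ac; rewrite mul0r add0r.
    rewrite /G normcM exprMn ler_wpM2r ?sqr_ge0// normcM exprMn normc_Lambda_weight -ea.
    have := lambda1_gt0; set be := tp * la1 => be0.
    rewrite -(mul1r be) -ler_pdivrMr// mulrAC mulrC; apply: le_trans ac.
    rewrite ler_wpM2l ?powR_ge0// lerDr divr_ge0 ?sqr_ge0//.
    exact: mulr_ge0 (ltW lambda2_gt0) (sobolev_symbol_ge0 _ _).
  by rewrite mul0e add0e lte_mul_pinfty ?lee_fin ?(ltW lambda1_gt0).
pose m y := repr_L2 (inv_fourier (regular (G y))).
have mP y : L2 y -> represents (inv_fourier (regular (G y))) (m y).
  move=> /L2P[my yoo]; have [h [hr _]] := inv_fourier_represents (mG y my) (Goo y my yoo).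
  exact: repr_L2P hr.
exists m; split; first split.
- by move=> y Ly; have [] := mP y Ly.
- move=> y z Ly Lz yz; have ry := mP y Ly; have rz := mP z Lz.
  apply: represents_unique ry _; apply: eq_represents rz.
  have /L2P[my _] := Ly; have /L2P[mz _] := Lz.
  by apply: inv_fourier_ae; [exact: mG|exact: mG|apply: filterS yz => xi yzi; rewrite /G yzi].
move=> y Ly; have /L2P[my yoo] := Ly.
exists (G y); split.
- by apply/L2P; split; [exact: mG|exact: Goo].
- by apply: filterS aa' => xi ea; rewrite /G -ea.
- by move=> f sf; have [_ ->] := mP y Ly.
Qed.

(** The Wiener filter. Writing al = lambda_2 S and be = (2 pi)^d lambda_1, it minimises |1 - a|^2 /
    al + |a|^2 / be, with minimum 1 / (al + be), so the condition becomes psi_theta^eta <= al +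
    be. *)
Definition wiener_multiplier (xi : E) : R[i] :=
  ((tp * la1) / (tp * la1 + la2 * sobolev_symbol nu xi))%:C.

Lemma wiener_multiplier_cmeas : cmeas wiener_multiplier.
Proof.
apply: cmeas_real; apply: measurable_funM => //.
rewrite (_ : (fun _ => _) = fun xi => (tp * la1 + la2 * sobolev_symbol nu xi) `^ (-1)).
  apply: (measurableT_comp (@measurable_powR R _)); apply: measurable_funD => //.
  by apply: measurable_funM => //; exact: measurable_sobolev_symbol.
apply/funext => xi; rewrite powR_inv1// addr_ge0 ?(ltW lambda1_gt0)//.
by rewrite mulr_ge0 ?sobolev_symbol_ge0// ltW ?lambda2_gt0.
Qed.

Lemma wiener_multiplier_condition :
  multiplier_condition theta eta nu delta wiener_multiplier.
Proof.
apply: aeW => xi; have b0 := lambda1_gt0; have l0 := lambda2_gt0.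
have [S0|Sn0] := eqVneq (sobolev_symbol nu xi) 0.
  by rewrite (sobolev_symbol_eq0_psi d_gt0 eta_gt0 eta_lt_nu theta_gt0 theta_le S0) mul0r.
have Sp : 0 < sobolev_symbol nu xi by rewrite lt_neqAle eq_sym Sn0 sobolev_symbol_ge0.
have h := psi_powR_le_weighted d_gt0 eta_gt0 eta_lt_nu theta_gt0 theta_le xi rho_gt0.
rewrite -lambda2E -lambda1E in h.
rewrite -/(sobolev_symbol nu xi) -/la1 -/la2 -[(2 * pi) ^+ d]/tp /wiener_multiplier.
move: h b0; set be := tp * la1; set P := psi _ _ `^ _; set al := la2 * _ => h b0.
have a0 : 0 < al by rewrite mulr_gt0.
have s0 : 0 < be + al by rewrite addr_gt0.
have -> : 1 - (be / (be + al))%:C = (al / (be + al))%:C.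
  by rewrite -[1]/(1%:C) -rmorphB; congr _%:C; field; rewrite gt_eqF.
rewrite !normc_real !real_normK ?num_real//.
have -> : (al / (be + al)) ^+ 2 / al + (be / (be + al)) ^+ 2 / be = (be + al)^-1.
  by field; rewrite !gt_eqF.
by rewrite ler_pdivrMr// mul1r addrC.
Qed.

Lemma optimal_error_le : (@optimal_error R d theta eta nu delta <= optimal_value%:E)%E.
Proof.
have La : lebesgue_cmeasurable wiener_multiplier.
  by exists wiener_multiplier; [exact: wiener_multiplier_cmeas|exact: aeW].
have [m mm] := multiplier_method_exists La wiener_multiplier_condition.
apply: le_trans (multiplier_method_error La wiener_multiplier_condition mm).
by apply: ereal_inf_lbound; exists m => //; exact: mm.1.
Qed.

End upper_bound.

(** * The lower bound and the multiplicative inequality *)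

Section lower_bound.
Context {R : realType} {d : nat}.
Local Notation leb := (lebesgue_rV R d).
Local Notation E := 'rV[R]_d.
Implicit Types (f g h u v w y a : E -> R[i]) (T U : (E -> R[i]) -> R[i]).

Definition cube (lo hi : R) : set E := [set xi | forall i, `[lo, hi]%classic (xi ord0 i)].

Lemma measurable_cube lo hi : measurable (cube lo hi).
Proof.
rewrite (_ : cube lo hi = \big[setI/setT]_(i < d)
    ((fun xi : E => xi ord0 i) @^-1` `[lo, hi]%classic)).
  apply: bigsetI_measurable => i _; rewrite -[X in measurable X]setTI.
  exact: (@measurable_coord _ _ _ i measurableT _ (measurable_itv _)).
rewrite -bigcap_seq; apply/seteqP; split => xi /= h i; first by move=> _; exact: h.
by apply: h => /=; rewrite mem_index_enum.
Qed.

Lemma lebesgue_rV_cube lo hi : lo < hi -> leb (cube lo hi) = ((hi - lo) ^+ d)%:E.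
Proof.
move=> lh; rewrite /cube (@lebesgue_rV_box R d (fun=> `[lo, hi]%classic)).
  rewrite (eq_bigr (fun=> (hi - lo)%:E)); last first.
    by move=> i _; rewrite lebesgue_measure_itv/= lte_fin lh EFinB.
  by rewrite prodEFin prodr_const card_ord.
by move=> i; exact: measurable_itv.
Qed.

Definition cube_fun (c lo hi : R) (xi : E) : R[i] := (c * \1_(cube lo hi) xi)%:C.

Lemma cmeas_cube_fun c lo hi : cmeas (cube_fun c lo hi).
Proof.
apply: cmeas_real; apply: measurable_funM => //.
exact: measurable_indic (measurable_cube lo hi).
Qed.

Lemma normc_cube_fun c lo hi xi :
  normc (cube_fun c lo hi xi) ^+ 2 = c ^+ 2 * \1_(cube lo hi) xi.
Proof.
rewrite /cube_fun normc_real real_normK ?num_real// exprMn; congr (_ * _).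
by rewrite indicE; case: (_ \in _); rewrite ?expr1n ?expr0n.
Qed.

Lemma nsq_cube_fun c lo hi : lo < hi ->
  nsq (cube_fun c lo hi) = (c ^+ 2 * (hi - lo) ^+ d)%:E.
Proof.
move=> lh; rewrite /nsq; under eq_integral do rewrite normc_cube_fun EFinM.
have mI : measurable_fun setT (\1_(cube lo hi) : E -> R).
  exact: measurable_indic (measurable_cube lo hi).
rewrite ge0_integralZl//; [|exact/measurable_EFinP|by rewrite lee_fin sqr_ge0].
rewrite integral_indic//; last exact: measurable_cube.
by rewrite setIT [RHS]EFinM; congr (_ * _)%E; exact: lebesgue_rV_cube.
Qed.

Variables nu eta theta delta : R.
Hypotheses (d_gt0 : (0 < d)%N) (eta_gt0 : 0 < eta) (eta_lt_nu : eta < nu).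
Hypotheses (theta_gt0 : 0 < theta) (theta_le : theta <= 2 * nu).
Hypothesis delta_gt0 : 0 < delta.

Let W := @Lambda_weight R d theta eta.
Let tp : R := twopi_d d.
Let rho : R := tp / delta ^+ 2.
Let V : R := @optimal_value R d nu eta theta delta.

(* As [q] tends to 1 the spectrum concentrates at a point where all the
   [|xi_j|^(2 nu)] equal [rho], the equality case of both the power mean and the
   arithmetic-geometric mean inequalities. *)
Lemma extremal_function q : 0 < q < 1 -> exists g, [/\ cmeas g,
  nsq g = (delta ^+ 2)%:E, forall j, (moment nu j g <= tp%:E)%E &
  ((q * (tp * V ^+ 2))%:E <= nsq (fun xi => W xi * g xi)%R)%E].
Proof.
move=> /andP[q0 q1].
have nu0 : 0 < nu by exact: lt_trans eta_lt_nu.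
have d0 : 0 < d%:R :> R by rewrite ltr0n.
have tp0 : 0 < tp by exact: twopi_d_gt0.
have rho0 : 0 < rho by exact: rho_gt0.
(* The spectrum fills the cube [s r, r]^d. The upper end r, with r^(2 nu) = rho, keeps the moments
   admissible; the lower end s r, with s^(2 eta) = q, costs only the factor q in psi_theta^eta. *)
pose s := q `^ (2 * eta)^-1; pose r := rho `^ (2 * nu)^-1.
have s0 : 0 < s by exact: powR_gt0.
have r0 : 0 < r by exact: powR_gt0.
have eta2 : 2 * eta != 0 by rewrite gt_eqF// mulr_gt0.
have sq : s `^ (2 * eta) = q by rewrite -powRrM mulVf// powRr1// ltW.
have s1 : s < 1.
  rewrite ltNge; apply/negP => s1.
  have e2 : 0 <= 2 * eta by rewrite mulr_ge0// ltW.
  have := ge0_ler_powR e2 _ _ s1; rewrite sq powR1 !nnegrE ler01 (ltW s0).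
  by rewrite leNgt q1 => /(_ isT isT).
have rr : r `^ (2 * nu) = rho.
  by rewrite -powRrM mulVf ?powRr1 ?(ltW rho0)// gt_eqF// mulr_gt0.
have sr : s * r < r by rewrite gtr_pMl.
have vol0 : 0 < (r - s * r) ^+ d by rewrite exprn_gt0// subr_gt0.
pose c := delta / Num.sqrt ((r - s * r) ^+ d).
have c2 : c ^+ 2 * (r - s * r) ^+ d = delta ^+ 2.
  by rewrite expr_div_n sqr_sqrtr ?(ltW vol0)// divfK// gt_eqF.
pose g := cube_fun c (s * r) r.
have mg : cmeas g by exact: cmeas_cube_fun.
have ng : nsq g = (delta ^+ 2)%:E by rewrite nsq_cube_fun// c2.
have gc (xi : E) : cube (s * r) r xi \/ g xi = 0.
  have [h|h] := pselect (cube (s * r) r xi); [by left|right].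
  by rewrite /g /cube_fun indicE memNset// mulr0.
have m2 := cmeas_normc2 mg.
exists g; split => //.
- move=> j; have -> : tp = rho * delta ^+ 2 by rewrite /rho divfK// gt_eqF// exprn_gt0.
  rewrite EFinM -ng -ge0_integralZl//; last 2 first.
  + by move=> xi _; rewrite lee_fin sqr_ge0.
  + by rewrite lee_fin ltW.
  apply: ge0_le_integral => //.
  + by move=> xi _; rewrite lee_fin sqr_ge0.
  + by apply: cmeas_normc2; apply: cmeasM => //; exact: cmeas_ipow.
  + exact: emeasurable_funM.
  move=> xi _; rewrite -EFinM lee_fin normcM exprMn.
  have [xic|->] := gc xi; last by rewrite normc0 expr0n !mulr0.
  rewrite ler_wpM2r ?sqr_ge0// normc_ipow -powR_mulrn ?powR_ge0// -powRrM mulrC -rr.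
  have := xic j; rewrite /= in_itv/= => /andP[lo hi].
  have x0 : 0 <= xi ord0 j by apply: le_trans lo; rewrite mulr_ge0// ltW.
  by rewrite ger0_norm// ge0_ler_powR ?nnegrE// ?(ltW r0)// mulr_ge0// ltW.
- have kp : (0 < eta / nu) by exact: (andP (exponent_itv eta_gt0 eta_lt_nu)).1.
  have rk : r `^ (2 * eta) = rho `^ (eta / nu).
    by rewrite -rr -powRrM; congr (_ `^ _); field; rewrite gt_eqF.
  have -> : q * (tp * V ^+ 2) =
      d%:R `^ (2 * eta / theta) * (s * r) `^ (2 * eta) * delta ^+ 2.
    rewrite powRM ?(ltW s0) ?(ltW r0)// sq rk.
    rewrite -(mulr_powRB1 (ltW rho0) kp) /V optimal_value_sqr// -/tp -/rho.
    rewrite (_ : delta ^+ 2 = tp / rho); first by field; rewrite gt_eqF.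
    by rewrite /rho invfM invrK mulrA mulfV ?mul1r// gt_eqF.
  rewrite EFinM -ng -ge0_integralZl//; last 2 first.
  + by move=> xi _; rewrite lee_fin sqr_ge0.
  + by rewrite lee_fin mulr_ge0// powR_ge0.
  apply: ge0_le_integral => //.
  + by move=> xi _; rewrite -EFinM lee_fin mulr_ge0 ?sqr_ge0// mulr_ge0 ?powR_ge0.
  + exact: emeasurable_funM.
  + by apply: cmeas_normc2; apply: cmeasM => //; exact: cmeas_Lambda_weight.
  move=> xi _; rewrite -EFinM lee_fin normcM exprMn normc_Lambda_weight.
  have [xic|->] := gc xi; last by rewrite normc0 expr0n !mulr0.
  rewrite ler_wpM2r ?sqr_ge0// /psi -powRrM.
  have -> : d%:R `^ (2 * eta / theta) * (s * r) `^ (2 * eta) =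
      (d%:R * (s * r) `^ theta) `^ (2 / theta * eta).
    rewrite [RHS]powRM ?powR_ge0// -[((s * r) `^ theta) `^ _]powRrM.
    by congr (_ * _); congr (_ `^ _); [ring|field; rewrite gt_eqF].
  have p0 : 0 <= 2 / theta * eta by rewrite mulr_ge0 ?divr_ge0// ltW.
  apply: ge0_ler_powR; rewrite ?nnegrE; first exact: p0.
  - exact: mulr_ge0 (ltW d0) (powR_ge0 _ _).
  - by apply: sumr_ge0 => j _; exact: powR_ge0.
  rewrite (_ : d%:R * _ = \sum_(j < d) (s * r) `^ theta); last first.
    by rewrite sumr_const card_ord mulr_natl.
  apply: ler_sum => j _; have := xic j; rewrite /= in_itv/= => /andP[lo _].
  have x0 : 0 <= s * r by rewrite mulr_ge0// ltW.
  by rewrite ge0_ler_powR ?nnegrE// ?(ltW theta_gt0)// (le_trans lo)// ler_norm.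
Qed.

Lemma sqr_le_from_below (x e : R) : (forall q, 0 < q < 1 -> q * x <= e) -> 0 <= x -> x <= e.
Proof.
move=> qx x0; rewrite leNgt; apply/negP => ex.
have e0 : 0 <= e.
  by apply: le_trans (qx 2^-1 _); rewrite ?mulr_ge0// invr_gt0 ltr0n/= invf_lt1// ltr1n.
have xp : 0 < x by exact: le_lt_trans ex.
(* The midpoint of e / x and 1 is a value of q for which q x > e. *)
have : 0 < (e / x + 1) / 2 < 1.
  rewrite divr_gt0 ?ltr_wpDl ?divr_ge0//= ltr_pdivrMr// mul1r (_ : 2 = 1 + 1)// ltrD2r.
  by rewrite ltr_pdivrMr// mul1r.
move=> /qx; rewrite leNgt => /negP; apply.
rewrite (_ : _ * x = (e + x) / 2); last by field; rewrite gt_eqF.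
by rewrite ltr_pdivlMr// mulr_natr mulr2n ltrD2l.
Qed.

Lemma W2_surj g : cmeas g -> nsq g = (delta ^+ 2)%:E ->
  (forall j, (moment nu j g <= tp%:E)%E) ->
  exists T, W2 nu T /\ represents (fourier T) g.
Proof.
move=> mg ng mom.
have goo : (nsq g < +oo)%E by rewrite ng ltry.
have momoo j : (moment nu j g < +oo)%E by apply: le_lt_trans (mom j) (ltry _).
have [T [TX Tg]] := X2_surj mg goo momoo.
exists T; split => //; split => // j.
by rewrite (dist_l2norm_D_nu Tg (momoo j)) scaled_sqrt_le ?nsq_ge0// expr1n mulr1.
Qed.

(* The data [y = 0] is compatible with both [g] and [- g]. *)
Lemma method_error_ge m e : is_method m -> 0 <= e ->
  (@method_error R d theta eta nu delta m <= e%:E)%E -> V <= e.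
Proof.
move=> [mL2 _] e0 me.
have V0 : 0 < V by exact: optimal_value_gt0.
have tp0 : 0 < tp by exact: twopi_d_gt0.
rewrite -(@ler_pXn2r _ 2) ?nnegrE ?(ltW V0)//; apply: sqr_le_from_below (sqr_ge0 _) => q q01.
have [g [mg ng mom Wg]] := extremal_function q01.
have goo : (nsq g < +oo)%E by rewrite ng ltry.
have momoo j : (moment nu j g < +oo)%E by apply: le_lt_trans (mom j) (ltry _).
have Wgoo := nsq_Lambda_lty d_gt0 eta_gt0 eta_lt_nu theta_gt0 theta_le mg goo momoo.
have mW := @cmeas_Lambda_weight R d theta eta.
have mWg : cmeas (fun xi => W xi * g xi) by exact: cmeasM.
have z0 : cmeas ((fun=> 0) : E -> R[i]) by exact: cmeas_cst.
have zoo : (nsq ((fun=> 0%R) : E -> R[i]) < +oo)%E.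
  rewrite /nsq (eq_integral (fun=> 0%E)) ?integral0//.
  by move=> x _; rewrite normc0 expr0n.
have Lz : L2 ((fun=> 0) : E -> R[i]) by exact/L2P.
have /L2P[mm moo] := mL2 _ Lz.
have bound f : cmeas f -> (forall xi, normc (f xi) = normc (g xi)) ->
    exists h, represents (inv_fourier (regular (fun xi => W xi * f xi))) h /\
      (nsq (fun x => h x - m (fun=> 0%R) x)%R <= (e ^+ 2)%:E)%E.
  move=> mf fg.
  have nf w : nsq (fun xi => w xi * f xi) = nsq (fun xi => w xi * g xi).
    by apply: eq_integral => x _; rewrite !normcM fg.
  have nf0 : nsq f = (delta ^+ 2)%:E.
    by rewrite -ng; apply: eq_integral => x _; rewrite fg.
  have [T [TW Tf]] : exists T, W2 nu T /\ represents (fourier T) f.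
    by apply: W2_surj => // j; rewrite /moment nf; exact: mom.
  have mWf : cmeas (fun xi => W xi * f xi) by exact: cmeasM.
  have Wfoo : (nsq (fun xi => W xi * f xi)%R < +oo)%E by rewrite nf.
  have [h [hr _]] := inv_fourier_represents mWf Wfoo.
  exists h; split => //.
  have hT : represents (Lambda theta eta T) h.
    apply: eq_represents hr; rewrite LambdaE; exact: inv_fourier_mul_L2.
  rewrite -sqrt_poweR_le ?nsq_ge0//.
  rewrite -(dist_l2norm_nsq (represents_sub hT (represents_regular mm moo))).
  apply: le_trans me; apply: ereal_sup_ubound; exists T, (fun=> 0); split => //.
  rewrite (dist_l2norm_nsq (represents_sub Tf (represents_regular z0 zoo))).
  rewrite sqrt_poweR_le ?nsq_ge0 ?(ltW delta_gt0)// -nf0 le_eqVlt; apply/orP; left.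
  by apply/eqP; apply: eq_integral => x _; rewrite subr0.
have [h [hr he]] := bound g mg (fun=> erefl).
have mgN : cmeas (fun xi => - g xi) by exact: cmeasN.
have [k [kr ke]] := bound _ mgN (fun xi => normcN _).
have [mh hoo] := represents_L2 hr; have [mk koo] := represents_L2 kr.
have mWgN : cmeas (fun xi => W xi * - g xi) by exact: cmeasM.
have WgNoo : (nsq (fun xi => W xi * - g xi)%R < +oo)%E.
  rewrite (_ : nsq _ = nsq (fun xi => W xi * g xi))//.
  by apply: eq_integral => x _; rewrite mulrN normcN.
have hk : nsq (fun x => h x - k x) =
    ((tp^-1)%:E * (4%:E * nsq (fun xi => W xi * g xi)%R))%E.
  have [l [lr lE]] := inv_fourier_represents (cmeasB mWg mWgN) (nsqB_lty mWg mWgN Wgoo WgNoo).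
  have r1 := eq_represents (inv_fourier_subr mWg mWgN Wgoo WgNoo) lr.
  rewrite (ae_eq_nsq (cmeasB mh mk) (represents_L2 lr).1); last first.
    exact: represents_unique (represents_sub hr kr) r1.
  rewrite lE; congr (_ * _)%E.
  transitivity (nsq (fun xi => 2%:R%:C * (W xi * g xi))%R).
    congr nsq; apply/funext => xi; rewrite mulrN opprK.
    by rewrite -[2%:R]/(1 + 1) rmorphD rmorph1 mulrDl mul1r.
  by rewrite nsqZ// normc_real ger0_norm// expr2 -natrM.
(* Both images lie within e of the same element m(0). The resulting 4 e^2 matches the factor 4 in
   [hk], so nothing is lost. *)
have hkm : (nsq (fun x => h x - k x)%R <= (2 * e ^+ 2 + 2 * e ^+ 2)%:E)%E.
  rewrite (_ : nsq _ = nsq (fun x => (h x - m (fun=> 0) x) - (k x - m (fun=> 0) x))).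
    by apply: nsqB_le => //; exact: cmeasB.
  by apply: eq_integral => x _; rewrite opprB addrA subrK.
have : ((tp^-1)%:E * (4%:E * (q * (tp * V ^+ 2))%:E) <= (2 * e ^+ 2 + 2 * e ^+ 2)%:E)%E.
  apply: le_trans hkm; rewrite hk lee_wpmul2l ?lee_fin ?invr_ge0 ?(ltW tp0)//.
  by rewrite lee_wpmul2l// lee_fin.
rewrite -!EFinM lee_fin (_ : tp^-1 * _ = 4 * (q * V ^+ 2)); last by field; rewrite gt_eqF.
by lra.
Qed.

Lemma optimal_error_ge : (V%:E <= @optimal_error R d theta eta nu delta)%E.
Proof.
have V0 : ~ (V <= 0) by rewrite leNgt optimal_value_gt0.
apply: le_ereal_inf_tmp => _ [m mm <-].
(* A priori the error is an extended real of any sign. The values -oo and e < 0 are excluded by the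
   bound at e = 0, which would give V <= 0. *)
case E : (method_error theta eta nu delta m) => [e| |]; last 2 first.
- exact: leey.
- by case: V0; apply: (method_error_ge mm (lexx 0)); rewrite E leNye.
have [e0|e0] := leP 0 e; first by rewrite lee_fin (method_error_ge mm)// E.
by case: V0; apply: (method_error_ge mm (lexx 0)); rewrite E lee_fin ltW.
Qed.

(** The extremal functions have |Fx| = delta and derivatives of norm at most 1, so the inequality
    with constant c bounds their image by c delta^(1 - eta / nu), while its norm comes arbitrarily
    close to the optimal value. *)
Lemma multiplicative_inequality_sharp c : multiplicative_inequality d theta eta nu c ->
  @sharp_constant R d nu eta theta <= c.
Proof.
move=> cP; have V0 : 0 < V by exact: optimal_value_gt0.
have S0 : 0 < @sharp_constant R d nu eta theta by exact: sharp_constant_gt0.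
have tp0 : 0 < tp by exact: twopi_d_gt0.
pose t := delta `^ (1 - eta / nu); have t0 : 0 < t by exact: powR_gt0.
(* The sign of c is not given; the maximum with 0 makes multiplication by it monotone, and the
   positivity of the sharp constant brings c back. *)
pose b := Num.max c 0; have b0 : 0 <= b by rewrite le_max lexx orbT.
suff : @sharp_constant R d nu eta theta <= b by rewrite le_max (leNgt _ 0) S0 orbF.
rewrite -(ler_pM2r t0) -optimal_value_sharp// -/V.
rewrite -(@ler_pXn2r _ 2) ?nnegrE ?(ltW V0) ?mulr_ge0 ?(ltW t0)//.
apply: sqr_le_from_below (sqr_ge0 _) => q q01.
have [g [mg ng mom Wg]] := extremal_function q01.
have goo : (nsq g < +oo)%E by rewrite ng ltry.
have momoo j : (moment nu j g < +oo)%E by apply: le_lt_trans (mom j) (ltry _).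
have Wgoo := nsq_Lambda_lty d_gt0 eta_gt0 eta_lt_nu theta_gt0 theta_le mg goo momoo.
have [T [[TX TD] Tg]] := W2_surj mg ng mom.
have := cP T TX; rewrite (dist_l2norm_Lambda Tg Wgoo).
have -> : dist_l2norm (fourier T) = delta%:E.
  by rewrite (dist_l2norm_nsq Tg) ng poweR_EFin powR12_sqrt ?sqr_ge0// sqrtr_sqr gtr0_norm.
set M := \big[maxe/0%E]_j _.
have M0 : (0 <= M)%E by exact: bigmax_ge_id.
have M1 : (M <= 1)%E by apply: bigmax_le => // j _; exact: TD.
have Mk : (M `^ (eta / nu) <= 1)%E.
  have /andP[k0 _] := exponent_itv eta_gt0 eta_lt_nu.
  case: M M0 M1 => [r| |]//=; rewrite !lee_fin => r0 r1.
  apply: (@le_trans _ _ (1 `^ (eta / nu))); last by rewrite powR1.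
  by rewrite ge0_ler_powR ?nnegrE// ltW.
move=> h; have {h} : ((((twopi_d d)^-1)%:E * nsq (fun xi => W xi * g xi)%R) `^ 2^-1 <= (b * t)%:E)%E.
  apply: le_trans h _; rewrite poweR_EFin -/t -EFinM.
  apply: (@le_trans _ _ ((b * t)%:E * M `^ (eta / nu))%E).
    by rewrite lee_wpmul2r ?poweR_ge0// lee_fin ler_wpM2r ?(ltW t0)// le_max lexx.
  by rewrite -[leRHS]mule1 lee_wpmul2l// lee_fin mulr_ge0// ltW.
rewrite scaled_sqrt_le ?nsq_ge0 ?mulr_ge0 ?(ltW t0)// -/tp => /(le_trans Wg).
by rewrite lee_fin mulrCA ler_pM2l.
Qed.

Lemma multiplicative_inequality_holds :
  multiplicative_inequality d theta eta nu (@sharp_constant R d nu eta theta).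
Proof.
move=> T TX; have nu0 : 0 < nu by exact: lt_trans eta_lt_nu.
have k01 := exponent_itv eta_gt0 eta_lt_nu; have /andP[k0 k1] := k01.
have d0 : 0 < d%:R :> R by rewrite ltr0n.
have tp0 : 0 < tp by exact: twopi_d_gt0.
have S0 : 0 < @sharp_constant R d nu eta theta by exact: sharp_constant_gt0.
have [g [Tg mom]] := X2_represents (ltW nu0) TX; have [mg goo] := represents_L2 Tg.
have Wgoo := nsq_Lambda_lty d_gt0 eta_gt0 eta_lt_nu theta_gt0 theta_le mg goo mom.
rewrite (dist_l2norm_Lambda Tg Wgoo) (dist_l2norm_nsq Tg).
have [A AE A0] : exists2 A, nsq g = A%:E & 0 <= A.
  exists (fine (nsq g)); first by rewrite fineK// ge0_fin_numE ?nsq_ge0.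
  by rewrite fine_ge0 ?nsq_ge0.
pose D j := Num.sqrt (tp^-1 * fine (moment nu j g)).
have mE j : moment nu j g = (fine (moment nu j g))%:E.
  by rewrite fineK// ge0_fin_numE ?nsq_ge0.
have DE j : dist_l2norm (D_nu nu j T) = (D j)%:E.
  rewrite (dist_l2norm_D_nu Tg (mom j)) mE -EFinM poweR_EFin powR12_sqrt//.
  by rewrite mulr_ge0 ?invr_ge0 ?(ltW tp0)// fine_ge0 ?nsq_ge0.
under eq_bigr do rewrite DE.
rewrite EFin_bigmax; set M := \big[Num.max/0]_j _.
have M0 : 0 <= M by exact: bigmax_ge_id.
have momle j : (moment nu j g <= (tp * M ^+ 2)%:E)%E.
  rewrite -scaled_sqrt_le ?nsq_ge0// -(dist_l2norm_D_nu Tg (mom j)) DE lee_fin.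
  exact: le_bigmax.
rewrite AE poweR_EFin powR12_sqrt// !poweR_EFin -!EFinM.
rewrite scaled_sqrt_le ?nsq_ge0//; last first.
  exact: mulr_ge0 (mulr_ge0 (ltW S0) (powR_ge0 _ _)) (powR_ge0 _ _).
have [B BE] : exists B, nsq (fun xi => W xi * g xi) = B%:E.
  by exists (fine (nsq (fun xi => W xi * g xi))); rewrite fineK// ge0_fin_numE ?nsq_ge0.
rewrite -/W BE lee_fin -/tp.
pose G := d%:R `^ (2 * eta / theta) : R; have G0 : 0 < G by exact: powR_gt0.
(* The weighted inequality divided by (2 pi)^d d^(2 eta / theta), in the form that
   [powR_weighted_agm_le] optimises over r with s = M^2 and t = A / (2 pi)^d. *)
have BG r : 0 < r -> B / (G * tp) <=
    eta / nu * r `^ (eta / nu - 1) * M ^+ 2 + (1 - eta / nu) * r `^ (eta / nu) * (A / tp).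
  move=> r0; rewrite ler_pdivrMr ?mulr_gt0// -lee_fin -BE.
  apply: le_trans (nsq_Lambda_le d_gt0 eta_gt0 eta_lt_nu theta_gt0 theta_le mg r0) _.
  have hm : (\sum_j moment nu j g <= (d%:R * (tp * M ^+ 2))%:E)%E.
    rewrite (_ : d%:R * _ = \sum_(j < d) tp * M ^+ 2); last first.
      by rewrite sumr_const card_ord mulr_natl.
    by rewrite -sumEFin; apply: lee_sum => j _.
  rewrite AE; apply: (@le_trans _ _ ((eta / nu * d%:R `^ (2 * eta / theta - 1) * r `^ (eta / nu - 1))%:E *
    (d%:R * (tp * M ^+ 2))%:E + (G * (1 - eta / nu) * r `^ (eta / nu))%:E * A%:E)%E).
    rewrite leeD2r// lee_wpmul2l// lee_fin.
    exact: mulr_ge0 (mulr_ge0 (ltW k0) (powR_ge0 _ _)) (powR_ge0 _ _).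
  rewrite -!EFinM -EFinD lee_fin le_eqVlt; apply/orP; left; apply/eqP.
  have -> : d%:R `^ (2 * eta / theta - 1) = G / d%:R :> R.
    by rewrite powRB ?(gt_eqF d0) ?implybT// powRr1// ltW.
  by field; rewrite !gt_eqF.
have := powR_weighted_agm_le k01 (sqr_ge0 M) (divr_ge0 A0 (ltW tp0)) BG.
rewrite ler_pdivrMr ?mulr_gt0// => /le_trans; apply.
rewrite le_eqVlt; apply/orP; left; apply/eqP.
have := @sharp_constant_sqr R d nu eta theta; rewrite -/G -/tp.
move: (sharp_constant _ _ _) => Sc Sc2; rewrite !exprMn Sc2.
rewrite (powR_sqr _ M0) (powR_sqr _ (sqrtr_ge0 A)) sqr_sqrtr//.
have -> : (A / tp) `^ (1 - eta / nu) = A `^ (1 - eta / nu) / tp `^ (1 - eta / nu).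
  rewrite powRM ?invr_ge0 ?(ltW tp0)//; congr (_ * _).
  by rewrite -(powR_inv1 (ltW tp0)) -powRrM mulN1r powRN.
by ring.
Qed.

End lower_bound.

Unset Implicit Arguments.
Set Strict Implicit.
Set Printing Implicit Defensive.

Theorem theorem7 (R : realType) (d : nat) (nu eta theta delta : R)
    (d_gt0 : (0 < d)%N) (eta_gt0 : 0 < eta) (eta_lt_nu : eta < nu)
    (nu_ge1 : 1 <= nu) (theta_gt0 : 0 < theta) (theta_le : theta <= 2 * nu)
    (delta_gt0 : 0 < delta) :
  [/\ @optimal_error R d theta eta nu delta =
        (d%:R `^ (eta / theta) *
         (delta / (2 * pi) `^ (d%:R / 2)) `^ (1 - eta / nu))%:E,
      (forall a : 'rV[R]_d -> R[i],
         lebesgue_cmeasurable a ->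
         multiplier_condition theta eta nu delta a ->
         (exists m, multiplier_method theta eta a m) /\
         (forall m, multiplier_method theta eta a m ->
            optimal_method theta eta nu delta m)),
      multiplicative_inequality d theta eta nu
        (d%:R `^ (eta / theta) / (2 * pi) `^ (d%:R * (1 - eta / nu) / 2)) &
      (forall c : R, multiplicative_inequality d theta eta nu c ->
         d%:R `^ (eta / theta) / (2 * pi) `^ (d%:R * (1 - eta / nu) / 2) <= c)].
Proof.
split.
- by apply/eqP; rewrite eq_le; apply/andP; split;
    [exact: optimal_error_le|exact: optimal_error_ge].
- move=> a La ca; split; first exact: (@multiplier_method_exists R d nu eta theta delta).
  move=> m mm; split; first exact: mm.1.
  apply/eqP; rewrite eq_le; apply/andP; split.
    apply: (@le_trans _ _ (@optimal_value R d nu eta theta delta)%:E).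
      exact: multiplier_method_error La ca mm.
    exact: optimal_error_ge.
  by apply: ereal_inf_lbound; exists m => //; exact: mm.1.
- exact: multiplicative_inequality_holds.
- by move=> c; exact: (@multiplicative_inequality_sharp R d nu eta theta delta).
Qed.
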